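(* There exists a simple, nuclear, and non-$\mathcal{Z}$-stable $C^*$-algebra which is not tensorially prime.
   Context: $\mathcal{Z}$ is the Jiang-Su algebra; a $C^*$-algebra $A$ is $\mathcal{Z}$-stable if $A\otimes\mathcal{Z}\cong A$ (minimal tensor product). A simple $C^*$-algebra is tensorially prime if it cannot be written as a tensor product $C\otimes D$ where both $C$ and $D$ are simple and non-type-I. *)

(* Defs.v *)
From HB Require Import structures.
From mathcomp Require Import all_boot all_order all_algebra.
From mathcomp Require Import complex mxtens.
From mathcomp Require Import all_classical all_reals all_analysis.

Set Implicit Arguments.
Unset Strict Implicit.
Unset Printing Implicit Defensive.

Import Order.TTheory GRing.Theory Num.Theory.
Import numFieldNormedType.Exports.

Local Open Scope classical_set_scope.
Local Open Scope ring_scope.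
Local Open Scope complex_scope.

(* C*-algebras are complex and not assumed unital (whence the separate
   product [cmul]).  Norms take their values in the nonnegative reals of R[i],
   as for every normed module over R[i]. *)
HB.mixin Record isCStarAlgebra (R : realType) (A : Type)
    of CompleteNormedModule R[i] A := {
  cmul : A -> A -> A ;
  star : A -> A ;
  cmulA : associative cmul ;
  cmulDl : left_distributive cmul +%R ;
  cmulDr : right_distributive cmul +%R ;
  cmulZl : forall (k : R[i]) (x y : A), cmul (k *: x) y = k *: cmul x y ;
  cmulZr : forall (k : R[i]) (x y : A), cmul x (k *: y) = k *: cmul x y ;
  starK : involutive star ;
  starD : {morph star : x y / x + y} ;
  starZ : forall (k : R[i]) (x : A), star (k *: x) = Num.conj k *: star x ;
  starM : forall x y : A, star (cmul x y) = cmul (star y) (star x) ;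
  norm_cmul : forall x y : A, `|cmul x y| <= `|x| * `|y| ;
  norm_star_cmul : forall x : A, `|cmul (star x) x| = `|x| ^+ 2
}.

#[short(type="cstarAlgType")]
HB.structure Definition CStarAlgebra (R : realType) :=
  {A of isCStarAlgebra R A & CompleteNormedModule R[i] A}.

Notation "x ** y" := (cmul x y) (at level 40, left associativity) : ring_scope.

(* The inner product is linear in its first variable. *)
HB.mixin Record isHilbert (R : realType) (H : Type)
    of CompleteNormedModule R[i] H := {
  dot : H -> H -> R[i] ;
  dotDl : forall x y z : H, dot (x + y) z = dot x z + dot y z ;
  dotZl : forall (k : R[i]) (x y : H), dot (k *: x) y = k * dot x y ;
  dotC : forall x y : H, dot x y = Num.conj (dot y x) ;
  dot_norm : forall x : H, dot x x = `|x| ^+ 2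
}.

#[short(type="hilbertType")]
HB.structure Definition Hilbert (R : realType) :=
  {H of isHilbert R H & CompleteNormedModule R[i] H}.

Definition lin_span (K : numFieldType) (V : lmodType K) (S : set V) : set V :=
  [set x | exists (n : nat) (c : 'I_n -> K) (v : 'I_n -> V),
     (forall i, S (v i)) /\ x = \sum_i c i *: v i].

Section CStarAlgebras.
Context {R : realType}.
Implicit Types A B C D Z : cstarAlgType R.

Definition closed_ideal A (I : set A) : Prop :=
  [/\ closed I, I 0,
      (forall (k : R[i]) x y, I x -> I y -> I (k *: x + y)) &
      (forall x y, I x -> I (x ** y) /\ I (y ** x))].

Definition simple_cstar A : Prop :=
  (exists x : A, x <> 0) /\
  (forall I : set A, closed_ideal I -> I = [set 0] \/ I = setT).

Definition star_hom A B (f : A -> B) : Prop :=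
  [/\ linear f, {morph f : x y / x ** y} & {morph f : x / star x}].

Definition is_unit A (e : A) : Prop := forall x, e ** x = x /\ x ** e = x.

(* Elements of the algebraic tensor product of A and B are represented by
   formal sums [:: (a1, b1); ...; (an, bn)]; two of them are equal in the
   tensor product iff no bilinear map separates them. *)
Definition tens_eq A B (u v : seq (A * B)) : Prop :=
  forall (V : lmodType R[i]) (f : {bilinear A -> B -> V}),
    \sum_(x <- u) f x.1 x.2 = \sum_(x <- v) f x.1 x.2.

Definition tens_scale A B (k : R[i]) (u : seq (A * B)) : seq (A * B) :=
  [seq (k *: x.1, x.2) | x <- u].

Definition tens_mul A B (u v : seq (A * B)) : seq (A * B) :=
  [seq (x.1 ** y.1, x.2 ** y.2) | x <- u, y <- v].

Definition tens_star A B (u : seq (A * B)) : seq (A * B) :=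
  [seq (star x.1, star x.2) | x <- u].

Record tensor_cstar_norm A B (N : seq (A * B) -> R[i]) : Prop := {
  tensN_wd : forall u v, tens_eq u v -> N u = N v ;
  tensN_ge0 : forall u, 0 <= N u ;
  tensN_eq0 : forall u, N u = 0 -> tens_eq u [::] ;
  tensN_add : forall u v, N (u ++ v) <= N u + N v ;
  tensN_scale : forall k u, N (tens_scale k u) = `|k| * N u ;
  tensN_mul : forall u v, N (tens_mul u v) <= N u * N v ;
  tensN_star : forall u, N (tens_mul (tens_star u) u) = N u ^+ 2
}.

(* A C*-norm always exists (the spatial one), so only uniqueness is stated. *)
Definition nuclear A : Prop :=
  forall B (N N' : seq (A * B) -> R[i]),
    tensor_cstar_norm N -> tensor_cstar_norm N' -> N = N'.

Definition bounded_op (H : hilbertType R) (T : H -> H) : Prop :=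
  linear T /\ continuous T.

Record representation A (H : hilbertType R) (pi : A -> H -> H) : Prop := {
  repr_bounded : forall a, bounded_op (pi a) ;
  repr_linear : forall (k : R[i]) a b x,
    pi (k *: a + b) x = k *: pi a x + pi b x ;
  repr_mul : forall a b x, pi (a ** b) x = pi a (pi b x) ;
  repr_star : forall a x y, dot (pi a x) y = dot x (pi (star a) y)
}.

Definition faithful_repr A (H : hilbertType R) (pi : A -> H -> H) : Prop :=
  representation pi /\ injective pi.

(* T, with elementary tensors tau x y, is the Hilbert space tensor product of
   H and K. *)
Definition hilbert_tensor (H K T : hilbertType R)
    (tau : {bilinear H -> K -> T}) : Prop :=
  (forall x x' y y', dot (tau x y) (tau x' y') = dot x x' * dot y y') /\
  closure (lin_span [set z | exists x y, z = tau x y]) = setT.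

(* A is isomorphic to the minimal (spatial) tensor product of C and D, i.e. to
   the closed span of the operators pi c (x) rho d on the Hilbert space tensor
   product of H and K, where pi and rho are faithful representations of C and D
   on H and K; sigma identifies A with this algebra of operators and t c d is
   the element of A corresponding to c (x) d. *)
Definition min_tensor C D A : Prop :=
  exists (H K T : hilbertType R)
    (pi : C -> H -> H) (rho : D -> K -> K) (sigma : A -> T -> T)
    (tau : {bilinear H -> K -> T}) (t : C -> D -> A),
  [/\ faithful_repr pi, faithful_repr rho, faithful_repr sigma &
      hilbert_tensor tau] /\
  [/\ (forall c d x y, sigma (t c d) (tau x y) = tau (pi c x) (rho d y)) &
      closure (lin_span [set a | exists c d, a = t c d]) = setT].

Definition commutant (H : hilbertType R) (S : set (H -> H)) : set (H -> H) :=
  [set T | bounded_op T /\ forall s, S s -> T \o s = s \o T].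

Definition projection (H : hilbertType R) (p : H -> H) : Prop :=
  [/\ bounded_op p, p \o p = p & forall x y, dot (p x) y = dot x (p y)].

(* The von Neumann algebra M is of type I: each nonzero central projection of M
   dominates a nonzero abelian projection of M. *)
Definition type_I_vN (H : hilbertType R) (M : set (H -> H)) : Prop :=
  forall z, M z -> projection z -> (forall s, M s -> z \o s = s \o z) ->
    z <> cst 0 ->
  exists e, [/\ M e, projection e, e <> cst 0, z \o e = e &
    forall s s', M s -> M s' ->
      (e \o s \o e) \o (e \o s' \o e) = (e \o s' \o e) \o (e \o s \o e)].

Definition type_I A : Prop :=
  forall (H : hilbertType R) (pi : A -> H -> H), representation pi ->
    type_I_vN (commutant (commutant (range pi))).

Definition tensorially_prime A : Prop :=
  ~ exists C D, [/\ simple_cstar C, simple_cstar D, ~ type_I C, ~ type_I D &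
                  min_tensor C D A].

Definition dim_drop_fun (p q : nat) (f : R -> 'M[R[i]]_(p * q)) : Prop :=
  [/\ {within `[0, 1], continuous (f : R -> 'M[R[i]^o]_(p * q))},
      (exists M : 'M[R[i]]_p, f 0 = M *t (1%:M : 'M[R[i]]_q)) &
      (exists N : 'M[R[i]]_q, f 1 = (1%:M : 'M[R[i]]_p) *t N)].

(* B is isomorphic to the prime dimension drop algebra of the continuous
   f : [0, 1] -> M_p (x) M_q with f 0 in M_p (x) 1 and f 1 in 1 (x) M_q; ev b is
   the function corresponding to b, its values outside [0, 1] being irrelevant.
   The norm needs no mention since *-isomorphisms are isometric. *)
Definition prime_dim_drop (p q : nat) B : Prop :=
  [/\ (0 < p)%N, (0 < q)%N & coprime p q] /\
  exists ev : B -> R -> 'M[R[i]]_(p * q),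
  [/\ (forall b, dim_drop_fun (ev b)),
      (forall f, dim_drop_fun f ->
         exists b, forall s, 0 <= s <= 1 -> ev b s = f s),
      (forall b, (forall s, 0 <= s <= 1 -> ev b s = 0) -> b = 0) &
      (forall s, 0 <= s <= 1 ->
         [/\ (forall (k : R[i]) a b,
                ev (k *: a + b) s = k *: ev a s + ev b s),
             (forall a b, ev (a ** b) s = ev a s *m ev b s) &
             (forall a, ev (star a) s = map_mx Num.conj (ev a s)^T)])].

Definition cocone (S : nat -> cstarAlgType R) (phi : forall n, S n -> S n.+1)
    B (mu : forall n, S n -> B) : Prop :=
  forall n, star_hom (mu n) /\ forall a, mu n.+1 (phi n a) = mu n a.

Definition inductive_limit (S : nat -> cstarAlgType R)
    (phi : forall n, S n -> S n.+1) B (mu : forall n, S n -> B) : Prop :=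
  cocone phi mu /\
  forall D (nu : forall n, S n -> D), cocone phi nu ->
    exists! psi : B -> D, star_hom psi /\ forall n a, psi (mu n a) = nu n a.

Definition tracial_state A (tr : A -> R[i]) : Prop :=
  [/\ (forall (k : R[i]) a b, tr (k *: a + b) = k * tr a + tr b),
      (forall a, 0 <= tr (star a ** a)),
      (forall e, is_unit e -> tr e = 1) &
      (forall a b, tr (a ** b) = tr (b ** a))].

Definition infinite_dimensional A : Prop :=
  ~ exists (n : nat) (v : 'I_n -> A), lin_span (range v) = setT.

(* By Jiang and Su's classification theorem there is, up to isomorphism, exactly
   one unital, simple, infinite-dimensional C*-algebra with a unique tracial
   state which is the limit of a sequence of prime dimension drop algebras with
   unital connecting maps.  Infinite dimension only discards the complex
   numbers, a limit of copies of C([0, 1]) (the case p = q = 1). *)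
Definition jiang_su Z : Prop :=
  [/\ (exists e : Z, is_unit e), simple_cstar Z, infinite_dimensional Z,
      (exists! tr : Z -> R[i], tracial_state tr) &
      exists (p q : nat -> nat) (S : nat -> cstarAlgType R)
        (phi : forall n, S n -> S n.+1) (mu : forall n, S n -> Z),
      [/\ (forall n, prime_dim_drop (p n) (q n) (S n)),
          (forall n, star_hom (phi n)),
          (forall n e, is_unit e -> is_unit (phi n e)) &
          inductive_limit phi mu]].

Definition Z_stable A : Prop := exists Z, jiang_su Z /\ min_tensor A Z A.

End CStarAlgebras.

(* Main.v *)
Require Import Defs.
From HB Require Import structures.
From mathcomp Require Import all_boot all_order all_algebra.
From mathcomp Require Import complex mxtens.
From mathcomp Require Import all_classical all_reals all_analysis.
From mathcomp Require Import ring lra.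

Set Implicit Arguments.
Unset Strict Implicit.
Unset Printing Implicit Defensive.

Import Order.TTheory GRing.Theory Num.Theory.
Import numFieldNormedType.Exports.

Local Open Scope classical_set_scope.
Local Open Scope ring_scope.
Local Open Scope complex_scope.

(* The example is the twisted group C*-algebra A(V) of a group V of exponent two with
   a bicharacter whose antisymmetrization is nondegenerate.  Averaging over the
   unitaries lam_h shows that A(V) is simple, and the finite subgroups of V that it
   is nuclear.  With V0 = X * K, for X the finitely supported and K all sequences of
   bits, A(V0) is not of type I, and A(V0 * V0) is A(V0) tensor A(V0).

   Suppose that A(V), for V = V0 * V0, absorbs the Jiang-Su algebra Z tensorially.
   Then the image of Z is supported on a countable subgroup G.  Every lam_k with k in
   the uncountable part K of V is approximated by sums of b z with z in Z and b
   commuting with Z; this gives a unit vector of l2(G) on which left multiplication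
   by Z agrees with right multiplication twisted by the character k.  As l2(G) is
   separable, one vector serves approximately, by Baire, for a somewhere dense set
   of k.  Averaging over them leaves of each element z of Z only its coefficients on
   finitely many cosets of K.  But Z contains order zero images of arbitrarily large
   matrix units, and since K is commutative, such a frame has little mass on each
   coset of K: by Parseval, the bound is that for a one-dimensional representation. *)

(** * Real-valued norms *)

(** For countably infinite V the algebra A(V) is the CAR algebra, which absorbs Z; hence V must be
    uncountable, and the proof plays the size of K against the separability of Z. As Z has no
    nontrivial projections, it offers no matrix units, only their images under order zero maps: one
    family in M_p (x) 1 that fades towards the end 1, another in 1 (x) M_q that fades towards the
    end 0. Normalized and joined they satisfy sum z^* z = sum z z^* = 1, so they reproduce the norm
    of every vector, while a coset of K carries mass at most 2 / k as soon as p, q >= k. The order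
    of the choices is essential: Baire first fixes a prefix s of bits and a vector d; averaging over
    the remaining bits leaves 2^|s| cosets of K, and only then is k taken large against 2^|s| and
    the coefficients of d. The cocycle pairs the K-part of its left argument with the X-part of its
    right one. So K is invisible on the right: right translation by K carries no sign, and
    conjugating a right multiplication by it is twisting by a character. *)

Definition nr (R : realType) (V : normedZmodType R[i]) (x : V) : R := complex.Re `|x|.

Section NrBasics.
Context {R : realType}.

(** Transfer between the norm, whose values lie in the partially ordered [R[i]], and a real number,
    for which suprema and [lra] are available. *)
Lemma nrE (V : normedZmodType R[i]) (x : V) : `|x| = (nr x)%:C.
Proof. by rewrite /nr RRe_real// normr_real. Qed.

Lemma nr_ge0 (V : normedZmodType R[i]) (x : V) : 0 <= nr x.
Proof. by have := normr_ge0 x; rewrite nrE ler0c. Qed.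

Lemma nr_eq0 (V : normedZmodType R[i]) (x : V) : (nr x == 0) = (x == 0).
Proof. by rewrite -(normr_eq0 x) nrE -(inj_eq (@complexI R)). Qed.

Lemma nr0 (V : normedZmodType R[i]) : nr (0 : V) = 0.
Proof. by apply/eqP; rewrite nr_eq0. Qed.

Lemma nr0_eq (V : normedZmodType R[i]) (x : V) : nr x = 0 -> x = 0.
Proof. by move/eqP; rewrite nr_eq0 => /eqP. Qed.

Lemma nr_gt0 (V : normedZmodType R[i]) (x : V) : (0 < nr x) = (x != 0).
Proof. by rewrite lt_def nr_ge0 andbT nr_eq0. Qed.

Lemma nrD (V : normedZmodType R[i]) (x y : V) : nr (x + y) <= nr x + nr y.
Proof. by have := ler_normD x y; rewrite !nrE -rmorphD/= lecR. Qed.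

Lemma nrN (V : normedZmodType R[i]) (x : V) : nr (- x) = nr x.
Proof. by rewrite /nr normrN. Qed.

Lemma nrB (V : normedZmodType R[i]) (x y : V) : nr (x - y) <= nr x + nr y.
Proof. by rewrite -(nrN y) nrD. Qed.

Lemma nrC (V : normedZmodType R[i]) (x y : V) : nr (x - y) = nr (y - x).
Proof. by rewrite -nrN opprB. Qed.

Lemma nr_tri (V : normedZmodType R[i]) (y x z : V) :
  nr (x - z) <= nr (x - y) + nr (y - z).
Proof. by rewrite -[x in X in X <= _](subrK y) -addrA nrD. Qed.

Lemma nr_sum (V : normedZmodType R[i]) (I : Type) (r : seq I) (P : pred I) (F : I -> V) :
  nr (\sum_(i <- r | P i) F i) <= \sum_(i <- r | P i) nr (F i).
Proof.
elim/big_rec2: _ => [|i y x _ h]; first by rewrite nr0.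
by apply: le_trans (nrD _ _) _; rewrite lerD2l.
Qed.

Lemma nrZ (V : normedModType R[i]) (k : R[i]) (x : V) : nr (k *: x) = nr k * nr x.
Proof. by apply: (@complexI R); rewrite rmorphM/= -!nrE normrZ. Qed.

Lemma nrM (k l : R[i]) : nr (k * l) = nr k * nr l.
Proof. by apply: (@complexI R); rewrite rmorphM/= -!nrE normrM. Qed.

Lemma nrR (r : R) : nr r%:C = `|r|.
Proof. by rewrite /nr normc_def/= expr0n/= addr0 sqrtr_sqr. Qed.

Lemma nr1 : nr (1 : R[i]) = 1.
Proof. by rewrite /nr normr1. Qed.

Lemma nr_sqr (z : R[i]) : nr z ^+ 2 = (complex.Re z) ^+ 2 + (complex.Im z) ^+ 2.
Proof. by rewrite /nr normc_def/= sqr_sqrtr// addr_ge0// sqr_ge0. Qed.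

Lemma conjE (z : R[i]) : Num.conj z = conjc z.
Proof. by []. Qed.

Lemma conjR (r : R) : Num.conj (r%:C) = r%:C.
Proof. exact: conjc_real. Qed.

Lemma nr_conj (z : R[i]) : nr (Num.conj z) = nr z.
Proof. by rewrite /nr norm_conjC. Qed.

Lemma nrV (z : R[i]) : nr z^-1 = (nr z)^-1.
Proof. by apply: (@complexI R); rewrite -nrE normfV nrE fmorphV. Qed.

Lemma mul_conj (z : R[i]) : z * Num.conj z = (nr z ^+ 2)%:C.
Proof. by rewrite -normCK nrE rmorphXn. Qed.

Lemma Re_le_nr (z : R[i]) : complex.Re z <= nr z.
Proof.
apply: le_trans (ler_norm _) _.
by rewrite -(@ler_pXn2r _ 2)// ?nnegrE ?nr_ge0// real_normK ?num_real// nr_sqr lerDl sqr_ge0.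
Qed.

Lemma norm_Re_le_nr (z : R[i]) : `|complex.Re z| <= nr z.
Proof.
by rewrite -(@ler_pXn2r _ 2)// ?nnegrE ?nr_ge0// real_normK ?num_real// nr_sqr lerDl sqr_ge0.
Qed.

Lemma norm_Im_le_nr (z : R[i]) : `|complex.Im z| <= nr z.
Proof.
by rewrite -(@ler_pXn2r _ 2)// ?nnegrE ?nr_ge0// real_normK ?num_real// nr_sqr lerDr sqr_ge0.
Qed.

Lemma nr_le_ReIm (z : R[i]) : nr z <= `|complex.Re z| + `|complex.Im z|.
Proof.
rewrite -(@ler_pXn2r _ 2)// ?nnegrE ?nr_ge0 ?addr_ge0// nr_sqr sqrrD.
rewrite !real_normK ?num_real// -addrA lerD2l lerDr mulrn_wge0// mulr_ge0//.
Qed.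

Definition scvg (V : normedZmodType R[i]) (u : nat -> V) (l : V) :=
  forall e : R, 0 < e -> exists N, forall n, (N <= n)%N -> nr (u n - l) < e.

Definition scauchy (V : normedZmodType R[i]) (u : nat -> V) :=
  forall e : R, 0 < e -> exists N, forall m n, (N <= m)%N -> (N <= n)%N -> nr (u m - u n) < e.

Lemma ball_nr (V : pseudoMetricNormedZmodType R[i]) (x y : V) (e : R) :
  ball x e%:C y <-> nr (x - y) < e.
Proof. by rewrite -ball_normE /ball_/= nrE ltcR. Qed.

Lemma posC (e : R[i]) : 0 < e -> exists2 r : R, 0 < r & e = r%:C.
Proof.
move=> e0; exists (complex.Re e).
  by move: e0; rewrite ltcE => /andP[].
by rewrite RRe_real// gtr0_real.
Qed.

Lemma closure_nr (V : pseudoMetricNormedZmodType R[i]) (S : set V) x :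
  closure S x <-> forall e : R, 0 < e -> exists2 y, S y & nr (x - y) < e.
Proof.
split=> [cS e e0|h B].
  have /cS [y [Sy By]] : nbhs x (ball x e%:C) by apply: nbhsx_ballx; rewrite ltcR.
  by exists y => //; apply/ball_nr.
move=> /nbhs_ballP [e /= /posC [r r0 ->]] sB.
by have [y Sy yr] := h r r0; exists y; split => //; apply: sB; apply/ball_nr.
Qed.

Lemma closed_nr (V : pseudoMetricNormedZmodType R[i]) (S : set V) :
  closed S <-> forall x, (forall e : R, 0 < e -> exists2 y, S y & nr (x - y) < e) -> S x.
Proof.
split=> [cS x h|h x cx]; first by apply: cS; apply/closure_nr.
by apply: h; apply/closure_nr.
Qed.

Lemma continuous_nr (V W : pseudoMetricNormedZmodType R[i]) (f : V -> W) :
  continuous f <-> forall x (e : R), 0 < e -> exists2 d : R, 0 < d &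
     forall y, nr (x - y) < d -> nr (f x - f y) < e.
Proof.
split=> [cf x e e0|h x].
  have /cf : nbhs (f x) (ball (f x) e%:C) by apply: nbhsx_ballx; rewrite ltcR.
  rewrite /= => /nbhs_ballP [d /= /posC [r r0 ->]] sB.
  by exists r => // y xy; apply/ball_nr; apply: sB; apply/ball_nr.
move=> B /nbhs_ballP [e /= /posC [r r0 ->]] sB.
have [d d0 hd] := h x r r0.
apply/nbhs_ballP; exists d%:C => /=; first by rewrite ltcR.
by move=> y /ball_nr xy; apply: sB; apply/ball_nr; apply: hd.
Qed.

Lemma linear_bounded (V W : normedModType R[i]) (f : V -> W) :
  linear f -> continuous f ->
  exists2 C : R, 0 <= C & forall x, nr (f x) <= C * nr x.
Proof.
move=> lf /continuous_nr /(_ 0 1 ltr01) [d d0 h].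
have f0 : f 0 = 0.
  by have := lf 1 0 0; rewrite !scale1r addr0 => /eqP; rewrite -subr_eq0 opprD addrA subrr sub0r oppr_eq0 => /eqP.
have fZ k x : f (k *: x) = k *: f x.
  by have := lf k x 0; rewrite f0 !addr0.
exists (2 / d) => [|x]; first by rewrite divr_ge0// ltW.
have [->|x0] := eqVneq x 0; first by rewrite f0 !nr0 mulr0.
have nx : 0 < nr x by rewrite nr_gt0.
(* [t] brings x to norm d / 2, inside the ball on which |f| < 1; hence the constant 2 / d. *)
set t := d / (2 * nr x).
have t0 : 0 < t by rewrite divr_gt0// mulr_gt0.
have /h : nr (0 - t%:C *: x) < d.
  rewrite sub0r nrN nrZ nrR gtr0_norm// /t invfM mulrA -mulrA mulVf ?gt_eqF// mulr1.
  by rewrite ltr_pdivrMr// ltr_pMr// ltr1n.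
rewrite f0 sub0r nrN fZ nrZ nrR gtr0_norm// => /ltW.
rewrite mulrC -ler_pdivlMr// mul1r /t invf_div mulrAC//.
Qed.

Lemma bounded_continuous (V W : normedModType R[i]) (f : V -> W) (C : R) :
  linear f -> (forall x, nr (f x) <= C * nr x) -> continuous f.
Proof.
move=> lf h; apply/continuous_nr => x e e0.
exists (e / (1 + `|C|)) => [|y].
  by rewrite divr_gt0// ltr_wpDr.
rewrite ltr_pdivlMr ?ltr_wpDr// => hy.
have -> : f x - f y = f (x - y).
  by rewrite [x - y]addrC -(scaleN1r y) lf scaleN1r addrC.
apply: le_lt_trans (h _) _; apply: le_lt_trans hy.
rewrite mulrC ler_wpM2l ?nr_ge0//.
by apply: le_trans (ler_norm C) _; rewrite lerDr.
Qed.

Lemma scvg_uniq (V : normedZmodType R[i]) (u : nat -> V) l l' : scvg u l -> scvg u l' -> l = l'.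
Proof.
move=> h h'; apply/eqP; rewrite -subr_eq0 -nr_eq0 eq_le nr_ge0 andbT.
apply/ler_addgt0Pl => e e0; rewrite addr0.
have e2 : 0 < e / 2 by rewrite divr_gt0.
have [N hN] := h _ e2; have [N' hN'] := h' _ e2.
have {}hN := hN (maxn N N') (leq_maxl _ _).
have {}hN' := hN' (maxn N N') (leq_maxr _ _).
apply: le_trans (nr_tri (u (maxn N N')) _ _) _.
by rewrite [e]splitr lerD ?ltW// nrC.
Qed.

Lemma complete_scvg (V : completeNormedModType R[i]) (u : nat -> V) :
  scauchy u -> exists l, scvg u l.
Proof.
move=> cu.
have : cauchy (u @ \oo).
  apply: cauchy_exP => e /posC [r r0 ->].
  have [N hN] := cu r r0; exists (u N); exists N => // n /= Nn.
  by apply/ball_nr; exact: hN.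
move=> /cauchy_cvg h.
have [l ul] := (cvg_ex (u @ \oo)).1 h.
exists l => e e0.
have /ul [N _ hN] : nbhs l (ball l e%:C) by apply: nbhsx_ballx; rewrite ltcR.
by exists N => n Nn; have /ball_nr := hN n Nn; rewrite nrC.
Qed.

End NrBasics.

(** A real norm that is sequentially complete is what l2, the operators and the closed subalgebras
    naturally come with; the builder turns it into convergence of Cauchy filters. *)
HB.factory Record Lmodule_isRealNormed (R : realType) (V : Type) of GRing.Lmodule R[i] V := {
  rnorm : V -> R ;
  rnormD : forall x y, rnorm (x + y) <= rnorm x + rnorm y ;
  rnormZ : forall (k : R[i]) x, rnorm (k *: x) = nr k * rnorm x ;
  rnorm_eq0 : forall x, rnorm x = 0 -> x = 0 ;
  rnorm_complete : forall u : nat -> V,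
    (forall e : R, 0 < e -> exists N, forall m n, (N <= m)%N -> (N <= n)%N ->
        rnorm (u m - u n) < e) ->
    exists l, forall e : R, 0 < e -> exists N, forall n, (N <= n)%N -> rnorm (u n - l) < e
}.

HB.builders Context (R : realType) V of Lmodule_isRealNormed R V.

Let N (x : V) : R[i] := (rnorm x)%:C.

Let ND x y : N (x + y) <= N x + N y.
Proof. by rewrite /N -rmorphD/= lecR rnormD. Qed.

Let NZ (k : R[i]) x : N (k *: x) = `|k| * N x.
Proof. by rewrite /N rnormZ rmorphM/= nrE. Qed.

Let N0 x : N x = 0 -> x = 0.
Proof. by move=> /(@complexI R); exact: rnorm_eq0. Qed.

HB.instance Definition _ := Lmodule_isNormed.Build R[i] V ND NZ N0.

Let cpl : forall F : set_system V, ProperFilter F -> cauchy F -> cvg F.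
Proof.
move=> F FF /cauchyP cF.
have pos n : 0 < (2 ^- n)%:C :> R[i] by rewrite ltcR invr_gt0 exprn_gt0.
(* The filter is traced by centers of balls of radius 2^-n that belong to it; any two of these balls
   meet, so the centers form a Cauchy sequence. *)
have /choice [x hx] : forall n, exists x, F (ball x (2 ^- n)%:C : set V).
  by move=> n; exact: cF (pos n).
have sm (e : R) : 0 < e -> exists n, forall m, (n <= m)%N -> 2 ^- m < e.
  move=> e0; have [n _ hn] := near_infty_natSinv_lt (PosNum e0).
  exists n => m nm; apply: le_lt_trans (hn n (leqnn n)); rewrite -natrX lef_pV2 ?posrE ?ltr0n ?expn_gt0//.
  by rewrite ler_nat (leq_trans (ltn_expl n (ltnSn 1)))// leq_exp2l.
have : scauchy x.
  move=> e e0.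
  have [n hn] := sm (e / 2) (divr_gt0 e0 (ltr0Sn _ _)).
  exists n => k l /hn hk /hn hl.
  have /filter_ex [y [/= yk yl]] : F (ball (x k) (2 ^- k)%:C `&` ball (x l) (2 ^- l)%:C).
    exact: filterI (hx k) (hx l).
  move: yk yl => /ball_nr yk /ball_nr yl.
  apply: le_lt_trans (nr_tri y _ _) _; rewrite [e]splitr ltrD//.
    exact: lt_trans yk hk.
  by rewrite nrC; exact: lt_trans yl hl.
move=> /rnorm_complete [l hl].
apply/cvg_ex; exists l => B /nbhs_ballP [e /= /posC [r r0 ->]] sB.
have r2 : 0 < r / 2 by rewrite divr_gt0.
have [n hn] := sm _ r2; have [m hm] := hl _ r2.
apply: filterS (hx (maxn n m)) => y /ball_nr hy; apply: sB; apply/ball_nr.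
apply: le_lt_trans (nr_tri (x (maxn n m)) _ _) _; rewrite [r]splitr ltrD//.
  by rewrite nrC; exact: hm (leq_maxr _ _).
exact: lt_trans hy (hn _ (leq_maxl _ _)).
Qed.

HB.instance Definition _ := Uniform_isComplete.Build V cpl.

HB.end.

(** * The Hilbert space l2 *)

Section Summation.
Context {R : realType} {S : eqType}.
Implicit Types (f g : S -> R[i]) (r : seq S).

Lemma ler_sum_subset (g : S -> R) r r' : (forall i, 0 <= g i) ->
  uniq r -> {subset r <= r'} -> \sum_(i <- r) g i <= \sum_(i <- r') g i.
Proof.
move=> g0; elim: r r' => [|i r IH] r' /=; first by rewrite big_nil sumr_ge0.
move=> /andP[ir ur] sub; have ir' : i \in r' by apply: sub; rewrite inE eqxx.
rewrite big_cons (perm_big _ (perm_to_rem ir')) big_cons lerD2l; apply: IH => // j jr.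
have : j \in r' by apply: sub; rewrite inE jr orbT.
by rewrite (perm_mem (perm_to_rem ir')) inE => /orP[/eqP ji|//]; rewrite -ji jr in ir.
Qed.

Definition asum f := exists C : R, forall r, uniq r -> \sum_(i <- r) nr (f i) <= C.

(** Unordered summation along finite duplicate-free lists: the index type will be an uncountable
    group, so the terms cannot be enumerated. *)
Definition summ f (L : R[i]) := forall e : R, 0 < e ->
  exists r0, forall r, uniq r -> {subset r0 <= r} -> nr (\sum_(i <- r) f i - L) < e.

Lemma summ_uniq f L L' : summ f L -> summ f L' -> L = L'.
Proof.
move=> h h'; apply/eqP; rewrite -subr_eq0 -nr_eq0 eq_le nr_ge0 andbT.
apply/ler_addgt0Pl => e e0; rewrite addr0.
have [r hr] := h _ (divr_gt0 e0 (ltr0Sn _ 1)).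
have [r' hr'] := h' _ (divr_gt0 e0 (ltr0Sn _ 1)).
have u : uniq (undup (r ++ r')) by rewrite undup_uniq.
have {}hr := hr _ u; have {}hr' := hr' _ u.
apply: le_trans (nr_tri (\sum_(i <- undup (r ++ r')) f i) _ _) _.
rewrite [e]splitr lerD ?ltW// ?[nr (L - _)]nrC; [apply: hr|apply: hr'] => i ir;
by rewrite mem_undup mem_cat ir ?orbT.
Qed.

Lemma summD f g L M : summ f L -> summ g M -> summ (fun i => f i + g i) (L + M).
Proof.
move=> h h' e e0.
have [r hr] := h _ (divr_gt0 e0 (ltr0Sn _ 1)).
have [r' hr'] := h' _ (divr_gt0 e0 (ltr0Sn _ 1)).
exists (r ++ r') => s us sub; rewrite big_split/= opprD addrACA.
apply: le_lt_trans (nrD _ _) _; rewrite [e]splitr ltrD//; [apply: hr|apply: hr'] => // i ir;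
by apply: sub; rewrite mem_cat ir ?orbT.
Qed.

Lemma summZ f L (k : R[i]) : summ f L -> summ (fun i => k * f i) (k * L).
Proof.
move=> h e e0.
have e'0 : 0 < e / (1 + nr k) by rewrite divr_gt0// ltr_wpDr// nr_ge0.
have [r hr] := h _ e'0; exists r => s us sub.
rewrite -big_distrr/= -mulrBr nrM.
have k1 : 0 < 1 + nr k by rewrite ltr_wpDr// nr_ge0.
have := hr s us sub; rewrite ltr_pdivlMr// => he.
apply: le_lt_trans he; rewrite mulrC ler_wpM2l ?nr_ge0// lerDr//.
Qed.

Lemma summ_conj f L : summ f L -> summ (fun i => Num.conj (f i)) (Num.conj L).
Proof.
move=> h e e0; have [r hr] := h e e0; exists r => s us sub.
by rewrite -rmorph_sum -rmorphB nr_conj; exact: hr.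
Qed.

Lemma summ_pos (g : S -> R) (C : R) : (forall i, 0 <= g i) ->
  (forall r, uniq r -> \sum_(i <- r) g i <= C) -> exists L, summ (fun i => (g i)%:C) L%:C.
Proof.
move=> g0 hC.
pose A := [set t | exists2 r, uniq r & t = \sum_(i <- r) g i].
have hA : has_sup A.
  split; first by exists 0, [::]; rewrite ?big_nil.
  by exists C => _ [r ur ->]; exact: hC.
exists (sup A) => e e0.
have [_ [r0 ur0 ->] hr0] := sup_adherent e0 hA.
exists r0 => r ur sub.
rewrite -rmorph_sum -rmorphB/= nrR.
have h1 : \sum_(i <- r) g i <= sup A by apply: sup_upper_bound => //; exists r.
have h2 := ler_sum_subset g0 ur0 sub.
rewrite ler0_norm ?subr_le0// opprB ltrBlDl.
by rewrite -ltrBlDr; apply: lt_le_trans hr0 h2.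
Qed.

Lemma asum_summ f : asum f -> exists L, summ f L.
Proof.
move=> [C hC].
have key (p : R[i] -> R) : (forall z, 0 <= p z <= nr z) ->
    exists L, summ (fun i => (p (f i))%:C) L%:C.
  move=> hp; apply: (@summ_pos _ C) => [i|r ur]; first by have /andP[] := hp (f i).
  by apply: le_trans (hC r ur); apply: ler_sum => i _; have /andP[] := hp (f i).
(* The positive part; [m t] and [m (- t)] split a real series into two series of nonnegative
   terms. *)
pose m (t : R) := (t + `|t|) / 2.
have mE t : m t - m (- t) = t.
  by rewrite /m normrN; lra.
have mP (t u : R) : `|t| <= u -> 0 <= m t <= u.
  move=> tu; have := ler_norm t; have := ler_norm (- t); rewrite normrN /m => *.
  by apply/andP; split; lra.
have [a ha] := key (fun z => m (complex.Re z)) (fun z => mP _ _ (norm_Re_le_nr z)).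
have [b hb] : exists L, summ (fun i => (m (- complex.Re (f i)))%:C) L%:C.
  by apply: (key (fun z => m (- complex.Re z))) => z; apply: mP; rewrite normrN norm_Re_le_nr.
have [c hc] := key (fun z => m (complex.Im z)) (fun z => mP _ _ (norm_Im_le_nr z)).
have [d hd] : exists L, summ (fun i => (m (- complex.Im (f i)))%:C) L%:C.
  by apply: (key (fun z => m (- complex.Im z))) => z; apply: mP; rewrite normrN norm_Im_le_nr.
have h := summD (summD ha (summZ (-1) hb)) (summZ 'i (summD hc (summZ (-1) hd))).
eexists; move: h; congr (summ _ _); apply/funext => i.
rewrite !mulN1r -!rmorphB/= !mE [RHS]complexE//.
Qed.

Definition tsum f : R[i] := xget 0 [set L | summ f L].

Lemma tsumP f : asum f -> summ f (tsum f).
Proof. by move=> /asum_summ [L hL]; rewrite /tsum; case: xgetP => [? ->//|/(_ L)]. Qed.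

Lemma tsum_eq f L : summ f L -> tsum f = L.
Proof.
move=> h; rewrite /tsum; case: xgetP => [? -> h'|/(_ L)//].
exact: summ_uniq h' h.
Qed.

Lemma summ_fin f r0 : uniq r0 -> (forall i, i \notin r0 -> f i = 0) ->
  summ f (\sum_(i <- r0) f i).
Proof.
move=> ur0 h e e0; exists r0 => r ur sub.
suff -> : \sum_(i <- r) f i = \sum_(i <- r0) f i by rewrite subrr nr0.
rewrite (bigID (mem r0))/= [X in _ + X]big1 ?addr0// -big_filter.
apply: perm_big; apply: uniq_perm => //; first by rewrite filter_uniq.
move=> i; rewrite mem_filter; case: (boolP (i \in r0)) => //= /sub //.
Qed.

Lemma summ_ge (f : S -> R[i]) L r : summ f L -> (forall i, 0 <= complex.Re (f i)) -> uniq r ->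
  \sum_(i <- r) complex.Re (f i) <= complex.Re L.
Proof.
move=> h f0 ur; apply/ler_addgt0Pr => e e0; have [r0 hr0] := h e e0.
have u : uniq (undup (r ++ r0)) by rewrite undup_uniq.
have sub : {subset r <= undup (r ++ r0)} by move=> i ir; rewrite mem_undup mem_cat ir.
apply: le_trans (ler_sum_subset f0 ur sub) _.
rewrite -lerBlDl -(raddf_sum (@complex.Re R : Rcomplex R -> R)) -raddfB/=.
apply: le_trans (Re_le_nr _) _; apply: ltW; apply: hr0 => // i ir.
by rewrite mem_undup mem_cat ir orbT.
Qed.

Lemma summ_le (f : S -> R[i]) L (C : R) : summ f L ->
  (forall r, uniq r -> \sum_(i <- r) complex.Re (f i) <= C) -> complex.Re L <= C.
Proof.
move=> h hC; apply/ler_addgt0Pr => e e0; have [r0 hr0] := h e e0.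
have u : uniq (undup r0) by rewrite undup_uniq.
have sub : {subset r0 <= undup r0} by move=> i ir; rewrite mem_undup.
have := hr0 _ u sub; rewrite nrC => /ltW hh.
have := le_trans (Re_le_nr _) hh.
rewrite raddfB/= (raddf_sum (@complex.Re R : Rcomplex R -> R)) lerBlDl => h3.
by apply: le_trans h3 _; rewrite lerD2r hC.
Qed.

End Summation.

Lemma complex_complete (R : realType) (a : nat -> R[i]) : scauchy a -> exists l, scvg a l.
Proof.
move=> ca.
have key (p : R[i] -> R) : (forall z w, `|p z - p w| <= nr (z - w)) ->
    exists l : R, forall e : R, 0 < e -> exists N, forall n, (N <= n)%N -> `|p (a n) - l| < e.
  move=> hp; have : cauchy ((p \o a) @ \oo).
    apply: cauchy_exP => e e0; have [N hN] := ca e e0.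
    exists (p (a N)); exists N => // n /= Nn; rewrite /ball/=.
    by apply: le_lt_trans (hp _ _) _; exact: hN.
  move=> /cauchy_cvg /cvg_ex [l hl]; exists l => e e0.
  have /hl [N _ hN] : nbhs l (ball l e) by exact: nbhsx_ballx.
  by exists N => n Nn; have := hN n Nn; rewrite /ball/= distrC.
have [l hl] : exists l : R, forall e : R, 0 < e -> exists N, forall n, (N <= n)%N -> `|complex.Re (a n) - l| < e.
  by apply: key => z w; rewrite -raddfB/=; exact: norm_Re_le_nr.
have [m hm] : exists l : R, forall e : R, 0 < e -> exists N, forall n, (N <= n)%N -> `|complex.Im (a n) - l| < e.
  by apply: key => z w; rewrite -raddfB/=; exact: norm_Im_le_nr.
exists (l +i* m) => e e0; have e2 : 0 < e / 2 by rewrite divr_gt0.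
have [N hN] := hl _ e2; have [M hM] := hm _ e2.
exists (maxn N M) => n; rewrite geq_max => /andP[/hN h /hM h'].
apply: le_lt_trans (nr_le_ReIm _) _; rewrite [e]splitr.
by rewrite !raddfB/= ltrD.
Qed.

(** Stated for a bare positive form because the triangle inequality of l2 needs it before l2 is a
    Hilbert space. [key] expands the form at s x - t d(x, y) y; for B > 0 the choice s = B, t = 1 is
    the minimum. *)
Lemma sesqui_CS (R : realType) (V : lmodType R[i]) (d : V -> V -> R[i]) :
  (forall x y z, d (x + y) z = d x z + d y z) ->
  (forall k x y, d (k *: x) y = k * d x y) ->
  (forall x y, d x y = Num.conj (d y x)) ->
  (forall x, 0 <= d x x) ->
  forall x y, nr (d x y) ^+ 2 <= complex.Re (d x x) * complex.Re (d y y).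
Proof.
move=> dD dZ dC d0 x y.
have dDr u v w : d u (v + w) = d u v + d u w by rewrite dC dD rmorphD/= -!dC.
have dZr k u v : d u (k *: v) = Num.conj k * d u v by rewrite dC dZ rmorphM/= -!dC.
have dR u : d u u = (complex.Re (d u u))%:C by rewrite RRe_real// ger0_real.
set A := complex.Re (d x x); set B := complex.Re (d y y); set D := nr (d x y) ^+ 2.
have A0 : 0 <= A by have := d0 x; rewrite dR ler0c.
have B0 : 0 <= B by have := d0 y; rewrite dR ler0c.
have D0 : 0 <= D by rewrite sqr_ge0.
have key (s t : R) : 0 <= s ^+ 2 * A - 2 * s * t * D + t ^+ 2 * D * B.
  have := d0 (s%:C *: x + (- (t%:C * d x y)) *: y).
  rewrite dD !dDr !dZ !dZr (dC y x) (dR x) (dR y) -/A -/B.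
  rewrite rmorphN rmorphM/= !conjR.
  have -> : s%:C * (s%:C * A%:C) + s%:C * (- (t%:C * Num.conj (d x y)) * d x y) +
     (- (t%:C * d x y) * (s%:C * Num.conj (d x y)) +
      - (t%:C * d x y) * (- (t%:C * Num.conj (d x y)) * B%:C)) =
     s%:C ^+ 2 * A%:C - 2 * s%:C * t%:C * (d x y * Num.conj (d x y)) +
      t%:C ^+ 2 * (d x y * Num.conj (d x y)) * B%:C by ring.
  rewrite mul_conj -/D -!rmorphXn/=.
  have -> : (2 : R[i]) = (2 : R)%:C by rewrite rmorph_nat.
  by rewrite -!rmorphM/= -!rmorphB/= -rmorphD/= ler0c.
have [B1|] := ltP 0 B.
  have := key B 1; rewrite expr1n mul1r mulr1 => h.
  have : 0 <= B * (A * B - D) by apply: le_trans h _; rewrite le_eqVlt; apply/orP; left; apply/eqP; ring.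
  by rewrite pmulr_rge0// subr_ge0.
(* For B = 0 the inequality of [key] is linear in t, and t = (A + 1) / D would make its right side
   negative. *)
move=> B1; have Bz : B = 0 by apply/eqP; rewrite eq_le B1 B0.
rewrite Bz mulr0; rewrite leNgt; apply/negP => Dp.
have := key 1 ((A + 1) / D); rewrite Bz mulr0 addr0 expr1n mul1r mulr1.
have -> : 2 * ((A + 1) / D) * D = 2 * (A + 1) by rewrite -mulrA divfK// gt_eqF.
lra.
Qed.

Definition sqs (R : realType) (S : eqType) (x : S -> R[i]) :=
  exists C : R, forall r, uniq r -> \sum_(i <- r) nr (x i) ^+ 2 <= C.

Record l2 (R : realType) (S : eqType) := L2 { l2f :> S -> R[i] ; l2P : sqs l2f }.

Section L2.
Context {R : realType} {S : eqType}.
Implicit Types (x y z : S -> R[i]) (u v w : l2 R S).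

Lemma l2_ext u v : (forall i, u i = v i) -> u = v.
Proof.
case: u v => [u hu] [v hv] /= /funext e; rewrite e in hu *.
by congr L2; exact: Prop_irrelevance.
Qed.

Lemma sqs0 : sqs (fun _ : S => (0 : R[i])).
Proof. by exists 0 => r _; rewrite big1// => i _; rewrite nr0 expr0n. Qed.

Lemma sqsD x y : sqs x -> sqs y -> sqs (fun i => x i + y i).
Proof.
move=> [C hC] [D hD]; exists (2 * C + 2 * D) => r ur.
apply: le_trans (lerD (ler_wpM2l (ler0n _ 2) (hC r ur)) (ler_wpM2l (ler0n _ 2) (hD r ur))).
rewrite !mulr_sumr -big_split/=; apply: ler_sum => i _.
have h := nrD (x i) (y i); have h0 := nr_ge0 (x i + y i).
have : nr (x i + y i) ^+ 2 <= (nr (x i) + nr (y i)) ^+ 2 by rewrite lerXn2r// nnegrE addr_ge0 ?nr_ge0.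
have : 0 <= (nr (x i) - nr (y i)) ^+ 2 by rewrite sqr_ge0.
by rewrite sqrrB sqrrD; lra.
Qed.

Lemma sqsZ (k : R[i]) x : sqs x -> sqs (fun i => k * x i).
Proof.
move=> [C hC]; exists (nr k ^+ 2 * C) => r ur.
apply: le_trans (ler_wpM2l (sqr_ge0 _) (hC r ur)).
by rewrite mulr_sumr; apply: ler_sum => i _; rewrite nrM exprMn.
Qed.

Lemma sqsN x : sqs x -> sqs (fun i => - x i).
Proof. by move=> [C hC]; exists C => r ur; under eq_bigr do rewrite nrN; exact: hC. Qed.

Definition l2_zero := L2 sqs0.
Definition l2_add u v := L2 (sqsD (l2P u) (l2P v)).
Definition l2_opp u := L2 (sqsN (l2P u)).
Definition l2_scale (k : R[i]) u := L2 (sqsZ k (l2P u)).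

HB.instance Definition _ := gen_eqMixin (l2 R S).
HB.instance Definition _ := gen_choiceMixin (l2 R S).

Lemma l2_addA : associative l2_add.
Proof. by move=> u v w; apply: l2_ext => i /=; rewrite addrA. Qed.
Lemma l2_addC : commutative l2_add.
Proof. by move=> u v; apply: l2_ext => i /=; rewrite addrC. Qed.
Lemma l2_add0 : left_id l2_zero l2_add.
Proof. by move=> u; apply: l2_ext => i /=; rewrite add0r. Qed.
Lemma l2_addN : left_inverse l2_zero l2_opp l2_add.
Proof. by move=> u; apply: l2_ext => i /=; rewrite addNr. Qed.

HB.instance Definition _ := GRing.isZmodule.Build (l2 R S) l2_addA l2_addC l2_add0 l2_addN.

Lemma l2_scaleA (a b : R[i]) u : l2_scale a (l2_scale b u) = l2_scale (a * b) u.
Proof. by apply: l2_ext => i /=; rewrite mulrA. Qed.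
Lemma l2_scale1 : left_id 1 l2_scale.
Proof. by move=> u; apply: l2_ext => i /=; rewrite mul1r. Qed.
Lemma l2_scaleDr : right_distributive l2_scale +%R.
Proof. by move=> k u v; apply: l2_ext => i /=; rewrite mulrDr. Qed.
Lemma l2_scaleDl u : {morph l2_scale^~ u : a b / a + b}.
Proof. by move=> a b; apply: l2_ext => i /=; rewrite mulrDl. Qed.

HB.instance Definition _ := GRing.Zmodule_isLmodule.Build R[i] (l2 R S)
  l2_scaleA l2_scale1 l2_scaleDr l2_scaleDl.

Lemma l2DE u v i : (u + v) i = u i + v i. Proof. by []. Qed.
Lemma l2ZE k u i : (k *: u) i = k * u i. Proof. by []. Qed.
Lemma l20E i : (0 : l2 R S) i = 0. Proof. by []. Qed.
Lemma l2BE u v i : (u - v) i = u i - v i. Proof. by []. Qed.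
Lemma l2_sumE (I : Type) (r : seq I) (P : pred I) (F : I -> l2 R S) i :
  (\sum_(j <- r | P j) F j) i = \sum_(j <- r | P j) F j i.
Proof. by elim/big_rec2: _ => [//|j x y _ <-]; rewrite l2DE. Qed.

Definition l2dot u v : R[i] := tsum (fun i => u i * Num.conj (v i)).

Lemma l2dot_asum u v : asum (fun i => u i * Num.conj (v i)).
Proof.
have [C hC] := l2P u; have [D hD] := l2P v; exists (C + D) => r ur.
apply: le_trans (lerD (hC r ur) (hD r ur)); rewrite -big_split/=.
apply: ler_sum => i _; rewrite nrM nr_conj.
have : 0 <= (nr (u i) - nr (v i)) ^+ 2 by rewrite sqr_ge0.
have : 0 <= (nr (u i) + nr (v i)) ^+ 2 by rewrite sqr_ge0.
by rewrite sqrrB sqrrD; lra.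
Qed.

Lemma l2dot_summ u v : summ (fun i => u i * Num.conj (v i)) (l2dot u v).
Proof. exact: tsumP (l2dot_asum u v). Qed.

Lemma l2dotDl u v w : l2dot (u + v) w = l2dot u w + l2dot v w.
Proof.
apply: tsum_eq; have := summD (l2dot_summ u w) (l2dot_summ v w).
by congr summ; apply/funext => i; rewrite l2DE mulrDl.
Qed.

Lemma l2dotZl k u w : l2dot (k *: u) w = k * l2dot u w.
Proof.
apply: tsum_eq; have := summZ k (l2dot_summ u w).
by congr summ; apply/funext => i; rewrite l2ZE mulrA.
Qed.

Lemma l2dotC u w : l2dot u w = Num.conj (l2dot w u).
Proof.
apply: tsum_eq; have := summ_conj (l2dot_summ w u).
by congr summ; apply/funext => i; rewrite rmorphM/= conjCK mulrC.
Qed.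

Lemma l2_sq_le u r : uniq r -> \sum_(i <- r) nr (u i) ^+ 2 <= complex.Re (l2dot u u).
Proof.
move=> ur; have := @summ_ge _ _ _ _ r (l2dot_summ u u) _ ur.
by under eq_bigr do rewrite mul_conj/=; apply => i; rewrite mul_conj/= sqr_ge0.
Qed.

Lemma l2_sq_ge u (C : R) : (forall r, uniq r -> \sum_(i <- r) nr (u i) ^+ 2 <= C) ->
  complex.Re (l2dot u u) <= C.
Proof.
move=> h; apply: (summ_le (l2dot_summ u u)) => r ur.
by under eq_bigr do rewrite mul_conj/=; exact: h.
Qed.

Lemma l2dot_ge0 u : 0 <= l2dot u u.
Proof.
have : Num.conj (l2dot u u) = l2dot u u by rewrite -l2dotC.
rewrite conjE => /eqP; rewrite eq_complex => /andP[_ /eqP h].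
rewrite lecE/=; have /= := @l2_sq_le u [::] isT; rewrite big_nil => ->.
by rewrite andbT; move: h => /=; case: (l2dot u u) => a b /=; move=> h; apply/eqP; lra.
Qed.

Definition l2norm u := Num.sqrt (complex.Re (l2dot u u)).

Lemma l2norm_sqr u : l2norm u ^+ 2 = complex.Re (l2dot u u).
Proof. by rewrite sqr_sqrtr// ; have /= := @l2_sq_le u [::] isT; rewrite big_nil. Qed.

Lemma l2norm_ge0 u : 0 <= l2norm u. Proof. exact: sqrtr_ge0. Qed.

Lemma l2dotE u : l2dot u u = ((l2norm u) ^+ 2)%:C.
Proof. by rewrite l2norm_sqr RRe_real// ger0_real// l2dot_ge0. Qed.

Lemma l2norm_le u (C : R) : 0 <= C -> (forall r, uniq r -> \sum_(i <- r) nr (u i) ^+ 2 <= C ^+ 2) ->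
  l2norm u <= C.
Proof.
by move=> C0 h; rewrite -(@ler_pXn2r _ 2)// ?nnegrE ?l2norm_ge0// l2norm_sqr l2_sq_ge.
Qed.

Lemma nr_le_l2norm u i : nr (u i) <= l2norm u.
Proof.
rewrite -(@ler_pXn2r _ 2)// ?nnegrE ?l2norm_ge0 ?nr_ge0// l2norm_sqr.
by have := @l2_sq_le u [:: i] isT; rewrite big_seq1.
Qed.

Lemma l2normD u v : l2norm (u + v) <= l2norm u + l2norm v.
Proof.
rewrite -(@ler_pXn2r _ 2)// ?nnegrE ?addr_ge0 ?l2norm_ge0//.
have cs := sesqui_CS l2dotDl l2dotZl l2dotC l2dot_ge0 u v.
rewrite -!l2norm_sqr -exprMn ler_pXn2r ?nnegrE ?nr_ge0 ?mulr_ge0 ?l2norm_ge0// in cs.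
rewrite l2norm_sqr l2dotDl (l2dotC u) (l2dotC v) !l2dotDl.
rewrite !rmorphD/= -!l2dotC !raddfD/=.
rewrite -!l2norm_sqr (l2dotC v u).
have -> : complex.Re (Num.conj (l2dot u v)) = complex.Re (l2dot u v) by case: (l2dot u v).
have := le_trans (Re_le_nr _) cs.
by rewrite sqrrD; lra.
Qed.

Lemma l2normZ k u : l2norm (k *: u) = nr k * l2norm u.
Proof.
apply/eqP; rewrite -(@eqrXn2 _ 2) ?mulr_ge0 ?nr_ge0 ?l2norm_ge0// exprMn l2norm_sqr.
rewrite l2dotZl l2dotC l2dotZl rmorphM/= -l2dotC mulrA mul_conj l2dotE.
by rewrite -rmorphM/=.
Qed.

Lemma l2norm_eq0 u : l2norm u = 0 -> u = 0.
Proof.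
move=> h; apply: l2_ext => i; rewrite l20E; apply: nr0_eq.
by apply/eqP; rewrite eq_le nr_ge0 andbT -h nr_le_l2norm.
Qed.

Lemma scvg_sqsum (a : nat -> S -> R[i]) (x : S -> R[i]) r (C : R) :
  (forall i, scvg (a^~ i) (x i)) ->
  (exists N, forall n, (N <= n)%N -> \sum_(i <- r) nr (a n i) ^+ 2 <= C) ->
  \sum_(i <- r) nr (x i) ^+ 2 <= C.
Proof.
move=> ax [N hN].
have cv : (fun n => \sum_(i <- r) nr (a n i) ^+ 2) @ \oo --> \sum_(i <- r) nr (x i) ^+ 2.
  elim: r {hN} => [|i r IH].
    by rewrite big_nil; under eq_fun do rewrite big_nil; exact: cvg_cst.
  rewrite big_cons; under eq_fun do rewrite big_cons; apply: cvgD => //.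
  have h : (fun n => nr (a n i)) @ \oo --> nr (x i).
    apply/cvgrPdist_lt => e e0; have [M hM] := ax i e e0.
    exists M => // n /= Mn; have := hM n Mn; apply: le_lt_trans.
    rewrite ler_norml; apply/andP; split.
      by rewrite lerNl opprB lerBlDr; apply: le_trans (nrD _ _); rewrite subrK.
    by rewrite lerBlDr nrC; apply: le_trans (nrD _ _); rewrite subrK.
  rewrite expr2; under eq_fun do rewrite expr2; exact: cvgM.
by apply: (cvgr_to_le cv); exists N.
Qed.

Lemma l2_complete (u : nat -> l2 R S) :
  (forall e : R, 0 < e -> exists N, forall m n, (N <= m)%N -> (N <= n)%N ->
      l2norm (u m - u n) < e) ->
  exists l, forall e : R, 0 < e -> exists N, forall n, (N <= n)%N -> l2norm (u n - l) < e.
Proof.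
move=> cu.
have /choice [x hx] : forall i, exists l, scvg (fun n => u n i) l.
  move=> i; apply: complex_complete => e e0; have [N hN] := cu e e0.
  exists N => m n Nm Nn; apply: le_lt_trans (hN m n Nm Nn).
  by rewrite -l2BE nr_le_l2norm.
(* The finite partial sums of |u n - u m|^2 are at most e^2; letting m tend to infinity in them
   bounds those of |u n - x|^2. *)
have key (e : R) : 0 < e -> exists N, forall n, (N <= n)%N -> forall r, uniq r ->
   \sum_(i <- r) nr (u n i - x i) ^+ 2 <= e ^+ 2.
  move=> e0; have [N hN] := cu e e0; exists N => n Nn r ur.
  apply: (@scvg_sqsum (fun m i => u n i - u m i)) => [i d d0|].
    have [M hM] := hx i d d0; exists M => m Mm.
    by rewrite opprB addrC addrA subrK nrC; exact: hM.
  exists N => m Nm.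
  apply: le_trans (@l2_sq_le (u n - u m) r ur) _.
  by rewrite -l2norm_sqr ler_pXn2r ?nnegrE ?l2norm_ge0 1?ltW// hN.
have sx : sqs x.
  have [N hN] := key 1 ltr01; have [D hD] := sqsD (l2P (u N)) (sqsN (ex_intro _ _ (hN N (leqnn N)))).
  exists D => r ur; apply: le_trans (hD r ur); apply: ler_sum => i _.
  by rewrite opprB addrC subrK.
exists (L2 sx) => e e0; have e2 : 0 < e / 2 by rewrite divr_gt0.
have [N hN] := key _ e2; exists N => n Nn.
apply: (@le_lt_trans _ _ (e / 2)); last by rewrite ltr_pdivrMr// mulr_natr mulr2n ltrDl.
by apply: l2norm_le => [|r ur]; [exact: ltW|exact: hN].
Qed.

HB.instance Definition _ := @Lmodule_isRealNormed.Build R (l2 R S) l2norm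
  l2normD l2normZ l2norm_eq0 l2_complete.

Lemma l2_dot_norm u : l2dot u u = `|u| ^+ 2.
Proof. by rewrite l2dotE rmorphXn. Qed.

HB.instance Definition _ := @isHilbert.Build R (l2 R S) l2dot l2dotDl l2dotZl l2dotC l2_dot_norm.

End L2.

(** * Adjointable operators *)

Section HilbertTheory.
Context {R : realType} {H : hilbertType R}.
Implicit Types x y z : H.

Lemma dotDr x y z : dot x (y + z) = dot x y + dot x z.
Proof. by rewrite dotC dotDl rmorphD/= -!dotC. Qed.

Lemma dotZr (k : R[i]) x y : dot x (k *: y) = Num.conj k * dot x y.
Proof. by rewrite dotC dotZl rmorphM/= -dotC. Qed.

Lemma dot0l x : dot 0 x = 0.
Proof. by rewrite -(scale0r x) dotZl mul0r. Qed.

Lemma dot0r x : dot x 0 = 0.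
Proof. by rewrite dotC dot0l rmorph0. Qed.

Lemma dotNl x y : dot (- x) y = - dot x y.
Proof. by rewrite -scaleN1r dotZl mulN1r. Qed.

Lemma dotNr x y : dot x (- y) = - dot x y.
Proof. by rewrite dotC dotNl rmorphN/= -dotC. Qed.

Lemma dotBl x y z : dot (x - y) z = dot x z - dot y z.
Proof. by rewrite dotDl dotNl. Qed.

Lemma dotBr x y z : dot x (y - z) = dot x y - dot x z.
Proof. by rewrite dotDr dotNr. Qed.

Lemma dot_suml (I : Type) (r : seq I) (P : pred I) (F : I -> H) y :
  dot (\sum_(i <- r | P i) F i) y = \sum_(i <- r | P i) dot (F i) y.
Proof. by elim/big_rec2: _ => [|i u v _ <-]; rewrite ?dot0l ?dotDl. Qed.

Lemma dot_sumr (I : Type) (r : seq I) (P : pred I) (F : I -> H) y :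
  dot y (\sum_(i <- r | P i) F i) = \sum_(i <- r | P i) dot y (F i).
Proof. by elim/big_rec2: _ => [|i u v _ <-]; rewrite ?dot0r ?dotDr. Qed.

Lemma dot_nr x : dot x x = (nr x ^+ 2)%:C.
Proof. by rewrite dot_norm nrE rmorphXn. Qed.

Lemma Re_dot x : complex.Re (dot x x) = nr x ^+ 2.
Proof. by rewrite dot_nr. Qed.

Lemma cauchy_schwarz x y : nr (dot x y) <= nr x * nr y.
Proof.
have d0 z : 0 <= dot z z by rewrite dot_nr ler0c sqr_ge0.
have := @sesqui_CS R H dot (@dotDl R H) (@dotZl R H) (@dotC R H) d0 x y.
by rewrite !Re_dot -exprMn ler_pXn2r// nnegrE ?mulr_ge0 ?nr_ge0.
Qed.

Lemma dot_ext x y : (forall z, dot x z = dot y z) -> x = y.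
Proof.
move=> h; apply/eqP; rewrite -subr_eq0; apply/eqP/nr0_eq.
have := dot_nr (x - y); rewrite dotBl h subrr => /(@complexI R)/eqP.
by rewrite eq_sym sqrf_eq0 => /eqP.
Qed.

Lemma dot_ext_r x y : (forall z, dot z x = dot z y) -> x = y.
Proof. by move=> h; apply: dot_ext => z; rewrite dotC h -dotC. Qed.

Lemma nr_sqrD x y : nr (x + y) ^+ 2 = nr x ^+ 2 + nr y ^+ 2 + 2 * complex.Re (dot x y).
Proof.
rewrite -!Re_dot dotDl !dotDr !raddfD/= (dotC y x).
have -> : complex.Re (Num.conj (dot x y)) = complex.Re (dot x y) by case: (dot x y).
by ring.
Qed.

Lemma nr_sqrD_le x y : nr (x + y) ^+ 2 <= 2 * nr x ^+ 2 + 2 * nr y ^+ 2.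
Proof.
have h1 := nr_sqrD x y; have h2 := nr_sqrD x (- y).
rewrite dotNr raddfN/= nrN in h2; have := sqr_ge0 (nr (x - y)); lra.
Qed.

Lemma scvg_dotl (u : nat -> H) x y : scvg u x -> scvg (fun n => dot (u n) y) (dot x y).
Proof.
move=> h e e0; have e'0 : 0 < e / (1 + nr y) by rewrite divr_gt0// ltr_wpDr ?nr_ge0.
have [N hN] := h _ e'0; exists N => n /hN.
rewrite ltr_pdivlMr ?ltr_wpDr ?nr_ge0// => h'; rewrite -dotBl.
apply: le_lt_trans (cauchy_schwarz _ _) _; apply: le_lt_trans h'.
by rewrite ler_wpM2l ?nr_ge0// lerDr.
Qed.

Lemma scvg_dotr (u : nat -> H) x y : scvg u x -> scvg (fun n => dot y (u n)) (dot y x).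
Proof.
move=> h e e0; have [N hN] := @scvg_dotl u x y h e e0; exists N => n /hN.
by rewrite (dotC y (u n)) (dotC y x) -rmorphB nr_conj.
Qed.

End HilbertTheory.

Lemma scvg_le (R : realType) (V : normedZmodType R[i]) (u : nat -> V) l y (C : R) :
  scvg u l -> (exists N, forall n, (N <= n)%N -> nr (u n - y) <= C) -> nr (l - y) <= C.
Proof.
move=> h [N hN]; apply/ler_addgt0Pl => e e0; have [M hM] := h e e0.
have {}hM := hM (maxn N M) (leq_maxr _ _); have {}hN := hN (maxn N M) (leq_maxl _ _).
by apply: le_trans (nr_tri (u (maxn N M)) _ _) _; rewrite nrC lerD// ltW.
Qed.

Lemma scvgD (R : realType) (V : normedZmodType R[i]) (u v : nat -> V) l m :
  scvg u l -> scvg v m -> scvg (fun n => u n + v n) (l + m).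
Proof.
move=> h h' e e0; have [N hN] := h _ (divr_gt0 e0 (ltr0Sn _ 1)).
have [M hM] := h' _ (divr_gt0 e0 (ltr0Sn _ 1)).
exists (maxn N M) => n; rewrite geq_max => /andP[/hN {}hN /hM {}hM].
rewrite opprD addrACA; apply: le_lt_trans (nrD _ _) _.
by rewrite [e]splitr ltrD.
Qed.

Lemma scvgZ (R : realType) (V : normedModType R[i]) (k : R[i]) (u : nat -> V) l :
  scvg u l -> scvg (fun n => k *: u n) (k *: l).
Proof.
move=> h e e0; have e'0 : 0 < e / (1 + nr k) by rewrite divr_gt0// ltr_wpDr ?nr_ge0.
have [N hN] := h _ e'0; exists N => n /hN.
rewrite ltr_pdivlMr ?ltr_wpDr ?nr_ge0// => h'; rewrite -scalerBr nrZ mulrC.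
by apply: le_lt_trans h'; rewrite ler_wpM2l ?nr_ge0// lerDr.
Qed.

(** The adjoint is part of the data in place of an appeal to Riesz representation: all the operators
    built below have an explicit one. *)
Definition adjointable (R : realType) (H : hilbertType R) (f : H -> H) :=
  [/\ linear f, exists C : R, forall x, nr (f x) <= C * nr x &
      exists g : H -> H, forall x y, dot (f x) y = dot x (g y)].

Record bop (R : realType) (H : hilbertType R) :=
  Bop { bopf :> H -> H ; bopP : adjointable bopf }.

Section BoundedOperators.
Context {R : realType} {H : hilbertType R}.
Implicit Types (S T U : bop H) (x y z : H).

Lemma bop_ext S T : (forall x, S x = T x) -> S = T.
Proof.
case: S T => [f hf] [g hg] /= /funext e; rewrite e in hf *.
by congr Bop; exact: Prop_irrelevance.
Qed.

Lemma bop_linear T : linear T. Proof. by case: (bopP T). Qed.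
Lemma bopD T x y : T (x + y) = T x + T y.
Proof. by have := bop_linear T 1 x y; rewrite !scale1r. Qed.
Lemma bop0 T : T 0 = 0.
Proof. by apply/(@addrI _ (T 0)); rewrite -bopD !addr0. Qed.
Lemma bopZ T (k : R[i]) x : T (k *: x) = k *: T x.
Proof. by have := bop_linear T k x 0; rewrite bop0 !addr0. Qed.
Lemma bopN T x : T (- x) = - T x.
Proof. by rewrite -scaleN1r bopZ scaleN1r. Qed.
Lemma bopB T x y : T (x - y) = T x - T y.
Proof. by rewrite bopD bopN. Qed.
Lemma bop_sum T (I : Type) (r : seq I) (P : pred I) (F : I -> H) :
  T (\sum_(i <- r | P i) F i) = \sum_(i <- r | P i) T (F i).
Proof. by elim/big_rec2: _ => [|i u v _ <-]; rewrite ?bop0 ?bopD. Qed.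

Definition opn T : R := sup [set nr (T x) | x in [set x | nr x <= 1]].

Let opn_has_sup T : has_sup [set nr (T x) | x in [set x | nr x <= 1]].
Proof.
split; first by exists (nr (T 0)), 0 => //=; rewrite nr0.
have [_ [C hC] _] := bopP T; exists `|C| => _ [x /= x1 <-].
apply: le_trans (hC x) _; apply: le_trans (ler_wpM2r (nr_ge0 x) (ler_norm C)) _.
by rewrite -[leRHS]mulr1 ler_wpM2l.
Qed.

Lemma opn_ge0 T : 0 <= opn T.
Proof.
apply: le_trans (nr_ge0 (T 0)) _; apply: sup_upper_bound (opn_has_sup T) _ _.
by exists 0 => //=; rewrite nr0.
Qed.

Lemma bop_le T x : nr (T x) <= opn T * nr x.
Proof.
have [->|x0] := eqVneq x 0; first by rewrite bop0 !nr0 mulr0.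
have nx : 0 < nr x by rewrite nr_gt0.
have : nr (T ((nr x)^-1%:C *: x)) <= opn T.
  apply: sup_upper_bound (opn_has_sup T) _ _; exists ((nr x)^-1%:C *: x) => //=.
  by rewrite nrZ nrR ger0_norm ?invr_ge0 ?nr_ge0// mulVf ?gt_eqF.
by rewrite bopZ nrZ nrR ger0_norm ?invr_ge0 ?nr_ge0// mulrC ler_pdivrMr.
Qed.

Lemma opn_le T (C : R) : 0 <= C -> (forall x, nr (T x) <= C * nr x) -> opn T <= C.
Proof.
move=> C0 h; apply: ge_sup; first by case: (opn_has_sup T).
move=> _ [x /= x1 <-]; apply: le_trans (h x) _.
by rewrite -[leRHS]mulr1 ler_wpM2l.
Qed.

Lemma adjointable0 : adjointable (fun _ : H => 0 : H).
Proof.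
split; first by move=> k x y; rewrite scaler0 addr0.
  by exists 0 => x; rewrite nr0 mul0r.
by exists (fun=> 0) => x y; rewrite dot0l dot0r.
Qed.

Lemma adjointableD S T : adjointable (fun x => S x + T x).
Proof.
split; first by move=> k x y; rewrite !bopD !bopZ scalerDr addrACA.
  by exists (opn S + opn T) => x; rewrite mulrDl; apply: le_trans (nrD _ _) _; rewrite lerD// bop_le.
have [_ _ [g hg]] := bopP S; have [_ _ [g' hg']] := bopP T.
by exists (fun x => g x + g' x) => x y; rewrite dotDl dotDr hg hg'.
Qed.

Lemma adjointableZ (k : R[i]) T : adjointable (fun x => k *: T x).
Proof.
split; first by move=> l x y; rewrite !bopD !bopZ scalerDr !scalerA mulrC.
  by exists (nr k * opn T) => x; rewrite nrZ -mulrA ler_wpM2l ?nr_ge0 ?bop_le.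
have [_ _ [g hg]] := bopP T.
by exists (fun x => Num.conj k *: g x) => x y; rewrite dotZl hg dotZr conjCK.
Qed.

Lemma adjointableM S T : adjointable (S \o T).
Proof.
split; first by move=> l x y; rewrite /= !bopD !bopZ.
  exists (opn S * opn T) => x /=; apply: le_trans (bop_le _ _) _.
  by rewrite -mulrA ler_wpM2l ?opn_ge0 ?bop_le.
have [_ _ [g hg]] := bopP S; have [_ _ [g' hg']] := bopP T.
by exists (g' \o g) => x y /=; rewrite hg hg'.
Qed.

Lemma adjointable1 : adjointable (@id H).
Proof.
split => //; first by exists 1 => x; rewrite mul1r.
by exists id.
Qed.

Lemma adjointable_adj T : adjointable (sval (cid (let: And3 _ _ h := bopP T in h))).
Proof.
case: cid => g hg /=; split.
- move=> k x y; apply: dot_ext_r => z.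
  by rewrite -hg !dotDr !dotZr -!hg.
- exists (opn T) => x; have [->|gx] := eqVneq (g x) 0.
    by rewrite nr0 mulr_ge0 ?opn_ge0 ?nr_ge0.
  have gx0 : 0 < nr (g x) by rewrite nr_gt0.
  rewrite -(ler_pM2l gx0) -expr2 -Re_dot -hg.
  apply: le_trans (Re_le_nr _) _; apply: le_trans (cauchy_schwarz _ _) _.
  by rewrite mulrCA mulrA ler_wpM2r ?nr_ge0// bop_le.
- by exists T => x y; rewrite dotC -hg -dotC.
Qed.

Definition bop_zero := Bop adjointable0.
Definition bop_one := Bop adjointable1.
Definition bop_add S T := Bop (adjointableD S T).
Definition bop_scale k T := Bop (adjointableZ k T).
Definition bop_mul S T := Bop (adjointableM S T).
Definition adj T := Bop (adjointable_adj T).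

Lemma adjE T x y : dot (T x) y = dot x (adj T y).
Proof. by rewrite /=; case: cid => g /= ->. Qed.

Lemma adjE' T x y : dot (adj T x) y = dot x (T y).
Proof. by rewrite dotC -adjE -dotC. Qed.

Lemma adj_unique T U : (forall x y, dot (T x) y = dot x (U y)) -> adj T = U.
Proof. by move=> h; apply: bop_ext => y; apply: dot_ext_r => x; rewrite -adjE h. Qed.

HB.instance Definition _ := gen_eqMixin (bop H).
HB.instance Definition _ := gen_choiceMixin (bop H).

Lemma bop_addA : associative bop_add.
Proof. by move=> S T U; apply: bop_ext => x /=; rewrite addrA. Qed.
Lemma bop_addC : commutative bop_add.
Proof. by move=> S T; apply: bop_ext => x /=; rewrite addrC. Qed.
Lemma bop_add0 : left_id bop_zero bop_add.
Proof. by move=> S; apply: bop_ext => x /=; rewrite add0r. Qed.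
Lemma bop_addN : left_inverse bop_zero (bop_scale (-1)) bop_add.
Proof. by move=> S; apply: bop_ext => x /=; rewrite scaleN1r addNr. Qed.

HB.instance Definition _ := GRing.isZmodule.Build (bop H) bop_addA bop_addC bop_add0 bop_addN.

Lemma bop_scaleA (a b : R[i]) T : bop_scale a (bop_scale b T) = bop_scale (a * b) T.
Proof. by apply: bop_ext => x /=; rewrite scalerA. Qed.
Lemma bop_scale1 : left_id 1 bop_scale.
Proof. by move=> T; apply: bop_ext => x /=; rewrite scale1r. Qed.
Lemma bop_scaleDr : right_distributive bop_scale +%R.
Proof. by move=> k S T; apply: bop_ext => x /=; rewrite scalerDr. Qed.
Lemma bop_scaleDl T : {morph bop_scale^~ T : a b / a + b}.
Proof. by move=> a b; apply: bop_ext => x /=; rewrite scalerDl. Qed.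

HB.instance Definition _ := GRing.Zmodule_isLmodule.Build R[i] (bop H)
  bop_scaleA bop_scale1 bop_scaleDr bop_scaleDl.

Lemma bopDE S T x : (S + T) x = S x + T x. Proof. by []. Qed.
Lemma bopZE (k : R[i]) T x : (k *: T) x = k *: T x. Proof. by []. Qed.
Lemma bop0E x : (0 : bop H) x = 0. Proof. by []. Qed.
Lemma bopNE T x : (- T) x = - T x. Proof. by rewrite -scaleN1r bopZE scaleN1r. Qed.
Lemma bopBE S T x : (S - T) x = S x - T x. Proof. by rewrite bopDE bopNE. Qed.
Lemma bop_sumE (I : Type) (r : seq I) (P : pred I) (F : I -> bop H) x :
  (\sum_(i <- r | P i) F i) x = \sum_(i <- r | P i) F i x.
Proof. by elim/big_rec2: _ => [//|j u v _ <-]; rewrite bopDE. Qed.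

Lemma opnD S T : opn (S + T) <= opn S + opn T.
Proof.
apply: opn_le => [|x]; first by rewrite addr_ge0 ?opn_ge0.
by rewrite mulrDl; apply: le_trans (nrD _ _) _; rewrite lerD// bop_le.
Qed.

Lemma opnZ (k : R[i]) T : opn (k *: T) = nr k * opn T.
Proof.
have le (l : R[i]) U : opn (l *: U) <= nr l * opn U.
  apply: opn_le => [|x]; first by rewrite mulr_ge0 ?opn_ge0 ?nr_ge0.
  by rewrite bopZE nrZ -mulrA ler_wpM2l ?nr_ge0 ?bop_le.
have [->|k0] := eqVneq k 0.
  by apply/eqP; rewrite nr0 mul0r eq_le opn_ge0 andbT -[leRHS](mul0r (opn T)) -(nr0 R[i]) le.
apply/eqP; rewrite eq_le le/= -ler_pdivlMl ?nr_gt0// -nrV.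
by apply: le_trans (le _ _); rewrite scalerA mulVf// scale1r.
Qed.

Lemma opn_eq0 T : opn T = 0 -> T = 0.
Proof.
move=> h; apply: bop_ext => x; rewrite bop0E; apply: nr0_eq.
by apply/eqP; rewrite eq_le nr_ge0 andbT -[leRHS](mul0r (nr x)) -h bop_le.
Qed.

Lemma opn_adj T : opn (adj T) = opn T.
Proof.
have le U : opn (adj U) <= opn U.
  apply: opn_le => [|x]; first exact: opn_ge0.
  have [->|gx] := eqVneq (adj U x) 0.
    by rewrite nr0 mulr_ge0 ?opn_ge0 ?nr_ge0.
  have gx0 : 0 < nr (adj U x) by rewrite nr_gt0.
  rewrite -(ler_pM2l gx0) -expr2 -Re_dot -adjE.
  apply: le_trans (Re_le_nr _) _; apply: le_trans (cauchy_schwarz _ _) _.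
  by rewrite mulrCA mulrA ler_wpM2r ?nr_ge0// bop_le.
apply/eqP; rewrite eq_le le/=; apply: le_trans (le (adj T)).
by rewrite le_eqVlt; apply/orP; left; apply/eqP; congr opn; apply/esym/adj_unique => x y; rewrite adjE'.
Qed.

Lemma adjD S T : adj (S + T) = adj S + adj T.
Proof. by apply: adj_unique => x y; rewrite !bopDE dotDl dotDr !adjE. Qed.

Lemma adjZ (k : R[i]) T : adj (k *: T) = Num.conj k *: adj T.
Proof. by apply: adj_unique => x y; rewrite !bopZE dotZl dotZr conjCK adjE. Qed.

Lemma adjK : involutive adj.
Proof. by move=> T; apply: adj_unique => x y; rewrite adjE'. Qed.

Lemma adjM S T : adj (bop_mul S T) = bop_mul (adj T) (adj S).
Proof. by apply: adj_unique => x y; rewrite /= -[S (T x)]/(S _) -[T x]/(T _) !adjE. Qed.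

Lemma opnM S T : opn (bop_mul S T) <= opn S * opn T.
Proof.
apply: opn_le => [|x]; first by rewrite mulr_ge0 ?opn_ge0.
by apply: le_trans (bop_le S _) _; rewrite -mulrA ler_wpM2l ?opn_ge0 ?bop_le.
Qed.

Lemma opn_star_mul T : opn (bop_mul (adj T) T) = opn T ^+ 2.
Proof.
apply/eqP; rewrite eq_le; apply/andP; split.
  by apply: le_trans (opnM _ _) _; rewrite opn_adj.
rewrite -[leRHS]sqr_sqrtr ?opn_ge0// ler_pXn2r ?nnegrE ?opn_ge0 ?sqrtr_ge0//.
apply: opn_le => [|x]; first exact: sqrtr_ge0.
rewrite -(@ler_pXn2r _ 2)// ?nnegrE ?mulr_ge0 ?nr_ge0 ?sqrtr_ge0// exprMn sqr_sqrtr ?opn_ge0//.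
rewrite -Re_dot adjE; apply: le_trans (Re_le_nr _) _; apply: le_trans (cauchy_schwarz _ _) _.
by rewrite mulrC expr2 mulrA ler_wpM2r ?nr_ge0// (bop_le (bop_mul (adj T) T)).
Qed.

Lemma bop_complete (u : nat -> bop H) :
  (forall e : R, 0 < e -> exists N, forall m n, (N <= m)%N -> (N <= n)%N ->
      opn (u m - u n) < e) ->
  exists l, forall e : R, 0 < e -> exists N, forall n, (N <= n)%N -> opn (u n - l) < e.
Proof.
move=> cu.
have pt (v : nat -> bop H) : (forall e : R, 0 < e -> exists N, forall m n, (N <= m)%N -> (N <= n)%N ->
      opn (v m - v n) < e) -> forall x, exists l, scvg (fun n => v n x) l.
  move=> cv x; apply: complete_scvg => e e0.
  have e'0 : 0 < e / (1 + nr x) by rewrite divr_gt0// ltr_wpDr ?nr_ge0.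
  have [N hN] := cv _ e'0; exists N => m n Nm Nn; rewrite -bopBE.
  apply: le_lt_trans (bop_le _ _) _; have := hN m n Nm Nn.
  rewrite ltr_pdivlMr ?ltr_wpDr ?nr_ge0//; apply: le_lt_trans.
  by rewrite ler_wpM2l ?opn_ge0// lerDr.
have /choice [T hT] := pt u cu.
(* Taking adjoints is isometric, so the adjoints converge pointwise too, and their limit is the
   adjoint of T. *)
have /choice [T' hT'] : forall x, exists l, scvg (fun n => adj (u n) x) l.
  apply: (pt (fun n => adj (u n))) => e e0; have [N hN] := cu e e0; exists N => m n Nm Nn.
  have -> : adj (u m) - adj (u n) = adj (u m - u n).
    by rewrite adjD -(scaleN1r (u n)) adjZ rmorphN rmorph1 scaleN1r.
  by rewrite opn_adj hN.
have lT : linear T.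
  move=> k x y; apply: (scvg_uniq (hT _)).
  have := scvgD (scvgZ k (hT x)) (hT y).
  by congr scvg; apply/funext => n; rewrite bopD bopZ.
have key (e : R) : 0 < e -> exists N, forall n, (N <= n)%N -> forall x, nr (u n x - T x) <= e * nr x.
  move=> e0; have [N hN] := cu e e0; exists N => n Nn x.
  rewrite nrC; apply: scvg_le (hT x) _; exists N => m Nm; rewrite -bopBE.
  by apply: le_trans (bop_le _ _) _; rewrite ler_wpM2r ?nr_ge0// ltW// hN.
have aT : adjointable T.
  split => //.
    have [N hN] := key 1 ltr01; exists (1 + opn (u N)) => x.
    rewrite mulrDl -[T x](subrK (u N x)); apply: le_trans (nrD _ _) _.
    by rewrite lerD ?bop_le// nrC hN.
  exists T' => x y; apply: (scvg_uniq (scvg_dotl y (hT x))).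
  have := scvg_dotr x (hT' y); congr scvg; apply/funext => n.
  by rewrite adjE.
exists (Bop aT) => e e0; have e2 : 0 < e / 2 by rewrite divr_gt0.
have [N hN] := key _ e2; exists N => n Nn.
apply: (@le_lt_trans _ _ (e / 2)); last by rewrite ltr_pdivrMr// mulr_natr mulr2n ltrDl.
by apply: opn_le => [|x]; [exact: ltW|rewrite bopBE; exact: hN].
Qed.

HB.instance Definition _ := @Lmodule_isRealNormed.Build R (bop H) opn
  opnD opnZ opn_eq0 bop_complete.

Lemma opnE T : nr T = opn T. Proof. by []. Qed.

Lemma bop_mulA : associative bop_mul.
Proof. by move=> S T U; apply: bop_ext. Qed.
Lemma bop_mulDl : left_distributive bop_mul +%R.
Proof. by move=> S T U; apply: bop_ext. Qed.
Lemma bop_mulDr : right_distributive bop_mul +%R.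
Proof. by move=> S T U; apply: bop_ext => x; rewrite /= bopD. Qed.
Lemma bop_mulZl (k : R[i]) S T : bop_mul (k *: S) T = k *: bop_mul S T.
Proof. by apply: bop_ext. Qed.
Lemma bop_mulZr (k : R[i]) S T : bop_mul S (k *: T) = k *: bop_mul S T.
Proof. by apply: bop_ext => x; rewrite /= bopZ. Qed.
Lemma bop_norm_mul S T : `|bop_mul S T| <= `|S| * `|T|.
Proof. by rewrite !nrE -rmorphM/= lecR opnM. Qed.
Lemma bop_norm_star_mul T : `|bop_mul (adj T) T| = `|T| ^+ 2.
Proof. by rewrite !nrE -rmorphXn/= -opn_star_mul. Qed.

HB.instance Definition _ := @isCStarAlgebra.Build R (bop H) bop_mul adj
  bop_mulA bop_mulDl bop_mulDr bop_mulZl bop_mulZr adjK adjD adjZ adjM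
  bop_norm_mul bop_norm_star_mul.

Lemma bopME S T x : (S ** T) x = S (T x). Proof. by []. Qed.

End BoundedOperators.

(** * Norms on C*-algebras *)

Section CStarTheory.
Context {R : realType}.
Implicit Types A B : cstarAlgType R.

Lemma cmul0l A (x : A) : 0 ** x = 0.
Proof. by rewrite -(scale0r x) cmulZl !scale0r. Qed.
Lemma cmul0r A (x : A) : x ** 0 = 0.
Proof. by rewrite -(scale0r x) cmulZr !scale0r. Qed.
Lemma cmulNl A (x y : A) : (- x) ** y = - (x ** y).
Proof. by rewrite -scaleN1r cmulZl scaleN1r. Qed.
Lemma cmulNr A (x y : A) : x ** (- y) = - (x ** y).
Proof. by rewrite -scaleN1r cmulZr scaleN1r. Qed.
Lemma cmulBl A (x y z : A) : (x - y) ** z = x ** z - y ** z.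
Proof. by rewrite cmulDl cmulNl. Qed.
Lemma cmulBr A (x y z : A) : z ** (x - y) = z ** x - z ** y.
Proof. by rewrite cmulDr cmulNr. Qed.
Lemma cmul_suml A (I : Type) (r : seq I) (P : pred I) (F : I -> A) y :
  (\sum_(i <- r | P i) F i) ** y = \sum_(i <- r | P i) F i ** y.
Proof. by elim/big_rec2: _ => [|i u v _ <-]; rewrite ?cmul0l ?cmulDl. Qed.
Lemma cmul_sumr A (I : Type) (r : seq I) (P : pred I) (F : I -> A) y :
  y ** (\sum_(i <- r | P i) F i) = \sum_(i <- r | P i) y ** F i.
Proof. by elim/big_rec2: _ => [|i u v _ <-]; rewrite ?cmul0r ?cmulDr. Qed.
Lemma star0 A : star (0 : A) = 0.
Proof. by rewrite -(scale0r (0 : A)) starZ rmorph0 !scale0r. Qed.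
Lemma starN A (x : A) : star (- x) = - star x.
Proof. by rewrite -scaleN1r starZ rmorphN1 scaleN1r. Qed.
Lemma starB A (x y : A) : star (x - y) = star x - star y.
Proof. by rewrite starD starN. Qed.
Lemma star_sum A (I : Type) (r : seq I) (P : pred I) (F : I -> A) :
  star (\sum_(i <- r | P i) F i) = \sum_(i <- r | P i) star (F i).
Proof. by elim/big_rec2: _ => [|i u v _ <-]; rewrite ?star0 ?starD. Qed.

Lemma nr_cmul A (x y : A) : nr (x ** y) <= nr x * nr y.
Proof. by have := norm_cmul x y; rewrite !nrE -rmorphM lecR. Qed.

Lemma nr_star_cmul A (x : A) : nr (star x ** x) = nr x ^+ 2.
Proof. by have := norm_star_cmul x; rewrite !nrE -rmorphXn => /(@complexI R). Qed.

Lemma nr_star A (x : A) : nr (star x) = nr x.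
Proof.
have le (y : A) : nr y <= nr (star y).
  have [->|y0] := eqVneq y 0; first by rewrite star0.
  have ny : 0 < nr y by rewrite nr_gt0.
  by rewrite -(ler_pM2r ny) -expr2 -nr_star_cmul nr_cmul.
by apply/eqP; rewrite eq_le le andbT -{2}[x]starK le.
Qed.

Lemma scvg_cmul A (u v : nat -> A) l m : scvg u l -> scvg v m ->
  scvg (fun n => u n ** v n) (l ** m).
Proof.
move=> h h' e e0; pose c := nr l + nr m + 1.
have c0 : 0 < c by rewrite /c ltr_wpDl// addr_ge0 ?nr_ge0.
have m0 : 0 < Num.min 1 (e / (2 * c)) by rewrite lt_min ltr01 divr_gt0// mulr_gt0.
have [N hN] := h _ m0; have [M hM] := h' _ m0.
exists (maxn N M) => n; rewrite geq_max => /andP[/hN {}hN /hM {}hM].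
move: hN hM; rewrite !lt_min => /andP[_ hN] /andP[hM1 hM].
have -> : u n ** v n - l ** m = (u n - l) ** v n + l ** (v n - m).
  by rewrite cmulBl cmulBr addrA subrK.
have hv : nr (v n) <= nr m + 1.
  by rewrite -[v n](subrK m) addrC; apply: le_trans (nrD _ _) _; rewrite lerD2l ltW.
apply: le_lt_trans (nrD _ _) _.
have h1 : nr ((u n - l) ** v n) <= (e / (2 * c)) * (nr m + 1).
  by apply: le_trans (nr_cmul _ _) _; rewrite ler_pM ?nr_ge0// ltW.
have h2 : nr (l ** (v n - m)) <= (e / (2 * c)) * nr l.
  by rewrite mulrC; apply: le_trans (nr_cmul _ _) _; rewrite ler_wpM2l ?nr_ge0// ltW.
apply: le_lt_trans (lerD h1 h2) _; rewrite -mulrDr.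
have -> : nr m + 1 + nr l = c by rewrite /c; ring.
by rewrite invfM mulrA divfK ?gt_eqF// ltr_pdivrMr// mulr_natr mulr2n ltrDl.
Qed.

Lemma scvg_star A (u : nat -> A) l : scvg u l -> scvg (fun n => star (u n)) (star l).
Proof. by move=> h e e0; have [N hN] := h e e0; exists N => n /hN; rewrite -starB nr_star. Qed.

Lemma scvg_cst (V : normedZmodType R[i]) (l : V) : scvg (fun=> l) l.
Proof. by move=> e e0; exists 0 => n _; rewrite subrr nr0. Qed.

Lemma halfC (V : lmodType R[i]) (x : V) : (2^-1 : R)%:C *: (x + x) = x.
Proof.
rewrite -mulr2n -(scaler_nat 2 x) scalerA -(rmorph_nat (real_complex R)) -rmorphM/= mulVf//.
by rewrite scale1r.
Qed.

Lemma seminorm_double (V : lmodType R[i]) (p : V -> R) (x : V) :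
  (forall (k : R[i]) y, p (k *: y) = nr k * p y) -> p (x + x) = 2 * p x.
Proof. by move=> pZ; rewrite -{3}(halfC x) pZ nrR ger0_norm// mulVKf. Qed.

Lemma nr_double (V : normedModType R[i]) (x : V) : nr (x + x) = 2 * nr x.
Proof. by apply: seminorm_double => k y; rewrite nrZ. Qed.

(* The iteration Y <- (W + Y^2) / 2 from 0 is majorized by its scalar
   counterpart at 1, which increases and stays below 1; its limit is
   1 - sqrt (1 - W), written without a unit. *)
Lemma one_sub_sqrt A (W : A) : nr W <= 1 ->
  exists Y : A, [/\ Y + Y = W + Y ** Y, nr Y <= 1, star W = W -> star Y = Y &
     forall c, c ** W = W ** c -> c ** Y = Y ** c].
Proof.
move=> W1.
pose Y := fix Y n : A := if n is m.+1 then (2^-1 : R)%:C *: (W + Y m ** Y m) else 0.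
pose y := fix y n : R := if n is m.+1 then 2^-1 * (1 + y m ^+ 2) else 0.
have YS n : Y n.+1 = (2^-1 : R)%:C *: (W + Y n ** Y n) by [].
have yS n : y n.+1 = 2^-1 * (1 + y n ^+ 2) by [].
have y0 n : 0 <= y n by elim: n => [//|n IH]; rewrite yS mulr_ge0// addr_ge0 ?sqr_ge0.
have y1 n : y n <= 1.
  elim: n => [|n IH]; first exact: ler01.
  have : y n ^+ 2 <= 1 by rewrite expr_le1.
  by rewrite yS; lra.
have Yy n : nr (Y n) <= y n.
  elim: n => [|n IH]; first by rewrite nr0.
  rewrite YS yS nrZ nrR ger0_norm// ler_wpM2l//; apply: le_trans (nrD _ _) _.
  rewrite lerD//; apply: le_trans (nr_cmul _ _) _; rewrite expr2.
  by rewrite ler_pM ?nr_ge0.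
have Yc c : c ** W = W ** c -> forall n, c ** Y n = Y n ** c.
  move=> cW; elim=> [|n IH]; first by rewrite /= cmul0l cmul0r.
  by rewrite YS cmulZl cmulZr cmulDl cmulDr cW cmulA IH -cmulA IH cmulA.
(* The iterates commute, so a difference of squares factors as (Y' - Y)(Y' + Y), exactly as for the
   scalar sequence; induction then compares the two factors. *)
have Yd n : nr (Y n.+1 - Y n) <= y n.+1 - y n.
  elim: n => [|n IH]; first by rewrite !subr0.
  have -> : Y n.+2 - Y n.+1 = (2^-1 : R)%:C *: ((Y n.+1 - Y n) ** (Y n.+1 + Y n)).
    rewrite (YS n.+1) {2}(YS n) -scalerBr opprD addrACA subrr add0r.
    rewrite cmulDr !cmulBl (Yc (Y n) _ n.+1) ?addrA ?subrK//.
    by apply/esym; apply: Yc.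
  have -> : y n.+2 - y n.+1 = 2^-1 * ((y n.+1 - y n) * (y n.+1 + y n)).
    by rewrite (yS n.+1) {2}(yS n); ring.
  rewrite nrZ nrR ger0_norm// ler_wpM2l//; apply: le_trans (nr_cmul _ _) _.
  by rewrite ler_pM ?nr_ge0//; apply: le_trans (nrD _ _) _; rewrite lerD.
have ynd n k : y n <= y (n + k)%N.
  elim: k => [|k IH]; first by rewrite addn0.
  by rewrite addnS; apply: le_trans IH _; rewrite -subr_ge0; apply: le_trans (nr_ge0 _) (Yd _).
have Yd' n k : nr (Y (n + k)%N - Y n) <= y (n + k)%N - y n.
  elim: k => [|k IH]; first by rewrite addn0 !subrr nr0.
  rewrite addnS; apply: le_trans (nr_tri (Y (n + k)%N) _ _) _.
  by apply: le_trans (lerD (Yd _) IH) _; rewrite addrA subrK.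
have hs : has_sup (range y).
  by split; [exists (y 0); exists 0|exists 1 => _ [n _ <-]].
have yC (e : R) : 0 < e -> exists N, forall m n, (N <= n)%N -> y m - y n < e.
  move=> e0; have [_ [N _ <-] hN] := sup_adherent e0 hs.
  exists N => m n Nn; have : y m <= sup (range y) by apply: sup_upper_bound => //; exists m.
  by have := ynd N (n - N)%N; rewrite subnKC//; lra.
have [L hL] : exists l, scvg Y l.
  apply: complete_scvg => e e0; have [N hN] := yC e e0; exists N => m n Nm Nn.
  have [nm|mn] := leqP n m.
    by rewrite -(subnKC nm); apply: le_lt_trans (Yd' _ _) _; exact: hN.
  by rewrite nrC -(subnKC (ltnW mn)); apply: le_lt_trans (Yd' _ _) _; exact: hN.
exists L; split.
- have h1 : scvg (fun n => Y n.+1) L.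
    by move=> e e0; have [N hN] := hL e e0; exists N => n Nn; apply: hN; exact: leqW.
  have h2 := scvgZ (2^-1 : R)%:C (scvgD (scvg_cst W) (scvg_cmul hL hL)).
  by rewrite {1 2}(scvg_uniq h1 h2) -scalerDr halfC.
- rewrite -[L]subr0; apply: scvg_le hL _; exists 0 => n _; rewrite subr0.
  exact: le_trans (Yy n) (y1 n).
- move=> sW; have sY n : star (Y n) = Y n.
    elim: n => [|n IH]; first by rewrite /= star0.
    by rewrite YS starZ conjR starD starM sW IH.
  apply: (scvg_uniq (scvg_star hL)).
  by move: hL; congr scvg; apply/funext => n; rewrite sY.
- move=> c cW; apply: (scvg_uniq (scvg_cmul (scvg_cst c) hL)).
  have := scvg_cmul hL (scvg_cst c); congr scvg; apply/funext => n.
  by rewrite Yc.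
Qed.

(* [h ** b + 'i *: (b - Y ** b)] is w b for the unitary w = h + i sqrt (1 - h^2). *)
Lemma formal_unitary A (h Y b : A) : star h = h -> star Y = Y -> h ** Y = Y ** h ->
  Y + Y = h ** h + Y ** Y ->
  star (h ** b + 'i *: (b - Y ** b)) ** (h ** b + 'i *: (b - Y ** b)) = star b ** b.
Proof.
move=> sh sY hY eY.
rewrite starD starZ starB !starM sh sY cmulDl !cmulDr.
set u := h ** b; set m := b - Y ** b.
have -> : Num.conj 'i = - 'i :> R[i] by rewrite conjE /= -[RHS]/((- 0) +i* (- 1)) oppr0.
set u' := star b ** h; set m' := star b - star b ** Y.
have um : u' ** m = m' ** u.
  by rewrite /u' /m /m' /u cmulBr cmulBl !cmulA -(cmulA _ h Y) hY cmulA.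
have mm : m' ** m = star b ** b - u' ** u.
  rewrite /m' /m cmulBr !cmulBl.
  have -> : u' ** u = star b ** (h ** h) ** b by rewrite /u' /u !cmulA.
  have -> : h ** h = Y + Y - Y ** Y by rewrite eY addrK.
  by rewrite cmulBr cmulBl cmulDr cmulDl !cmulA !opprD !opprK !addrA.
rewrite !cmulZl !cmulZr um mm scalerA mulNr -expr2 sqr_i opprK scale1r scaleNr.
by rewrite -addrA (addrA (_ *: _)) subrr add0r addrC subrK.
Qed.

Section Seminorm.
Context {A : cstarAlgType R} (p : A -> R).
Hypothesis pD : forall x y, p (x + y) <= p x + p y.
Hypothesis pZ : forall (k : R[i]) x, p (k *: x) = nr k * p x.
Hypothesis pS : forall x y, star x ** x = star y ** y -> p x = p y.

Let pN x : p (- x) = p x.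
Proof. by rewrite -scaleN1r pZ nrN nr1 mul1r. Qed.

(** h is the mean of the formal unitaries h + i sqrt (1 - h^2) and h - i sqrt (1 - h^2), and each of
    them preserves p, since p x depends only on x^* x. In this generality the argument serves
    C*-seminorms as well as one leg of a tensor norm. *)
Lemma selfadjoint_contracts h b : star h = h -> nr h <= 1 -> p (h ** b) <= p b.
Proof.
move=> sh h1; have hh1 : nr (h ** h) <= 1.
  by apply: le_trans (nr_cmul _ _) _; rewrite -expr2 expr_le1 ?nr_ge0.
have [Y [eY _ sY cY]] := one_sub_sqrt hh1.
have {}sY : star Y = Y by apply: sY; rewrite starM sh.
have hY : h ** Y = Y ** h by apply: cY; rewrite cmulA.
have f1 := pS (formal_unitary b sh sY hY eY).
have f2 : p ((- h) ** b + 'i *: (b - Y ** b)) = p b.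
  apply/pS/formal_unitary => //; first by rewrite starN sh.
    by rewrite cmulNl cmulNr hY.
  by rewrite cmulNl cmulNr opprK.
have -> : h ** b = (2^-1 : R)%:C *: ((h ** b + 'i *: (b - Y ** b)) - ((- h) ** b + 'i *: (b - Y ** b))).
  by rewrite opprD addrACA subrr addr0 cmulNl opprK halfC.
rewrite pZ nrR ger0_norm//; apply: le_trans (ler_wpM2l _ (pD _ _)) _ => //.
by rewrite pN f1 f2; lra.
Qed.

End Seminorm.

Lemma nr_pS A (x y : A) : star x ** x = star y ** y -> nr x = nr y.
Proof.
move=> e; apply/eqP; rewrite -(@eqrXn2 _ 2) ?nr_ge0//.
by rewrite -!nr_star_cmul e.
Qed.

(* [h - h ** Y] stands for sin cos where h = sin, so its double is a sine. *)
Lemma double_angle_le1 A (h Y : A) : star h = h -> star Y = Y -> h ** Y = Y ** h ->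
  Y + Y = h ** h + Y ** Y ->
  nr ((h - h ** Y) + (h - h ** Y)) <= 1.
Proof.
move=> sh sY hY eY; set c := _ + _.
have f1 b := nr_pS (formal_unitary b sh sY hY eY).
have f2 b : nr ((- h) ** b + 'i *: (b - Y ** b)) = nr b.
  apply/nr_pS/formal_unitary => //; first by rewrite starN sh.
    by rewrite cmulNl cmulNr hY.
  by rewrite cmulNl cmulNr opprK.
have key b : nr (c ** b) <= nr b.
  set m := b - Y ** b; set a := h ** b.
  have hm : h ** m = a - Y ** a.
    by rewrite /m /a cmulBr !cmulA hY.
  have cb : c ** b = h ** m + h ** m.
    by rewrite /c /m cmulDl !cmulBl cmulBr cmulA.
  (* With w = h + i sqrt (1 - h^2) and w' = - h + i sqrt (1 - h^2) this is the identity 2 i c = w^2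
     - w'^2 applied to b; both w and w' are isometric. *)
  have e : 'i *: (c ** b + c ** b) =
     (h ** (a + 'i *: m) + 'i *: ((a + 'i *: m) - Y ** (a + 'i *: m))) -
     ((- h) ** (- a + 'i *: m) + 'i *: ((- a + 'i *: m) - Y ** (- a + 'i *: m))).
    have hX : h ** (a + 'i *: m) - (- h) ** (- a + 'i *: m) = 'i *: (h ** m + h ** m).
      by rewrite cmulNl opprK (cmulDr h a) (cmulDr h (- a)) cmulNr addrACA subrr add0r cmulZr -scalerDr.
    have hZ : a + 'i *: m - Y ** (a + 'i *: m) - (- a + 'i *: m - Y ** (- a + 'i *: m)) =
        (a - Y ** a) + (a - Y ** a).
      rewrite (cmulDr Y a) (cmulDr Y (- a)) cmulNr !opprD !opprK.
      by rewrite [LHS](AC ((2*2)*(2*2)) ((1*3)*(5*7)*((2*6)*(4*8))))/= subrr addNr !addr0.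
    rewrite opprD addrACA -scalerBr.
    transitivity ('i *: (h ** m + h ** m) + 'i *: ((a - Y ** a) + (a - Y ** a))).
      by rewrite -hm cb -scalerDr.
    by congr (_ + 'i *: _); rewrite (hX, hZ).
  have : nr (c ** b + c ** b) <= nr b + nr b.
    have -> : nr (c ** b + c ** b) = nr ('i *: (c ** b + c ** b)).
      by rewrite nrZ /nr normc_def/= expr0n/= add0r expr1n sqrtr1 mul1r.
    rewrite e; apply: le_trans (nrB _ _) _.
    by rewrite f1 -(cmulNl h b) f2 f1 f2.
  rewrite nr_double.
  by move=> h2; lra.
have sc : star c = c.
  by rewrite /c starD starB starM sh sY -hY.
have : nr c ^+ 2 <= nr c by rewrite -nr_star_cmul sc key.
have := nr_ge0 c; move: (nr c) => t t0; rewrite expr2.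
by move: t0; rewrite le_eqVlt => /orP[/eqP <-//|t0]; rewrite -[X in _ <= X -> _]mulr1 ler_pM2l.
Qed.

Record cstar_seminorm A (p : A -> R) : Prop := {
  cs_ge0 : forall x, 0 <= p x ;
  cs_add : forall x y, p (x + y) <= p x + p y ;
  cs_scale : forall (k : R[i]) x, p (k *: x) = nr k * p x ;
  cs_star : forall x, p (star x ** x) = p x ^+ 2
}.

Lemma cs_pS A (p : A -> R) : cstar_seminorm p ->
  forall x y, star x ** x = star y ** y -> p x = p y.
Proof.
move=> hp x y e; apply/eqP; rewrite -(@eqrXn2 _ 2) ?(cs_ge0 hp)//.
by rewrite -!(cs_star hp) e.
Qed.

(** For self-adjoint h of norm at most one, p h ^ 2 = p (h h) <= p h by [selfadjoint_contracts], so
    p h <= 1; the C*-identity for x^* x passes to arbitrary x. Submultiplicativity is thus replaced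
    by the C*-identity alone. *)
Lemma cstar_seminorm_le A (p : A -> R) : cstar_seminorm p -> forall x, p x <= nr x.
Proof.
move=> hp.
have sa h : star h = h -> nr h <= 1 -> p h <= 1.
  move=> sh h1; have := selfadjoint_contracts (cs_add hp) (cs_scale hp) (cs_pS hp) h sh h1.
  rewrite -{1}sh (cs_star hp) expr2; have := cs_ge0 hp h; move: (p h) => t.
  by rewrite le_eqVlt => /orP[/eqP <-//|t0]; rewrite -[X in _ <= X -> _]mulr1 ler_pM2l.
have sa' h : star h = h -> p h <= nr h.
  move=> sh; have [->|h0] := eqVneq h 0.
    by rewrite nr0 -[0 : A](scale0r 0) (cs_scale hp) nr0 mul0r.
  have nh : 0 < nr h by rewrite nr_gt0.
  have ih0 : 0 < (nr h)^-1 by rewrite invr_gt0.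
  have : p ((nr h)^-1%:C *: h) <= 1.
    apply: sa; first by rewrite starZ conjR sh.
    by rewrite nrZ nrR gtr0_norm// mulVf ?gt_eqF.
  by rewrite (cs_scale hp) nrR gtr0_norm// mulrC ler_pdivrMr// mul1r.
move=> x; rewrite -(@ler_pXn2r _ 2) ?nnegrE ?nr_ge0 ?(cs_ge0 hp)//.
by rewrite -(cs_star hp) -nr_star_cmul sa'// starM starK.
Qed.

Lemma star_hom_le A B (f : A -> B) : star_hom f -> forall x, nr (f x) <= nr x.
Proof.
move=> [lf mf sf].
have fD x y : f (x + y) = f x + f y by have := lf 1 x y; rewrite !scale1r.
have f0 : f 0 = 0 by apply/(@addrI _ (f 0)); rewrite -fD !addr0.
apply: (@cstar_seminorm_le A (fun x => nr (f x))); split => [x|x y|k x|x].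
- exact: nr_ge0.
- by rewrite fD nrD.
- by have := lf k x 0; rewrite !addr0 f0 addr0 => ->; rewrite nrZ.
- by rewrite mf sf nr_star_cmul.
Qed.

Fixpoint sqpow A (x : A) n := if n is m.+1 then sqpow x m ** sqpow x m else x.

Lemma sqpow_star A (x : A) n : star x = x -> star (sqpow x n) = sqpow x n.
Proof. by move=> sx; elim: n => //= n IH; rewrite starM IH. Qed.

Lemma cs_sqpow A (p : A -> R) (x : A) n : cstar_seminorm p -> star x = x ->
  p (sqpow x n) = p x ^+ (2 ^ n).
Proof.
move=> hp sx; elim: n => [|n IH] /=; first by rewrite expr1.
by rewrite -{1}(sqpow_star n sx) (cs_star hp) IH -exprM -expnSr.
Qed.

Lemma nr_cstar_seminorm A : cstar_seminorm (fun x : A => nr x).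
Proof.
split => [x|x y|k x|x]; [exact: nr_ge0|exact: nrD|exact: nrZ|exact: nr_star_cmul].
Qed.

Lemma exp2n_small (r e : R) : 0 <= r < 1 -> 0 < e -> exists n, r ^+ (2 ^ n) < e.
Proof.
move=> /andP[r0 r1] e0.
have : (fun n => r ^+ n) @ \oo --> 0 by apply: cvg_expr; rewrite ger0_norm.
move=> /cvgrPdist_lt /(_ e e0) [N _ hN]; exists N.
have : (N <= 2 ^ N)%N by rewrite ltnW// ltn_expl.
by move=> /hN /=; rewrite sub0r normrN ger0_norm// exprn_ge0.
Qed.

Lemma comm_sq A (a c : A) : a ** c = c ** a -> (a ** a) ** c = c ** (a ** a).
Proof. by move=> h; rewrite -cmulA h cmulA h cmulA. Qed.

(* If p h < 1 = |h|, rescale so that p (h^2) <= 1/4 and put z = |1 - 2 h^2| - (1 - 2 h^2):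
   p z = 0 because the spectrum of h^2 for p lies left of 1/2, but z <> 0. *)
Lemma cstar_norm_unique A (p : A -> R) : cstar_seminorm p ->
  (forall x y, p (x ** y) <= p x * p y) -> (forall x, p x = 0 -> x = 0) ->
  forall x, p x = nr x.
Proof.
move=> hp pM p0.
have ple := cstar_seminorm_le hp.
suff sa h : star h = h -> nr h = 1 -> 1 <= p h.
  move=> x; have [->|x0] := eqVneq x 0.
    by rewrite nr0 -[0 : A](scale0r 0) (cs_scale hp) nr0 mul0r.
  have nx : 0 < nr (star x ** x) by rewrite nr_star_cmul exprn_gt0// nr_gt0.
  have ix : 0 < (nr (star x ** x))^-1 by rewrite invr_gt0.
  have := sa ((nr (star x ** x))^-1%:C *: (star x ** x)).
  rewrite starZ conjR starM starK nrZ nrR gtr0_norm// mulVf ?gt_eqF// => /(_ erefl erefl).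
  rewrite (cs_scale hp) nrR gtr0_norm// mulrC ler_pdivlMr// mul1r.
  rewrite nr_star_cmul (cs_star hp) ler_pXn2r ?nnegrE ?nr_ge0 ?(cs_ge0 hp)// => h1.
  by apply/eqP; rewrite eq_le ple h1.
move=> sh0 nh0; rewrite leNgt; apply/negP => ph0.
(* Repeated squaring preserves the norm 1 of h but drives p below 1/2, hence p of one further square
   below 1/4. *)
have [j hj] := @exp2n_small (p h) (2^-1) (introT andP (conj (cs_ge0 hp h) ph0)) ltac:(lra).
rewrite -(cs_sqpow j hp sh0) in hj.
have nh : nr (sqpow h j) = 1 by rewrite (cs_sqpow j (nr_cstar_seminorm A) sh0) nh0 expr1n.
have sh := sqpow_star j sh0.
move: (sqpow h j) hj nh sh => k hk nk sk {h sh0 nh0 ph0 j}.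
have nx : nr (k ** k) = 1 by rewrite -{1}sk nr_star_cmul nk expr1n.
have px : p (k ** k) <= 4^-1.
  by rewrite -{1}sk (cs_star hp); have := cs_ge0 hp k; move: (p k) hk => t; nra.
have [y [ey _ sy cy]] : exists Y : A, [/\ Y + Y = k ** k + Y ** Y, nr Y <= 1,
   star (k ** k) = k ** k -> star Y = Y & forall c, c ** (k ** k) = (k ** k) ** c -> c ** Y = Y ** c].
  by apply: one_sub_sqrt; rewrite nx.
have {}sy : star y = y by apply: sy; rewrite starM sk.
have ky : k ** y = y ** k by apply: cy; rewrite cmulA.
(* Here 1 - y = sqrt (1 - k^2), so for x = k^2 one has c^2 = 4 x (1 - x) and 1 - c^2 = (1 - 2 x)^2;
   therefore 1 - Y = |1 - 2 x|, computed without a unit. *)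
pose c := (k - k ** y) + (k - k ** y).
have nc : nr c <= 1 by exact: double_angle_le1.
have [Y [eY nY _ cY]] : exists Y : A, [/\ Y + Y = c ** c + Y ** Y, nr Y <= 1,
   star (c ** c) = c ** c -> star Y = Y & forall d, d ** (c ** c) = (c ** c) ** d -> d ** Y = Y ** d].
  apply: one_sub_sqrt; apply: le_trans (nr_cmul _ _) _.
  by rewrite mulr_ile1 ?nr_ge0.
set x := k ** k in px nx ey.
have xk : x ** k = k ** x by rewrite /x cmulA.
have xy : x ** y = y ** x by exact: comm_sq.
have ky2 : (k - k ** y) ** (k - k ** y) = x - x ** x.
  have e0 : y + y - y ** y = x by rewrite ey addrK.
  have e1 : k ** y ** k = x ** y by rewrite -(cmulA k y k) -ky (cmulA k k y).
  have e2 : k ** y ** (k ** y) = x ** (y ** y).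
    by rewrite -(cmulA k y (k ** y)) (cmulA y k y) -ky -(cmulA k y y) (cmulA k k (y ** y)).
  have e3 : k ** (k ** y) = x ** y by rewrite (cmulA k k y).
  rewrite cmulBl !cmulBr e1 e2 e3 -/x.
  have -> : x ** x = x ** y + x ** y - x ** (y ** y) by rewrite -{2}e0 cmulBr cmulDr.
  by rewrite !opprD !opprK !addrA.
have cc : c ** c = (x - x ** x) + (x - x ** x) + ((x - x ** x) + (x - x ** x)).
  by rewrite /c; move: (k - k ** y) ky2 => w hw; rewrite cmulDl !cmulDr !hw.
have kc : k ** c = c ** k.
  have kw : k ** (k - k ** y) = (k - k ** y) ** k.
    by rewrite cmulBl cmulBr -(cmulA k y k) -ky.
  by rewrite /c cmulDl cmulDr kw.
have kY : k ** Y = Y ** k by apply: cY; rewrite (comm_sq (esym kc)).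
have xY : x ** Y = Y ** x by exact: comm_sq.
pose z := (x + x) - Y.
(* Writing u = 1 - 2 x, this is (|u| - u)(|u| + u) = 0. As p (Y + 2 x) <= 3/2 < 2, it forces p z =
   0. *)
have zz : z + z = z ** (Y + (x + x)).
  have e1 : Y ** Y = Y + Y - c ** c by rewrite eY addrC addKr.
  rewrite cmulDr cmulBl (cmulBl (x + x)) cmulDl (cmulDr (x + x)) (cmulDr Y) -xY e1 cc.
  rewrite cmulDl /z; move: (x ** Y) (x ** x) => P Q.
  rewrite opprB !opprD [RHS](AC ((2*(((2*2)*(2*2))*2))*((2*2)*2))
    ((((3*5)*11)*((7*9)*12))*((1*17)*(2*18)*((4*13)*(6*14)*(8*15)*(10*16)))))/=.
  by rewrite !subrr !addNr !addr0.
have pz : p z = 0.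
  have h1 : p (z + z) = 2 * p z.
    by apply: seminorm_double; exact: cs_scale hp.
  have h2 : p (Y + (x + x)) <= 1 + (4^-1 + 4^-1).
    apply: le_trans (cs_add hp _ _) _; apply: lerD; first exact: le_trans (ple _) nY.
    by apply: le_trans (cs_add hp _ _) _; apply: lerD.
  have h3 : 2 * p z <= p z * (1 + (4^-1 + 4^-1)).
    rewrite -h1 zz; apply: le_trans (pM _ _) _.
    by rewrite ler_wpM2l ?(cs_ge0 hp).
  by have := cs_ge0 hp z; move: (p z) h3 => t; lra.
have /eqP := p0 _ pz; rewrite subr_eq0 => /eqP e.
have : nr (x + x) = 2.
  by rewrite nr_double nx mulr1.
by rewrite e => h; move: nY; rewrite h; lra.
Qed.

End CStarTheory.

(** * Closed *-subalgebras and inductive limits *)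

Record sub_cstar (R : realType) (A : cstarAlgType R) := SubCstar {
  sc_set :> A -> Prop ;
  sc0 : sc_set 0 ;
  sc_lin : forall (k : R[i]) x y, sc_set x -> sc_set y -> sc_set (k *: x + y) ;
  sc_mul : forall x y, sc_set x -> sc_set y -> sc_set (x ** y) ;
  sc_star : forall x, sc_set x -> sc_set (star x) ;
  sc_closed : closed (sc_set : set A)
}.

Record sub_elt (R : realType) (A : cstarAlgType R) (Q : sub_cstar A) :=
  SubElt { sc_val :> A ; sc_valP : Q sc_val }.

Section SubCstarAlgebra.
Context {R : realType} {A : cstarAlgType R} {Q : sub_cstar A}.
Implicit Types x y z : sub_elt Q.

Lemma sc_val_inj : injective (@sc_val R A Q).
Proof.
move=> [x hx] [y hy] /= e; rewrite e in hx *.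
by congr SubElt; exact: Prop_irrelevance.
Qed.

Lemma sc_scale_P (k : R[i]) x : Q (k *: sc_val x).
Proof. by rewrite -[k *: _]addr0; apply: sc_lin; [exact: sc_valP|exact: sc0]. Qed.

Lemma sc_add_P x y : Q (sc_val x + sc_val y).
Proof. by rewrite -[sc_val x]scale1r; apply: sc_lin; exact: sc_valP. Qed.

Definition sc_zero : sub_elt Q := SubElt (sc0 Q).
Definition sc_add x y : sub_elt Q := SubElt (sc_add_P x y).
Definition sc_scale (k : R[i]) x : sub_elt Q := SubElt (sc_scale_P k x).
Definition sc_cmul x y : sub_elt Q := SubElt (sc_mul (sc_valP x) (sc_valP y)).
Definition sc_adj x : sub_elt Q := SubElt (sc_star (sc_valP x)).

HB.instance Definition _ := gen_eqMixin (sub_elt Q).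
HB.instance Definition _ := gen_choiceMixin (sub_elt Q).

Lemma sc_addA : associative sc_add.
Proof. by move=> x y z; apply: sc_val_inj; rewrite /= addrA. Qed.
Lemma sc_addC : commutative sc_add.
Proof. by move=> x y; apply: sc_val_inj; rewrite /= addrC. Qed.
Lemma sc_add0 : left_id sc_zero sc_add.
Proof. by move=> x; apply: sc_val_inj; rewrite /= add0r. Qed.
Lemma sc_addN : left_inverse sc_zero (sc_scale (-1)) sc_add.
Proof. by move=> x; apply: sc_val_inj; rewrite /= scaleN1r addNr. Qed.

HB.instance Definition _ := GRing.isZmodule.Build (sub_elt Q) sc_addA sc_addC sc_add0 sc_addN.

Lemma sc_scaleA (a b : R[i]) x : sc_scale a (sc_scale b x) = sc_scale (a * b) x.
Proof. by apply: sc_val_inj; rewrite /= scalerA. Qed.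
Lemma sc_scale1 : left_id 1 sc_scale.
Proof. by move=> x; apply: sc_val_inj; rewrite /= scale1r. Qed.
Lemma sc_scaleDr : right_distributive sc_scale +%R.
Proof. by move=> k x y; apply: sc_val_inj; rewrite /= scalerDr. Qed.
Lemma sc_scaleDl x : {morph sc_scale^~ x : a b / a + b}.
Proof. by move=> a b; apply: sc_val_inj; rewrite /= scalerDl. Qed.

HB.instance Definition _ := GRing.Zmodule_isLmodule.Build R[i] (sub_elt Q)
  sc_scaleA sc_scale1 sc_scaleDr sc_scaleDl.

Lemma sc_valD x y : sc_val (x + y) = sc_val x + sc_val y. Proof. by []. Qed.
Lemma sc_valZ (k : R[i]) x : sc_val (k *: x) = k *: sc_val x. Proof. by []. Qed.
Lemma sc_val0 : sc_val (0 : sub_elt Q) = 0. Proof. by []. Qed.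
Lemma sc_valN x : sc_val (- x) = - sc_val x.
Proof. by rewrite -scaleN1r sc_valZ scaleN1r. Qed.
Lemma sc_valB x y : sc_val (x - y) = sc_val x - sc_val y.
Proof. by rewrite sc_valD sc_valN. Qed.
Lemma sc_val_sum (I : Type) (r : seq I) (P : pred I) (F : I -> sub_elt Q) :
  sc_val (\sum_(i <- r | P i) F i) = \sum_(i <- r | P i) sc_val (F i).
Proof. by elim/big_rec2: _ => [|i u v _ <-]; rewrite ?sc_val0 ?sc_valD. Qed.

Definition sc_nr x : R := nr (sc_val x).

Lemma sc_nrD x y : sc_nr (x + y) <= sc_nr x + sc_nr y.
Proof. exact: nrD. Qed.
Lemma sc_nrZ (k : R[i]) x : sc_nr (k *: x) = nr k * sc_nr x.
Proof. exact: nrZ. Qed.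
Lemma sc_nr_eq0 x : sc_nr x = 0 -> x = 0.
Proof. by move=> h; apply: sc_val_inj; exact: nr0_eq. Qed.

Lemma sc_complete (u : nat -> sub_elt Q) :
  (forall e : R, 0 < e -> exists N, forall m n, (N <= m)%N -> (N <= n)%N ->
      sc_nr (u m - u n) < e) ->
  exists l, forall e : R, 0 < e -> exists N, forall n, (N <= n)%N -> sc_nr (u n - l) < e.
Proof.
move=> cu; have [l hl] : exists l, scvg (fun n => sc_val (u n)) l.
  apply: complete_scvg => e e0; have [N hN] := cu e e0; exists N => m n Nm Nn.
  by rewrite -sc_valB; exact: hN.
have Ql : Q l.
  apply: (iffLR (closed_nr (Q : A -> Prop)) (@sc_closed _ _ Q)) => e e0.
  have [N hN] := hl e e0; exists (sc_val (u N)); first exact: sc_valP.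
  by rewrite nrC; exact: hN.
exists (SubElt Ql) => e e0; have [N hN] := hl e e0; exists N => n Nn.
by rewrite /sc_nr sc_valB; exact: hN.
Qed.

HB.instance Definition _ := @Lmodule_isRealNormed.Build R (sub_elt Q) sc_nr
  sc_nrD sc_nrZ sc_nr_eq0 sc_complete.

Lemma sc_nrE x : nr x = nr (sc_val x). Proof. by []. Qed.

Lemma sc_cmulA : associative sc_cmul.
Proof. by move=> x y z; apply: sc_val_inj; rewrite /= cmulA. Qed.
Lemma sc_cmulDl : left_distributive sc_cmul +%R.
Proof. by move=> x y z; apply: sc_val_inj; rewrite /= cmulDl. Qed.
Lemma sc_cmulDr : right_distributive sc_cmul +%R.
Proof. by move=> x y z; apply: sc_val_inj; rewrite /= cmulDr. Qed.
Lemma sc_cmulZl (k : R[i]) x y : sc_cmul (k *: x) y = k *: sc_cmul x y.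
Proof. by apply: sc_val_inj; rewrite /= cmulZl. Qed.
Lemma sc_cmulZr (k : R[i]) x y : sc_cmul x (k *: y) = k *: sc_cmul x y.
Proof. by apply: sc_val_inj; rewrite /= cmulZr. Qed.
Lemma sc_adjK : involutive sc_adj.
Proof. by move=> x; apply: sc_val_inj; rewrite /= starK. Qed.
Lemma sc_adjD : {morph sc_adj : x y / x + y}.
Proof. by move=> x y; apply: sc_val_inj; rewrite /= starD. Qed.
Lemma sc_adjZ (k : R[i]) x : sc_adj (k *: x) = Num.conj k *: sc_adj x.
Proof. by apply: sc_val_inj; rewrite /= starZ. Qed.
Lemma sc_adjM x y : sc_adj (sc_cmul x y) = sc_cmul (sc_adj y) (sc_adj x).
Proof. by apply: sc_val_inj; rewrite /= starM. Qed.
Lemma sc_norm_mul x y : `|sc_cmul x y| <= `|x| * `|y|.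
Proof. by rewrite !nrE -rmorphM/= lecR; exact: nr_cmul. Qed.
Lemma sc_norm_star_mul x : `|sc_cmul (sc_adj x) x| = `|x| ^+ 2.
Proof. by rewrite !nrE -rmorphXn/=; congr (_%:C); exact: nr_star_cmul. Qed.

HB.instance Definition _ := @isCStarAlgebra.Build R (sub_elt Q) sc_cmul sc_adj
  sc_cmulA sc_cmulDl sc_cmulDr sc_cmulZl sc_cmulZr sc_adjK sc_adjD sc_adjZ sc_adjM
  sc_norm_mul sc_norm_star_mul.

Lemma sc_valM x y : sc_val (x ** y) = sc_val x ** sc_val y. Proof. by []. Qed.
Lemma sc_valS x : sc_val (star x) = star (sc_val x). Proof. by []. Qed.

Lemma sc_val_star_hom : star_hom (@sc_val R A Q).
Proof. by []. Qed.

End SubCstarAlgebra.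

(* A C*-algebra through which a cocone over a limit factors is everything: the
   limit is generated, as a closed *-subalgebra, by the images. *)
Lemma inductive_limit_dense (R : realType) (S : nat -> cstarAlgType R)
    (phi : forall n, S n -> S n.+1) (B : cstarAlgType R) (mu : forall n, S n -> B)
    (Q : sub_cstar B) :
  inductive_limit phi mu -> (forall n a, Q (mu n a)) -> forall b, Q b.
Proof.
move=> [cmu univ] hQ b.
pose nu n a : sub_elt Q := SubElt (hQ n a).
have cnu : cocone phi nu.
  move=> n; have [[l m s] c] := cmu n; split; last first.
    by move=> a; apply: sc_val_inj; exact: c.
  split.
  - by move=> k x y; apply: sc_val_inj; exact: l.
  - by move=> x y; apply: sc_val_inj; exact: m.
  - by move=> x; apply: sc_val_inj; exact: s.
have [psi [[hpsi epsi] _]] := univ _ _ cnu.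
(* Both the identity and [sc_val \o psi] mediate from the cocone [mu] to itself, so they agree. *)
have [id' [_ uid]] := univ _ _ cmu.
have e1 : id' = @id B by apply: uid; split.
have e2 : id' = (@sc_val R B Q) \o psi.
  apply: uid; split; last by move=> n a; rewrite /= epsi.
  case: hpsi => l m s; split.
  - by move=> k x y; rewrite /= l.
  - by move=> x y; rewrite /= m.
  - by move=> x; rewrite /= s.
have -> : b = sc_val (psi b) by rewrite -[LHS]/(@id B b) -e1 e2.
exact: sc_valP.
Qed.

(** * Coordinate vectors and restrictions in l2 *)

Section L2Basis.
Context {R : realType} {S : eqType}.
Implicit Types (x y : l2 R S) (r : seq S).

Lemma l2_nrE x : nr x = l2norm x. Proof. by []. Qed.

Lemma l2_dotE x y : dot x y = l2dot x y. Proof. by []. Qed.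

Lemma l2_sum_le x r : uniq r -> \sum_(i <- r) nr (x i) ^+ 2 <= nr x ^+ 2.
Proof. by move=> ur; rewrite l2_nrE l2norm_sqr l2_sq_le. Qed.

Lemma l2_nr_le x (C : R) : 0 <= C ->
  (forall r, uniq r -> \sum_(i <- r) nr (x i) ^+ 2 <= C ^+ 2) -> nr x <= C.
Proof. exact: l2norm_le. Qed.

Lemma nr_coef x i : nr (x i) <= nr x.
Proof. exact: nr_le_l2norm. Qed.

Lemma sqs_restr (C : pred S) x : sqs (fun i => if C i then x i else 0).
Proof.
have [D hD] := l2P x; exists D => r ur; apply: le_trans (hD r ur).
by apply: ler_sum => i _; case: ifP => // _; rewrite nr0 expr0n sqr_ge0.
Qed.

Definition restr (C : pred S) x : l2 R S := L2 (sqs_restr C x).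

Lemma restrE C x i : restr C x i = if C i then x i else 0. Proof. by []. Qed.

Lemma nr_restr C x : nr (restr C x) <= nr x.
Proof.
apply: l2_nr_le => [|r ur]; first exact: nr_ge0.
apply: le_trans (l2_sum_le x ur); apply: ler_sum => i _ /=.
by case: ifP => // _; rewrite nr0 expr0n sqr_ge0.
Qed.

Lemma restr_lin C : linear (restr C).
Proof.
move=> k x y; apply: l2_ext => i; rewrite l2DE l2ZE !restrE l2DE l2ZE.
by case: ifP => // _; rewrite mulr0 addr0.
Qed.

Lemma restr_adjointable C : adjointable (restr C).
Proof.
split; first exact: restr_lin.
  by exists 1 => x; rewrite mul1r nr_restr.
exists (restr C) => x y; rewrite !l2_dotE /l2dot; congr tsum; apply/funext => i /=.
by case: ifP => //; rewrite rmorph0 mul0r mulr0.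
Qed.

Definition restr_op C : bop (l2 R S) := Bop (restr_adjointable C).

Lemma sqs_delta (f : S) : sqs (fun i => (i == f)%:R : R[i]).
Proof.
exists 1 => r ur; have [fr|fr] := boolP (f \in r); last first.
  rewrite big_seq big1 ?ler01// => i ir; case: eqP => [e|_]; last by rewrite nr0 expr0n.
  by rewrite -e ir in fr.
rewrite (bigD1_seq f)//= eqxx nr1 expr1n big1 ?addr0// => i /negPf ->.
by rewrite nr0 expr0n.
Qed.

Definition delta (f : S) : l2 R S := L2 (sqs_delta f).

Lemma deltaE f i : delta f i = (i == f)%:R. Proof. by []. Qed.

Lemma dot_delta x f : dot x (delta f) = x f.
Proof.
rewrite l2_dotE; apply: tsum_eq.
have := @summ_fin R S (fun i => x i * Num.conj (delta f i)) [:: f] isT.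
rewrite big_seq1 deltaE eqxx rmorph1 mulr1; apply => i.
by rewrite inE deltaE => /negPf ->; rewrite rmorph0 mulr0.
Qed.

Lemma nr_delta f : nr (delta f) = 1.
Proof.
have := Re_dot (delta f); rewrite dot_delta deltaE eqxx/= => /esym/eqP.
by rewrite sqrp_eq1 ?nr_ge0// => /eqP.
Qed.

Lemma sum_delta r x i : uniq r ->
  (\sum_(f <- r) x f *: delta f) i = if i \in r then x i else 0.
Proof.
move=> ur; rewrite l2_sumE.
under eq_bigr do rewrite l2ZE deltaE.
case: ifPn => ir.
  rewrite (bigD1_seq i)//= eqxx mulr1 big1 ?addr0// => f fi.
  by rewrite eq_sym (negPf fi) mulr0.
rewrite big_seq big1// => f fr; case: eqP => [e|_]; last by rewrite mulr0.
by rewrite e fr in ir.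
Qed.

Lemma l2_tail x (e : R) : 0 < e -> exists2 r, uniq r &
  forall s, uniq s -> (forall i, i \in s -> i \notin r) -> \sum_(i <- s) nr (x i) ^+ 2 <= e.
Proof.
move=> e0; have [r hr] := l2dot_summ x x e0.
exists (undup r); first exact: undup_uniq.
move=> s us sr; set t := undup r ++ s.
have ut : uniq t.
  rewrite cat_uniq undup_uniq us andbT; apply/hasPn => i /sr //.
have sub1 : {subset r <= undup r} by move=> i; rewrite mem_undup.
have sub2 : {subset r <= t} by move=> i ir; rewrite mem_cat mem_undup ir.
have h1 := hr _ (undup_uniq r) sub1.
have h2 := l2_sum_le x ut.
have {h1} : complex.Re (l2dot x x) - \sum_(i <- undup r) nr (x i) ^+ 2 <= e.
  apply: ltW; apply: le_lt_trans h1; rewrite nrC; apply: le_trans (Re_le_nr _).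
  rewrite raddfB/= lerD2l lerN2 (raddf_sum (@complex.Re R : Rcomplex R -> R)).
  by apply: ler_sum => i _; rewrite mul_conj.
rewrite -l2norm_sqr -l2_nrE; move: h2; rewrite big_cat/=; lra.
Qed.

Lemma delta_dense x (e : R) : 0 < e -> exists2 r, uniq r &
  nr (x - \sum_(f <- r) x f *: delta f) < e.
Proof.
move=> e0; have e2 : 0 < (e / 2) ^+ 2 by rewrite exprn_gt0// divr_gt0.
have [r ur hr] := l2_tail x e2; exists r => //.
apply: (@le_lt_trans _ _ (e / 2)); last by rewrite ltr_pdivrMr// mulr_natr mulr2n ltrDl.
apply: l2_nr_le => [|s us]; first by rewrite ltW// divr_gt0.
rewrite (bigID (mem r))/= big1 ?add0r => [|i ir]; last first.
  by rewrite sum_delta// ir subrr nr0 expr0n.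
apply: le_trans (hr [seq i <- s | i \notin r] _ _); rewrite ?filter_uniq//.
  rewrite big_filter; apply: ler_sum => i /negPf ir.
  by rewrite sum_delta// ir subr0.
by move=> i; rewrite mem_filter => /andP[].
Qed.

Lemma bop_delta_ext (T U : bop (l2 R S)) :
  (forall f, T (delta f) = U (delta f)) -> T = U.
Proof.
move=> h; apply: bop_ext => x; apply/eqP; rewrite -subr_eq0 -nr_eq0 eq_le nr_ge0 andbT.
apply/ler_addgt0Pl => e e0; rewrite addr0 -bopBE.
have c0 : 0 < 1 + opn (T - U) by rewrite ltr_wpDr ?opn_ge0.
have [r ur hr] := delta_dense x (divr_gt0 e0 c0).
have e1 : (T - U) (\sum_(f <- r) x f *: delta f) = 0.
  by rewrite bop_sum big1// => f _; rewrite bopZ bopBE h subrr scaler0.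
rewrite -[x in (T - U) x](subrK (\sum_(f <- r) x f *: delta f)) bopD e1 addr0.
apply: le_trans (bop_le _ _) _; move: hr; rewrite ltr_pdivlMr// => hr.
apply: le_trans (ltW hr); rewrite mulrC ler_wpM2l ?nr_ge0// lerDr//.
Qed.

End L2Basis.

(** * Twisted group algebras of groups of exponent two *)

(** [tw] is the exponent of a cocycle with values 1 and -1; being biadditive, it satisfies the
    cocycle identity. *)
Record twist := Twist {
  tw_sort :> zmodType ;
  tw : tw_sort -> tw_sort -> bool ;
  twDl : forall f g h, tw (f + g) h = tw f h (+) tw g h ;
  twDr : forall f g h, tw h (f + g) = tw h f (+) tw h g ;
  tw_char2 : forall g : tw_sort, g + g = 0 ;
  tw_nondeg : forall g : tw_sort, g != 0 -> exists h, tw h g (+) tw g h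
}.

Section TwistedGroupAlgebra.
Context {R : realType} {V : twist}.
Implicit Types (f g h : V) (x y : l2 R V) (c : V -> bool).

(** The commutator exponent: [lam g] and [lam h] commute up to the sign [sg (om g h)]. *)
Definition om g h := tw g h (+) tw h g.
Definition sg (b : bool) : R[i] := (-1) ^+ b.

Lemma omDl f g h : om (f + g) h = om f h (+) om g h.
Proof. by rewrite /om twDl twDr addbACA. Qed.
Lemma tw0l g : tw 0 g = false.
Proof. by have := twDl 0 0 g; rewrite addr0 addbb. Qed.
Lemma tw0r g : tw g 0 = false.
Proof. by have := twDr 0 0 g; rewrite addr0 addbb. Qed.

Lemma addKK g f : f + g + g = f.
Proof. by rewrite -addrA tw_char2 addr0. Qed.

Lemma add_eq f g h : (f + g == h) = (f == h + g).
Proof. by apply/eqP/eqP => [<-|->]; rewrite addKK. Qed.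

Lemma sgM b b' : sg b * sg b' = sg (b (+) b').
Proof. by rewrite /sg signr_addb. Qed.
Lemma sg_conj b : Num.conj (sg b) = sg b.
Proof. by case: b; rewrite /sg ?expr1 ?rmorphN1 ?rmorph1. Qed.
Lemma nr_sg b : nr (sg b) = 1.
Proof. by case: b; rewrite /sg ?expr1 ?nrN nr1. Qed.
Lemma sg0 : sg false = 1. Proof. by []. Qed.
Lemma sg1 : sg true = -1. Proof. by []. Qed.
Lemma sgK b : sg b * sg b = 1. Proof. by rewrite sgM addbb. Qed.

Lemma sum_shift_uniq g (r : seq V) : uniq [seq i + g | i <- r] = uniq r.
Proof. by apply: map_inj_uniq; exact: addIr. Qed.

Lemma sqs_mono g c x : sqs (fun i => sg (c i) * x (i + g)).
Proof.
have [D hD] := l2P x; exists D => r ur.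
apply: le_trans (hD [seq i + g | i <- r] _); last by rewrite sum_shift_uniq.
by rewrite big_map; apply: ler_sum => i _; rewrite nrM nr_sg mul1r.
Qed.

(** Signed translations cover the left and right regular representations, their adjoints, and, for g
    = 0, multiplication by a character, so that norms and adjoints are computed once. *)
Definition mono_fun g c x : l2 R V := L2 (sqs_mono g c x).

Lemma summ_shift (F : V -> R[i]) g L : summ F L -> summ (fun i => F (i + g)) L.
Proof.
move=> h e e0; have [r hr] := h e e0; exists [seq i + g | i <- r] => s us sub.
have -> : \sum_(i <- s) F (i + g) = \sum_(i <- [seq i + g | i <- s]) F i by rewrite big_map.
apply: hr; first by rewrite sum_shift_uniq.
move=> i ir; apply/mapP; exists (i + g); last by rewrite addKK.
by apply: sub; exact: map_f.
Qed.

Lemma mono_adj g c x y :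
  dot (mono_fun g c x) y = dot x (mono_fun g (fun i => c (i + g)) y).
Proof.
rewrite !l2_dotE; apply/esym/tsum_eq.
have := summ_shift g (l2dot_summ (mono_fun g c x) y); congr summ; apply/funext => i /=.
by rewrite addKK rmorphM/= sg_conj mulrCA mulrA.
Qed.

Lemma nr_mono g c x : nr (mono_fun g c x) = nr x.
Proof.
have := Re_dot (mono_fun g c x); rewrite mono_adj.
have -> : mono_fun g (fun i => c (i + g)) (mono_fun g c x) = x.
  by apply: l2_ext => i /=; rewrite addKK mulrA sgK mul1r.
by rewrite Re_dot => /eqP; rewrite eqrXn2 ?nr_ge0// => /eqP.
Qed.

Lemma mono_adjointable g c : adjointable (mono_fun g c).
Proof.
split.
- move=> k x y; apply: l2_ext => i /=.
  by rewrite mulrDr mulrCA.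
- by exists 1 => x; rewrite nr_mono mul1r.
- by exists (mono_fun g (fun i => c (i + g))) => x y; exact: mono_adj.
Qed.

Definition mono g c : bop (l2 R V) := Bop (mono_adjointable g c).

Lemma monoE g c x i : mono g c x i = sg (c i) * x (i + g). Proof. by []. Qed.

Lemma star_mono g c : star (mono g c) = mono g (fun i => c (i + g)).
Proof. by apply: adj_unique => x y; exact: mono_adj. Qed.

Lemma mono_delta g c f : mono g c (delta f) = sg (c (f + g)) *: delta (f + g).
Proof.
apply: l2_ext => i; rewrite monoE l2ZE !deltaE add_eq.
by case: eqP => [->//|_]; rewrite !mulr0.
Qed.

Lemma mono_eq g c c' : c =1 c' -> mono g c = mono g c'.
Proof. by move=> /funext ->. Qed.

Lemma mono_mul g c h d :
  mono g c ** mono h d = mono (g + h) (fun i => c i (+) d (i + g)).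
Proof.
apply: bop_ext => x; apply: l2_ext => i.
by rewrite bopME !monoE mulrA sgM addrA.
Qed.

Lemma mono_sg g c b : sg b *: mono g c = mono g (fun i => b (+) c i).
Proof. by apply: bop_ext => x; apply: l2_ext => i; rewrite bopZE l2ZE !monoE mulrA sgM. Qed.

Definition lam g := mono g (fun f => tw g (f + g)).
Definition rho g := mono g (fun f => tw (f + g) g).

Lemma lam_delta g f : lam g (delta f) = sg (tw g f) *: delta (f + g).
Proof. by rewrite mono_delta addKK. Qed.

Lemma rho_delta g f : rho g (delta f) = sg (tw f g) *: delta (f + g).
Proof. by rewrite mono_delta addKK. Qed.

Lemma rho_delta0 g : rho g (delta 0) = delta g.
Proof. by rewrite rho_delta tw0l add0r scale1r. Qed.

Lemma lam_delta0 g : lam g (delta 0) = delta g.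
Proof. by rewrite lam_delta tw0r add0r scale1r. Qed.

Lemma lamM g h : lam g ** lam h = sg (tw g h) *: lam (g + h).
Proof.
rewrite mono_mul mono_sg; apply: mono_eq => i.
rewrite (addrA i) !twDl !twDr.
by do ![case: (tw _ _)].
Qed.

Lemma lam_rho g h : lam g ** rho h = rho h ** lam g.
Proof.
rewrite !mono_mul addrC; apply: mono_eq => i.
rewrite !twDl !twDr.
by do ![case: (tw _ _)].
Qed.

Lemma lam0 : lam 0 = (@bop_one R (l2 R V)).
Proof. by apply: bop_ext => x; apply: l2_ext => i; rewrite monoE tw0l mul1r addr0. Qed.

Lemma star_lam g : star (lam g) = sg (tw g g) *: lam g.
Proof.
rewrite star_mono mono_sg; apply: mono_eq => i; rewrite !twDr.
by do ![case: (tw _ _)].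
Qed.

Definition lamsum (a : seq (R[i] * V)) : bop (l2 R V) := \sum_(p <- a) p.1 *: lam p.2.

Definition tga_set (T : bop (l2 R V)) : Prop :=
  forall e : R, 0 < e -> exists a, nr (T - lamsum a) < e.

Lemma lamsum_tga a : tga_set (lamsum a).
Proof. by move=> e e0; exists a; rewrite subrr nr0. Qed.

Lemma lamsum1 g : lamsum [:: (1, g)] = lam g.
Proof. by rewrite /lamsum big_seq1 scale1r. Qed.

Lemma lamsum_cat a b : lamsum (a ++ b) = lamsum a + lamsum b.
Proof. by rewrite /lamsum big_cat. Qed.

Lemma lamsum_scale (k : R[i]) a : k *: lamsum a = lamsum [seq (k * p.1, p.2) | p <- a].
Proof. by rewrite /lamsum scaler_sumr big_map; apply: eq_bigr => p _; rewrite scalerA. Qed.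

Lemma lamsum_mul a b : lamsum a ** lamsum b =
  lamsum [seq (p.1 * q.1 * sg (tw p.2 q.2), p.2 + q.2) | p <- a, q <- b].
Proof.
rewrite /lamsum big_allpairs_dep cmul_suml; apply: eq_bigr => p _.
rewrite cmul_sumr; apply: eq_bigr => q _.
by rewrite cmulZl cmulZr lamM !scalerA.
Qed.

Lemma lamsum_star a : star (lamsum a) = lamsum [seq (Num.conj p.1 * sg (tw p.2 p.2), p.2) | p <- a].
Proof.
rewrite /lamsum star_sum big_map; apply: eq_bigr => p _.
by rewrite starZ star_lam scalerA.
Qed.

Lemma tga_lin (k : R[i]) S T : tga_set S -> tga_set T -> tga_set (k *: S + T).
Proof.
move=> hS hT e e0; have e'0 : 0 < e / 2 / (1 + nr k) by rewrite !divr_gt0// ltr_wpDr ?nr_ge0.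
have [a ha] := hS _ e'0; have [b hb] := hT _ (divr_gt0 e0 (ltr0Sn _ 1)).
exists ([seq (k * p.1, p.2) | p <- a] ++ b).
rewrite lamsum_cat -lamsum_scale opprD addrACA -scalerBr.
apply: le_lt_trans (nrD _ _) _; rewrite [e]splitr ltr_leD//; last exact: ltW.
rewrite nrZ; move: ha; rewrite ltr_pdivlMr ?ltr_wpDr ?nr_ge0// mulrC; apply: le_lt_trans.
by rewrite ler_wpM2r ?nr_ge0// lerDr.
Qed.

Lemma tga_mul S T : tga_set S -> tga_set T -> tga_set (S ** T).
Proof.
move=> hS hT e e0.
have c0 : 0 < nr T + 1 by rewrite ltr_wpDl ?nr_ge0.
have [a ha] := hS _ (divr_gt0 (divr_gt0 e0 (ltr0Sn _ 1)) c0).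
have d0 : 0 < nr (lamsum a) + 1 by rewrite ltr_wpDl ?nr_ge0.
have [b hb] := hT _ (divr_gt0 (divr_gt0 e0 (ltr0Sn _ 1)) d0).
have [d hd] : exists d, lamsum a ** lamsum b = lamsum d by eexists; exact: lamsum_mul.
exists d; rewrite -hd.
have -> : S ** T - lamsum a ** lamsum b = (S - lamsum a) ** T + lamsum a ** (T - lamsum b).
  by rewrite cmulBl cmulBr addrA subrK.
have {}ha : nr (S - lamsum a) * (nr T + 1) < e / 2 by rewrite -ltr_pdivlMr.
have {}hb : nr (T - lamsum b) * (nr (lamsum a) + 1) < e / 2 by rewrite -ltr_pdivlMr.
apply: le_lt_trans (nrD _ _) _; rewrite [e]splitr ltrD//.
  apply: le_lt_trans (nr_cmul _ _) _; apply: le_lt_trans ha.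
  by rewrite ler_wpM2l ?nr_ge0// lerDl.
apply: le_lt_trans (nr_cmul _ _) _; apply: le_lt_trans hb.
by rewrite mulrC ler_wpM2l ?nr_ge0// lerDl.
Qed.

Lemma tga_star T : tga_set T -> tga_set (star T).
Proof.
move=> hT e e0; have [a ha] := hT e e0.
have [d hd] : exists d, star (lamsum a) = lamsum d by eexists; exact: lamsum_star.
exists d; rewrite -hd; by rewrite -starB nr_star.
Qed.

Lemma tga_closed : closed (tga_set : set (bop (l2 R V))).
Proof.
apply/closed_nr => T h e e0.
have [S hS TS] := h _ (divr_gt0 e0 (ltr0Sn _ 1)).
have [a ha] := hS _ (divr_gt0 e0 (ltr0Sn _ 1)).
exists a; apply: le_lt_trans (nr_tri S _ _) _.
by rewrite [e]splitr ltrD.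
Qed.

Lemma tga0 : tga_set 0.
Proof. by move=> e e0; exists [::]; rewrite /lamsum big_nil subrr nr0. Qed.

Definition tga_sub := SubCstar tga0 tga_lin tga_mul tga_star tga_closed.

End TwistedGroupAlgebra.

Arguments tga_sub : clear implicits.

Definition tga (R : realType) (V : twist) : cstarAlgType R := sub_elt (tga_sub R V).

Section TgaTheory.
Context {R : realType} {V : twist}.
Implicit Types (f g h : V) (T U : bop (l2 R V)) (a : seq (R[i] * V)).

Lemma lam_tga g : tga_set (lam g : bop (l2 R V)).
Proof. by rewrite -lamsum1; exact: lamsum_tga. Qed.

Definition lamA g : tga R V := SubElt (lam_tga g : tga_sub R V (lam g)).

Definition lamsumA a : tga R V := \sum_(p <- a) p.1 *: lamA p.2.

Lemma val_lamsumA a : sc_val (lamsumA a) = lamsum a.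
Proof. by rewrite sc_val_sum. Qed.

Lemma tgaP (T : tga R V) : tga_set (sc_val T).
Proof. exact: (sc_valP T). Qed.

Lemma tga_dense (T : tga R V) (e : R) : 0 < e -> exists a, nr (T - lamsumA a) < e.
Proof.
move=> e0; have [a ha] := tgaP T e0; exists a.
by rewrite sc_nrE sc_valB val_lamsumA.
Qed.

Lemma lamA0_unit : is_unit (lamA 0).
Proof. by move=> x; split; apply: sc_val_inj; rewrite sc_valM /= lam0; apply: bop_ext. Qed.

Lemma lamAM g h : lamA g ** lamA h = sg (tw g h) *: lamA (g + h).
Proof. by apply: sc_val_inj; rewrite sc_valM sc_valZ lamM. Qed.

Lemma star_lamA g : star (lamA g) = sg (tw g g) *: lamA g.
Proof. by apply: sc_val_inj; rewrite sc_valS sc_valZ star_lam. Qed.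

Lemma lamA_star_mul g : star (lamA g) ** lamA g = lamA 0.
Proof. by rewrite star_lamA cmulZl lamAM scalerA sgK scale1r tw_char2. Qed.

Lemma lamA_conj h g : lamA h ** lamA g ** star (lamA h) = sg (om h g) *: lamA g.
Proof.
rewrite star_lamA lamAM cmulZl cmulZr lamAM !scalerA !sgM.
rewrite [h + g]addrC addKK; congr (sg _ *: _).
by rewrite /om twDl; do ![case: (tw _ _)].
Qed.

Lemma nr_lamA g : nr (lamA g) <= 1.
Proof.
rewrite sc_nrE; apply: opn_le; first exact: ler01.
by move=> x; rewrite mul1r -(nr_mono g (fun f => tw g (f + g)) x).
Qed.

Lemma tga_comm U T : (forall g, U ** lam g = lam g ** U) -> tga_set T -> U ** T = T ** U.
Proof.
move=> h hT; apply/eqP; rewrite -subr_eq0 -nr_eq0 eq_le nr_ge0 andbT.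
apply/ler_addgt0Pl => e e0; rewrite addr0.
have c0 : 0 < 1 + (nr U + nr U) by rewrite ltr_wpDr ?addr_ge0 ?nr_ge0.
have [a ha] := hT _ (divr_gt0 e0 c0).
have Ua : U ** lamsum a = lamsum a ** U.
  rewrite /lamsum cmul_suml cmul_sumr; apply: eq_bigr => p _.
  by rewrite cmulZl cmulZr h.
have -> : U ** T - T ** U = U ** (T - lamsum a) - (T - lamsum a) ** U.
  by rewrite cmulBl cmulBr Ua opprB addrA subrK.
move: ha; rewrite ltr_pdivlMr// => /ltW ha; apply: le_trans ha.
apply: le_trans (nrB _ _) _; rewrite mulrDr mulr1 mulrDr.
apply: le_trans (lerD (nr_cmul _ _) (nr_cmul _ _)) _.
by rewrite [nr U * _]mulrC lerDr nr_ge0.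
Qed.

Lemma tga_rho T g : tga_set T -> T ** rho g = rho g ** T.
Proof. by move=> hT; apply/esym/tga_comm => // h; rewrite lam_rho. Qed.

(** delta_0 is separating: the right translations commute with T and carry T delta_0 to all the
    vectors T delta_g. *)
Lemma tga_delta T g : tga_set T -> T (delta g) = rho g (T (delta 0)).
Proof. by move=> hT; rewrite -bopME -tga_rho// bopME rho_delta0. Qed.

Lemma tga_sep T : tga_set T -> T (delta 0) = 0 -> T = 0.
Proof.
by move=> hT h; apply: bop_delta_ext => f; rewrite tga_delta// h bop0 bop0E.
Qed.

Lemma lamsum_delta0 a : (lamsum a) (delta 0) 0 = \sum_(p <- a | p.2 == 0) p.1.
Proof.
rewrite bop_sumE l2_sumE [RHS]big_mkcond; apply: eq_bigr => p _.
rewrite bopZE l2ZE lam_delta0 deltaE eq_sym.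
by case: eqP; rewrite (mulr1, mulr0).
Qed.

(** The mean of T and its conjugate by the unitary [lam h]: a contraction that removes the
    coefficients at those g with [om h g] and fixes the others. *)
Definition avg h (T : tga R V) : tga R V :=
  (2^-1 : R)%:C *: (T + lamA h ** T ** star (lamA h)).

Definition avgs (hs : seq V) (T : tga R V) := foldr avg T hs.

Lemma avgB h (S T : tga R V) : avg h (S - T) = avg h S - avg h T.
Proof.
by rewrite /avg cmulBr cmulBl addrACA -opprD -scalerBr.
Qed.

Lemma avgsB hs (S T : tga R V) : avgs hs (S - T) = avgs hs S - avgs hs T.
Proof. by elim: hs => //= h hs ->; rewrite avgB. Qed.

Lemma nr_avg h (T : tga R V) : nr (avg h T) <= nr T.
Proof.
rewrite /avg nrZ nrR ger0_norm// ler_pdivrMl// mulr_natl mulr2n.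
apply: le_trans (nrD _ _) _; rewrite lerD2l.
apply: le_trans (nr_cmul _ _) _; rewrite nr_star.
apply: (le_trans (ler_wpM2l (nr_ge0 _) (nr_lamA h))); rewrite mulr1.
apply: le_trans (nr_cmul _ _) _; rewrite -[leRHS]mul1r.
by rewrite ler_wpM2r ?nr_ge0 ?nr_lamA.
Qed.

Lemma nr_avgs hs (T : tga R V) : nr (avgs hs T) <= nr T.
Proof. by elim: hs => //= h hs IH; apply: le_trans (nr_avg _ _) IH. Qed.

Lemma avg_lamsumA h a :
  avg h (lamsumA a) = lamsumA [seq (if om h p.2 then 0 else p.1, p.2) | p <- a].
Proof.
rewrite /avg /lamsumA big_map cmul_sumr cmul_suml -big_split/= scaler_sumr.
apply: eq_bigr => p _; rewrite cmulZr cmulZl lamA_conj.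
case: (om _ _); first by rewrite sg1 scaleN1r scalerN subrr scaler0 scale0r.
by rewrite sg0 scale1r halfC.
Qed.

Lemma avgs_lamsumA hs a : avgs hs (lamsumA a) =
  lamsumA [seq (if has (fun h => om h p.2) hs then 0 else p.1, p.2) | p <- a].
Proof.
elim: hs => [|h hs IH] /=; first by rewrite map_id_in// => -[].
rewrite IH avg_lamsumA -map_comp; congr lamsumA; apply: eq_map => p /=.
by case: (om _ _).
Qed.

Lemma separating_list (G : seq V) :
  exists hs : seq V, forall g, g \in G -> g != 0 -> has (fun h => om h g) hs.
Proof.
have /choice [F hF] : forall g : V, exists h, g != 0 -> om h g.
  move=> g; have [->|g0] := eqVneq g 0; first by exists 0.
  by have [h hh] := tw_nondeg g0; exists h.
exists [seq F g | g <- G] => g gG g0; apply/hasP; exists (F g); last exact: hF.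
exact: map_f.
Qed.

Lemma om0r h : om h 0 = false. Proof. by rewrite /om tw0l tw0r. Qed.

Lemma avgs_trace a : exists hs, avgs hs (lamsumA a) = (lamsum a (delta 0) 0) *: lamA 0.
Proof.
have [hs hhs] := separating_list [seq p.2 | p <- a]; exists hs.
rewrite avgs_lamsumA /lamsumA big_map lamsum_delta0 scaler_suml [RHS]big_mkcond/=.
rewrite !big_seq; apply: eq_bigr => p pa.
case: eqVneq => [->|p0].
  by have /negPf -> : ~~ has (fun h => om h 0) hs; [apply/hasPn => h _; rewrite om0r|].
by rewrite hhs ?map_f// scale0r.
Qed.

Lemma closed_ideal_avgs (I : set (tga R V)) hs (T : tga R V) : closed_ideal I -> I T -> I (avgs hs T).
Proof.
move=> [_ I0 Ilin Imul] IT; elim: hs => [//|h hs IH]; rewrite [avgs _ _]/=.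
have IZ (k : R[i]) S : I S -> I (k *: S) by move=> IS; rewrite -[_ *: _]addr0; exact: Ilin.
have ID S (U : tga R V) : I S -> I U -> I (S + U) by move=> IS IU; rewrite -[S]scale1r; exact: Ilin.
apply/IZ/ID => //.
have [_ h1] := Imul _ (lamA h) IH.
by have [h2 _] := Imul _ (star (lamA h)) h1.
Qed.

Lemma delta_neq0 g : (delta g : l2 R V) <> 0.
Proof. by move=> e; have := nr_delta (R := R) g; rewrite e nr0 => /eqP; rewrite eq_sym oner_eq0. Qed.

Lemma lamA0_neq0 : lamA 0 <> 0.
Proof.
move=> /(congr1 (fun T : tga R V => sc_val T (delta 0))); rewrite /= -/(lam 0).
by rewrite -[LHS]/(lam 0 (delta 0)) lam_delta0; exact: delta_neq0.
Qed.

Lemma tga_simple : simple_cstar (tga R V).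
Proof.
split; first by exists (lamA 0); exact: lamA0_neq0.
move=> I cI; have [clI I0 Ilin Imul] := cI.
have [hI|hI] := pselect (forall x, I x -> x = 0).
  left; apply/seteqP; split => [x /hI -> //|x -> //].
right; move/existsNP: hI => [x /not_implyP [Ix x0]].
(* The trace t of x^* x is |x delta_0|^2, which is nonzero. Averages of y remain in I and approach
   the scalar t, so I contains the unit. *)
set y := star x ** x; have Iy : I y by case: (Imul x (star x) Ix).
set t := sc_val y (delta 0) 0.
have t0 : t != 0.
  rewrite /t -dot_delta -[sc_val y]/(star (sc_val x) ** sc_val x) bopME.
  rewrite -[star _]/(adj _) adjE' dot_nr; apply/eqP => /(@complexI R)/eqP.
  rewrite expf_eq0/= nr_eq0 => /eqP h; apply: x0; apply: sc_val_inj.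
  by apply: tga_sep h; exact: tgaP.
have It : I (t *: lamA 0).
  apply: (iffLR (closed_nr I)) => // e e0.
  have [a ha] := tga_dense y (divr_gt0 e0 (ltr0Sn _ 1)).
  have [hs hhs] := avgs_trace a.
  exists (avgs hs y); first exact: closed_ideal_avgs.
  apply: le_lt_trans (nr_tri (avgs hs (lamsumA a)) _ _) _; rewrite [e]splitr.
  apply: le_lt_trans (_ : nr (y - lamsumA a) + nr (y - lamsumA a) < _); last by rewrite ltrD.
  rewrite lerD//; last by rewrite nrC -avgsB nr_avgs.
  rewrite hhs -scalerBl nrZ; apply: le_trans (ler_wpM2l (nr_ge0 _) (nr_lamA 0)) _.
  rewrite mulr1 /t -l2BE -val_lamsumA -bopBE -sc_valB.
  apply: le_trans (nr_coef _ _) _; apply: le_trans (bop_le _ _) _.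
  by rewrite nr_delta mulr1.
apply/seteqP; split => // z _.
have I1 : I (lamA 0).
  have := Ilin t^-1 _ _ It I0; rewrite addr0 scalerA mulVf// scale1r//.
by have [h _] := Imul _ z I1; rewrite (proj1 (lamA0_unit z)) in h.
Qed.

(* If e is an abelian projection and u, v are anticommuting unitaries almost
   commuting with e in the trace norm, then e u e v e is close to u v e while
   e v e u e is close to v u e = - u v e. *)
Lemma tga_not_type_I :
  (forall F : seq V, exists g h, [/\ om g h, all (fun f => ~~ om g f) F & all (fun f => ~~ om h f) F]) ->
  ~ type_I (tga R V).
Proof.
move=> hV hI.
pose pi (T : tga R V) : l2 R V -> l2 R V := sc_val T.
have bP (T : bop (l2 R V)) : bounded_op T.
  split; first exact: bop_linear.
  by apply: (bounded_continuous (C := opn T)); [exact: bop_linear|exact: bop_le].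
have rpi : representation pi.
  split => //; last by move=> a x y; rewrite /pi sc_valS -[star _]/(adj _) adjE.
  by move=> a; exact: bP.
have := hI _ pi rpi; set M := commutant _ => tI.
have M1 : M (@id (l2 R V)) by split; [exact: (bP (@bop_one R (l2 R V)))|].
have [|||e [Me pe e0 _ eab]] := tI (@id (l2 R V)) M1.
- by split => //; exact: (bP (@bop_one R (l2 R V))).
- by [].
- by move=> /(congr1 (fun u : l2 R V -> l2 R V => u (delta 0))) /=; exact: delta_neq0.
have lamM' g : M (lam g).
  by split; [exact: bP|move=> T [_ hT]; have := hT (lam g); rewrite /= => ->//; exists (lamA g)].
(* e belongs to the bicommutant and the right translations to the commutant. *)
have e_rho g x : e (rho g x) = rho g (e x).
  have : commutant (range pi) (rho g).
    split; first exact: bP.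
    move=> _ [T _ <-]; apply/funext => z.
    exact: (congr1 (fun U : bop (l2 R V) => U z) (esym (tga_rho g (tgaP T)))).
  by move=> /(proj2 Me) /(congr1 (fun u : l2 R V -> l2 R V => u x)).
have [[le ce] ee ed] := pe.
have eD x y : e (x + y) = e x + e y by have := le 1 x y; rewrite !scale1r.
have e00 : e 0 = 0 by apply/(@addrI _ (e 0)); rewrite -eD !addr0.
have eZ (k : R[i]) x : e (k *: x) = k *: e x by have := le k x 0; rewrite e00 !addr0.
have eB x y : e (x - y) = e x - e y by rewrite eD -(scaleN1r y) eZ scaleN1r.
have eeE x : e (e x) = e x by rewrite -[LHS]/((e \o e) x) ee.
have en x : nr (e x) <= nr x.
  have [->|ex] := eqVneq (e x) 0; first by rewrite nr0 nr_ge0.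
  have ex0 : 0 < nr (e x) by rewrite nr_gt0.
  rewrite -(ler_pM2l ex0) -expr2 -Re_dot ed eeE.
  by apply: le_trans (Re_le_nr _) _; rewrite dotC nr_conj cauchy_schwarz.
have nlam g x : nr (lam g x) = nr x by exact: nr_mono.
set xi := e (delta 0).
have key (d : R) : 0 < d -> nr xi <= 8 * d.
  move=> d0; have [F uF hF] := delta_dense xi d0.
  set xi' := \sum_(f <- F) _ in hF.
  have [g [h [gh /allP gF /allP hF']]] := hV F.
  pose good w := forall f, f \in F -> ~~ om w f.
  (* A good w has trivial commutator with the support of xi', so left and right translation by w
     agree on xi', and e commutes with the right one. *)
  have goodgh w : good w -> nr (e (lam w (delta 0)) - lam w xi) <= 2 * d.
    move=> gw; rewrite lam_delta0 -rho_delta0 e_rho -/xi.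
    have e1 : rho w xi' = lam w xi'.
      rewrite /xi' !bop_sum big_seq [RHS]big_seq; apply: eq_bigr => f fF.
      rewrite !bopZ rho_delta lam_delta; congr (_ *: (sg _ *: _)).
      by move: (gw f fF); rewrite /om; do 2 case: (tw _ _).
    have -> : rho w xi - lam w xi = rho w (xi - xi') - lam w (xi - xi').
      by rewrite !bopB e1 opprB addrA subrK.
    apply: le_trans (nrB _ _) _; rewrite nlam [nr (rho _ _)]nr_mono; lra.
  have gg : good g by move=> f /gF.
  have gh' : good h by move=> f /hF'.
  have ggh : good (g + h).
    by move=> f fF; rewrite omDl; move: (gg f fF) (gh' f fF); do 2 case: (om _ f).
  (* e w e is close to w e on delta 0 *)
  have step w : good w -> nr (e (lam w xi) - lam w xi) <= 4 * d.
    move=> gw; have h1 := goodgh w gw.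
    apply: le_trans (nr_tri (e (lam w (delta 0))) _ _) _.
    apply: le_trans (lerD _ h1) (_ : 2 * d + 2 * d <= _); last by lra.
    by rewrite -(eeE (lam w (delta 0))) -eB; apply: le_trans (en _) _; rewrite nrC.
  have two w w' : good w -> good w' -> good (w + w') ->
      nr (e (lam w (e (lam w' xi))) - lam w (lam w' xi)) <= 8 * d.
    move=> gw gw' gww'.
    apply: le_trans (nr_tri (e (lam w (lam w' xi))) _ _) _.
    apply: le_trans (lerD (_ : _ <= 4 * d) (_ : _ <= 4 * d)) (_ : 4 * d + 4 * d <= _); last by lra.
      by rewrite -eB (le_trans (en _))// -bopB nlam step.
    by rewrite -!bopME lamM bopZE eZ -scalerBr nrZ nr_sg mul1r step.
  have t1 := two g h gg gh' ggh.
  have t2 : nr (e (lam h (e (lam g xi))) - lam h (lam g xi)) <= 8 * d.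
    by apply: two => //; rewrite addrC.
  have ab : e (lam g (e (lam h xi))) = e (lam h (e (lam g xi))).
    have := eab _ _ (lamM' g) (lamM' h) => /(congr1 (fun u : l2 R V -> l2 R V => u (delta 0))) /=.
    by rewrite !eeE.
  have anti : lam h (lam g xi) = - lam g (lam h xi).
    rewrite -!bopME !lamM !bopZE [h + g]addrC.
    by rewrite -scaleNr -mulN1r -sg1 sgM; congr (sg _ *: _); move: gh; rewrite /om; do 2 case: (tw _ _).
  have : nr (lam g (lam h xi) + lam g (lam h xi)) <= 16 * d.
    have -> : lam g (lam h xi) + lam g (lam h xi) =
       lam g (lam h xi) - lam h (lam g xi) by rewrite anti opprK.
    apply: le_trans (nr_tri (e (lam g (e (lam h xi)))) _ _) _.
    rewrite {2}ab [X in X + _]nrC; lra.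
  rewrite nr_double !nlam; lra.
have xi0 : xi = 0.
  apply: nr0_eq; apply/eqP; rewrite eq_le nr_ge0 andbT; apply/ler_addgt0Pl => d d0.
  by rewrite addr0; have := key (d / 8) (divr_gt0 d0 (ltr0Sn _ _)); rewrite mulrCA divff// mulr1.
have [C C0 hC] := linear_bounded le ce.
apply: e0; apply/funext => x /=; apply: nr0_eq; apply/eqP; rewrite eq_le nr_ge0 andbT.
apply/ler_addgt0Pl => d d0; rewrite addr0.
have c0 : 0 < 1 + C by rewrite ltr_wpDr.
have [r ur hr] := delta_dense x (divr_gt0 d0 c0).
have es : e (\sum_(f <- r) x f *: delta f) = 0.
  elim: r {ur hr} => [|f r IH]; rewrite (big_nil, big_cons)// eD IH addr0 eZ.
  by rewrite -rho_delta0 e_rho -/xi xi0 bop0 scaler0.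
rewrite -[x](subrK (\sum_(f <- r) x f *: delta f)) eD es addr0.
apply: le_trans (hC _) _; move: hr; rewrite ltr_pdivlMr// => /ltW hr; apply: le_trans hr.
by rewrite mulrC ler_wpM2l ?nr_ge0// lerDr.
Qed.

End TgaTheory.

Lemma lin_span_sum (K : numFieldType) (W : lmodType K) (S : set W) (I : Type)
    (r : seq I) (c : I -> K) (v : I -> W) :
  (forall i, S (v i)) -> lin_span S (\sum_(i <- r) c i *: v i).
Proof.
move=> hS; exists (size r), (fun j => c (tnth (in_tuple r) j)), (fun j => v (tnth (in_tuple r) j)).
by split => //; rewrite big_tnth.
Qed.

(** An adjoint relation may be tested on coordinate vectors, where amplifications and elementary
    tensors have explicit values. *)
Lemma dot_delta_ext (R : realType) (S : eqType) (H : hilbertType R) (g : l2 R S -> H)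
    (C : R) (w : l2 R S) (u : H) :
  linear g -> (forall x, nr (g x) <= C * nr x) ->
  (forall i, dot w (delta i) = dot u (g (delta i))) ->
  forall y, dot w y = dot u (g y).
Proof.
move=> lg gC h y; apply/eqP; rewrite -subr_eq0 -nr_eq0 eq_le nr_ge0 andbT.
apply/ler_addgt0Pl => e e0; rewrite addr0.
have gD a b : g (a + b) = g a + g b by have := lg 1 a b; rewrite !scale1r.
have g0 : g 0 = 0 by apply/(@addrI _ (g 0)); rewrite -gD !addr0.
have gZ (k : R[i]) a : g (k *: a) = k *: g a by have := lg k a 0; rewrite g0 !addr0.
have gB a b : g (a - b) = g a - g b by rewrite gD -(scaleN1r b) gZ scaleN1r.
pose M := 1 + (nr w + `|C| * nr u).
have M0 : 0 < M by rewrite /M ltr_wpDr// addr_ge0 ?mulr_ge0 ?nr_ge0.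
have [r ur hr] := delta_dense y (divr_gt0 e0 M0); set y' := \sum_(i <- r) _ in hr.
have e1 : dot w y' = dot u (g y').
  rewrite /y'; elim: r {ur hr y'} => [|i r IH].
    by rewrite !big_nil g0 !dot0r.
  by rewrite !big_cons gD gZ !dotDr !dotZr IH h.
have -> : dot w y - dot u (g y) = dot w (y - y') - dot u (g (y - y')).
  by rewrite gB !dotBr e1 opprB addrA subrK.
apply: le_trans (nrB _ _) _.
apply: le_trans (lerD (cauchy_schwarz _ _) (cauchy_schwarz _ _)) _.
have h2 : nr u * nr (g (y - y')) <= nr u * (`|C| * nr (y - y')).
  rewrite ler_wpM2l ?nr_ge0//; apply: le_trans (gC _) _.
  by rewrite ler_wpM2r ?nr_ge0 ?ler_norm.
apply: le_trans (lerD (lexx _) h2) _; move: hr; rewrite ltr_pdivlMr// /M => hr.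
have := nr_ge0 (y - y'); move: hr; move: (nr (y - y')) (nr u) (nr w) `|C| => a b c d; nra.
Qed.

(** * Tensor products *)

Section TensorL2.
Context {R : realType} {S S' P : eqType}.
(** The product index set is abstract, so that exchanging the two projections amplifies the other
    tensor factor by the same lemmas. *)
Variables (mk : S -> S' -> P) (p1 : P -> S) (p2 : P -> S').
Hypothesis mkK : forall z, mk (p1 z) (p2 z) = z.
Hypothesis mk1 : forall i j, p1 (mk i j) = i.
Hypothesis mk2 : forall i j, p2 (mk i j) = j.

Lemma mk_eq i j k l : (mk i j == mk k l) = (i == k) && (j == l).
Proof.
apply/eqP/andP => [e|[/eqP -> /eqP ->//]].
by split; apply/eqP; [rewrite -[LHS](mk1 i j) e mk1|rewrite -[LHS](mk2 i j) e mk2].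
Qed.

Lemma uniq_mk (I : seq S) (J : seq S') (r : S' -> seq S) : uniq J ->
  (forall j, uniq (r j)) -> uniq [seq mk i j | j <- J, i <- r j].
Proof.
move=> uJ ur; apply: allpairs_uniq_dep => //.
move=> _ _ /allpairsPdep [j [i [_ _ ->]]] /allpairsPdep [j' [i' [_ _ ->]]] /= /eqP.
by rewrite mk_eq => /andP[/eqP -> /eqP ->].
Qed.

Lemma sub_box (r : seq P) : {subset r <= [seq mk i j | j <- undup (map p2 r), i <- undup (map p1 r)]}.
Proof.
move=> z zr; apply/allpairsP; exists (p2 z, p1 z) => /=.
by rewrite !mem_undup !map_f// mkK.
Qed.

Lemma sum_box_le (g : P -> R) (r : seq P) : (forall z, 0 <= g z) -> uniq r ->
  \sum_(z <- r) g z <= \sum_(j <- undup (map p2 r)) \sum_(i <- undup (map p1 r)) g (mk i j).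
Proof.
move=> g0 ur; have := ler_sum_subset g0 ur (@sub_box r).
by rewrite big_allpairs_dep.
Qed.

Lemma sqs_slice j (x : l2 R P) : sqs (fun i => x (mk i j)).
Proof.
have [D hD] := l2P x; exists D => r ur.
have := hD [seq mk i j | i <- r]; rewrite big_map; apply.
by rewrite map_inj_uniq// => i k /eqP; rewrite mk_eq => /andP[/eqP].
Qed.

Definition slice j x : l2 R S := L2 (sqs_slice j x).

Lemma sliceE j x i : slice j x i = x (mk i j). Proof. by []. Qed.

Lemma slice_lin j : linear (slice j).
Proof. by move=> k x y; apply: l2_ext. Qed.

Lemma slice_sum (J : seq S') x : uniq J -> \sum_(j <- J) nr (slice j x) ^+ 2 <= nr x ^+ 2.
Proof.
move=> uJ; apply/ler_addgt0Pr => e e0.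
have n0 : 0 < (size J).+1%:R :> R by rewrite ltr0n.
(* A finite list exhausts each slice up to e / (size J + 1), which keeps the total error over J
   below e. *)
have /choice [r hr] : forall j, exists r, uniq r /\
    nr (slice j x) ^+ 2 <= \sum_(i <- r) nr (x (mk i j)) ^+ 2 + e / (size J).+1%:R.
  move=> j; have [r ur hr] := l2_tail (slice j x) (divr_gt0 e0 n0); exists r; split => //.
  rewrite l2_nrE l2norm_sqr; apply: l2_sq_ge => s us.
  rewrite (bigID (mem r))/= lerD//.
    rewrite -big_filter; apply: ler_sum_subset => [i||i]; rewrite ?sqr_ge0 ?filter_uniq//.
    by rewrite mem_filter => /andP[].
  rewrite -big_filter; apply: hr; rewrite ?filter_uniq// => i.
  by rewrite mem_filter => /andP[].
apply: (@le_trans _ _ (\sum_(j <- J) (\sum_(i <- r j) nr (x (mk i j)) ^+ 2 + e / (size J).+1%:R))).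
  by apply: ler_sum => j _; have [] := hr j.
rewrite big_split/=; apply: lerD.
  have := l2_sum_le x (uniq_mk [::] uJ (fun j => (hr j).1)).
  by rewrite big_allpairs_dep.
rewrite big_const_seq count_predT iter_addr addr0 -[_ *+ size J]mulr_natr -mulrA ger_pMr//.
by rewrite mulrC ler_pdivrMr// mul1r ler_nat.
Qed.

Lemma ampl_bound (T : bop (l2 R S)) x (r : seq P) : uniq r ->
  \sum_(z <- r) nr (T (slice (p2 z) x) (p1 z)) ^+ 2 <= (opn T * nr x) ^+ 2.
Proof.
move=> ur.
have /le_trans := @sum_box_le (fun z => nr (T (slice (p2 z) x) (p1 z)) ^+ 2) r (fun z => sqr_ge0 _) ur; apply.
set J := undup _; set I := undup _.
under eq_bigr do under eq_bigr do rewrite mk1 mk2.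
apply: (@le_trans _ _ (\sum_(j <- J) opn T ^+ 2 * nr (slice j x) ^+ 2)).
  apply: ler_sum => j _; apply: le_trans (l2_sum_le _ (undup_uniq _)) _.
  by rewrite -exprMn lerXn2r// ?nnegrE ?mulr_ge0 ?opn_ge0 ?nr_ge0 ?bop_le.
rewrite -mulr_sumr exprMn ler_wpM2l ?sqr_ge0//.
by apply: slice_sum; exact: undup_uniq.
Qed.

Lemma sqs_ampl (T : bop (l2 R S)) (x : l2 R P) : sqs (fun z => T (slice (p2 z) x) (p1 z)).
Proof. by eexists => r ur; exact: ampl_bound. Qed.

(** The operator T (x) 1, acting slice by slice. *)
Definition ampl_fun T x : l2 R P := L2 (sqs_ampl T x).

Lemma nr_ampl_fun T x : nr (ampl_fun T x) <= opn T * nr x.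
Proof.
apply: l2_nr_le => [|r ur]; first by rewrite mulr_ge0 ?opn_ge0 ?nr_ge0.
exact: ampl_bound.
Qed.

Lemma sqs_emb j (x : l2 R S) : sqs (fun z => if p2 z == j then x (p1 z) else 0).
Proof.
exists (nr x ^+ 2) => r ur; rewrite (bigID (fun z => p2 z == j))/= [X in _ + X]big1 ?addr0; last first.
  by move=> z /negPf ->; rewrite nr0 expr0n.
have -> : \sum_(z <- r | p2 z == j) nr (if p2 z == j then x (p1 z) else 0) ^+ 2 =
   \sum_(i <- [seq p1 z | z <- r & p2 z == j]) nr (x i) ^+ 2.
  by rewrite big_map big_filter; apply: eq_bigr => z ->.
apply: l2_sum_le; rewrite map_inj_in_uniq ?filter_uniq// => z w.
rewrite !mem_filter => /andP[/eqP zj _] /andP[/eqP wj _] e.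
by rewrite -(mkK z) -(mkK w) zj wj e.
Qed.

Definition emb j x : l2 R P := L2 (sqs_emb j x).

Lemma dot_emb j (x : l2 R P) (y : l2 R S) : dot x (emb j y) = dot (slice j x) y.
Proof.
rewrite !l2_dotE; apply/tsum_eq => e e0.
have [r hr] := l2dot_summ (slice j x) y e0.
exists [seq mk i j | i <- r] => s us sub.
rewrite (bigID (fun z => p2 z == j))/= [X in _ + X - _]big1 ?addr0; last first.
  by move=> z /negPf ->; rewrite rmorph0 mulr0.
have -> : \sum_(z <- s | p2 z == j) x z * Num.conj (if p2 z == j then y (p1 z) else 0) =
   \sum_(i <- [seq p1 z | z <- s & p2 z == j]) slice j x i * Num.conj (y i).
  by rewrite big_map big_filter; apply: eq_bigr => z zj; rewrite zj sliceE -{1}(mkK z) (eqP zj).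
apply: hr => [|i ir].
  rewrite map_inj_in_uniq ?filter_uniq// => z w.
  rewrite !mem_filter => /andP[/eqP zj _] /andP[/eqP wj _] e'.
  by rewrite -(mkK z) -(mkK w) zj wj e'.
apply/mapP; exists (mk i j); last by rewrite mk1.
by rewrite mem_filter mk2 eqxx sub// map_f.
Qed.

Lemma slice_delta j (z : P) : slice j (delta z) = if j == p2 z then delta (p1 z) else 0.
Proof.
apply: l2_ext => i; rewrite sliceE deltaE -[in LHS](mkK z) mk_eq.
by case: (j == p2 z); rewrite ?andbT ?andbF.
Qed.

Lemma ampl_delta T (z : P) : ampl_fun T (delta z) = emb (p2 z) (T (delta (p1 z))).
Proof.
apply: l2_ext => w /=; rewrite slice_delta.
by case: eqP => // _; rewrite bop0.
Qed.

Lemma ampl_adjointable T : adjointable (ampl_fun T).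
Proof.
have lin U : linear (ampl_fun U).
  by move=> k x y; apply: l2_ext => z /=; rewrite slice_lin bopD bopZ.
split => //; first by exists (opn T) => x; exact: nr_ampl_fun.
exists (ampl_fun (adj T)) => x y; apply: (dot_delta_ext (C := opn T)) => //.
- by move=> u; rewrite -(opn_adj T); exact: nr_ampl_fun.
- move=> z; rewrite dot_delta ampl_delta dot_emb -adjE.
  by rewrite dot_delta.
Qed.

Definition ampl T : bop (l2 R P) := Bop (ampl_adjointable T).

Lemma amplE T x z : ampl T x z = T (slice (p2 z) x) (p1 z). Proof. by []. Qed.

Lemma nr_ampl T : nr (ampl T) <= nr T.
Proof. by apply: opn_le => [|x]; [exact: opn_ge0|exact: nr_ampl_fun]. Qed.

Lemma amplB T U : ampl (T - U) = ampl T - ampl U.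
Proof.
apply: bop_ext => x; apply: l2_ext => z.
by rewrite bopBE l2BE !amplE bopBE l2BE.
Qed.

Lemma amplD T U : ampl (T + U) = ampl T + ampl U.
Proof. by apply: bop_ext => x; apply: l2_ext. Qed.

Lemma amplZ (k : R[i]) T : ampl (k *: T) = k *: ampl T.
Proof. by apply: bop_ext => x; apply: l2_ext. Qed.

Lemma ampl0 : ampl 0 = 0.
Proof. by rewrite -(scale0r 0) amplZ scale0r. Qed.

Lemma ampl_sum (I : Type) (r : seq I) (F : I -> bop (l2 R S)) :
  ampl (\sum_(i <- r) F i) = \sum_(i <- r) ampl (F i).
Proof. by elim/big_rec2: _ => [|i u v _ <-]; rewrite ?ampl0 ?amplD. Qed.

Lemma tens_bound (x : l2 R S) (y : l2 R S') r : uniq r ->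
  \sum_(z <- r) nr (x (p1 z) * y (p2 z)) ^+ 2 <= (nr x * nr y) ^+ 2.
Proof.
move=> ur.
have /le_trans := @sum_box_le (fun z => nr (x (p1 z) * y (p2 z)) ^+ 2) r (fun z => sqr_ge0 _) ur; apply.
rewrite exprMn mulrC.
under eq_bigr do under eq_bigr do rewrite mk1 mk2 nrM exprMn mulrC.
under eq_bigr do rewrite -mulr_sumr.
by rewrite -mulr_suml ler_pM ?sumr_ge0// ?l2_sum_le ?undup_uniq// => *; rewrite sqr_ge0.
Qed.

Lemma sqs_tens (x : l2 R S) (y : l2 R S') : sqs (fun z => x (p1 z) * y (p2 z)).
Proof. by eexists => r ur; exact: tens_bound. Qed.

Definition l2tens x y : l2 R P := L2 (sqs_tens x y).

Lemma nr_tens x y : nr (l2tens x y) <= nr x * nr y.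
Proof.
by apply: l2_nr_le => [|r ur]; [rewrite mulr_ge0 ?nr_ge0|exact: tens_bound].
Qed.

Lemma l2tensE x y z : l2tens x y z = x (p1 z) * y (p2 z). Proof. by []. Qed.

Lemma ampl_tens T x y : ampl T (l2tens x y) = l2tens (T x) y.
Proof.
apply: l2_ext => z; rewrite amplE l2tensE.
have -> : slice (p2 z) (l2tens x y) = y (p2 z) *: x.
  by apply: l2_ext => i; rewrite sliceE l2tensE mk1 mk2 mulrC.
by rewrite bopZ l2ZE mulrC.
Qed.

Lemma l2tens_bilinear : bilinear_for (GRing.Scale.Law.clone _ _ *:%R _)
  (GRing.Scale.Law.clone _ _ *:%R _) l2tens.
Proof.
split=> u a x y; apply: l2_ext => z /=.
  by rewrite mulrDl mulrA.
by rewrite mulrDr mulrCA.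
Qed.

HB.instance Definition _ := bilinear_isBilinear.Build R[i] (l2 R S) (l2 R S') (l2 R P)
  _ _ l2tens l2tens_bilinear.

Lemma dot_tens x x' y y' : dot (l2tens x y) (l2tens x' y') = dot x x' * dot y y'.
Proof.
rewrite -dotZl; apply/esym/(dot_delta_ext (C := nr x')).
- by move=> k u v; rewrite linearPr.
- by move=> u; exact: nr_tens.
move=> j; have -> : l2tens x' (delta j) = emb j x'.
  apply: l2_ext => z; rewrite l2tensE deltaE /=.
  by case: eqP; rewrite ?mulr1 ?mulr0.
rewrite dot_emb dot_delta l2ZE mulrC -dotZl; congr dot.
by apply: l2_ext => i; rewrite sliceE l2tensE mk1 mk2 l2ZE mulrC.
Qed.

End TensorL2.

Section TwistProduct.
Variables E F : twist.
Let S : zmodType := (E * F)%type.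

Definition twp (g h : S) : bool := tw g.1 h.1 (+) tw g.2 h.2.

Lemma twpDl (f g h : S) : twp (f + g) h = twp f h (+) twp g h.
Proof. by rewrite /twp !twDl addbACA. Qed.
Lemma twpDr (f g h : S) : twp h (f + g) = twp h f (+) twp h g.
Proof. by rewrite /twp !twDr addbACA. Qed.
Lemma twp_char2 (g : S) : g + g = 0.
Proof. by case: g => a b; congr pair; exact: tw_char2. Qed.
Lemma twp_nondeg (g : S) : g != 0 -> exists h, twp h g (+) twp g h.
Proof.
case: g => a b; have [->|a0 _] := eqVneq a 0.
  have [->|b0 _] := eqVneq b 0; first by rewrite eqxx.
  by have [h hh] := tw_nondeg b0; exists (0, h); rewrite /twp /= !tw0l.
have [h hh] := tw_nondeg a0; exists (h, 0); rewrite /twp /=.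
by rewrite !tw0l !tw0r !addbF.
Qed.

Definition twprod := Twist twpDl twpDr twp_char2 twp_nondeg.
End TwistProduct.

Section TgaTensor.
Context {R : realType} {E F : twist}.

Lemma bop_bounded (H : hilbertType R) (T : bop H) : bounded_op T.
Proof.
split; first exact: bop_linear.
by apply: (bounded_continuous (C := opn T)); [exact: bop_linear|exact: bop_le].
Qed.

Lemma sub_bop_faithful (H : hilbertType R) (Q : sub_cstar (bop H)) :
  faithful_repr (fun T : sub_elt Q => (sc_val T : H -> H)).
Proof.
split; last by move=> S T e; apply: sc_val_inj; apply: bop_ext => x; rewrite e.
split => //; first by move=> a; exact: bop_bounded.
by move=> a x y; rewrite sc_valS -[star _]/(adj _) adjE.
Qed.

Let EF := twprod E F.

Lemma pair_mkK (z : E * F) : (z.1, z.2) = z. Proof. by case: z. Qed.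

Definition amp1 (T : bop (l2 R E)) : bop (l2 R EF) :=
  ampl (mk := fun (i : E) (j : F) => (i, j)) pair_mkK (fun _ _ => erefl) (fun _ _ => erefl) T.

Definition amp2 (T : bop (l2 R F)) : bop (l2 R EF) :=
  ampl (mk := fun (j : F) (i : E) => (i, j)) (p1 := snd) (p2 := fst)
    pair_mkK (fun _ _ => erefl) (fun _ _ => erefl) T.

Lemma amp1_lam g : amp1 (lam g) = lam ((g, 0) : EF).
Proof.
apply: bop_ext => x; apply: l2_ext => -[i j].
rewrite amplE [LHS]monoE sliceE [RHS]monoE; congr (sg _ * x _).
  by rewrite /= /twp /= tw0l addbF.
by congr pair; rewrite /= addr0.
Qed.

Lemma amp2_lam g : amp2 (lam g) = lam ((0, g) : EF).
Proof.
apply: bop_ext => x; apply: l2_ext => -[i j].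
rewrite amplE [LHS]monoE sliceE [RHS]monoE; congr (sg _ * x _).
  by rewrite /= /twp /= tw0l addFb.
by congr pair; rewrite /= addr0.
Qed.

Lemma amp1_tga T : tga_set T -> tga_set (amp1 T).
Proof.
move=> hT e e0; have [a ha] := hT e e0.
exists [seq (p.1, ((p.2, 0) : EF)) | p <- a].
have -> : lamsum [seq (p.1, ((p.2, 0) : EF)) | p <- a] = amp1 (lamsum a).
  rewrite /lamsum big_map /amp1 ampl_sum; apply: eq_bigr => p _.
  by rewrite amplZ -amp1_lam.
by rewrite /amp1 -amplB; apply: le_lt_trans (nr_ampl _ _ _ _) ha.
Qed.

Lemma amp2_tga T : tga_set T -> tga_set (amp2 T).
Proof.
move=> hT e e0; have [a ha] := hT e e0.
exists [seq (p.1, ((0, p.2) : EF)) | p <- a].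
have -> : lamsum [seq (p.1, ((0, p.2) : EF)) | p <- a] = amp2 (lamsum a).
  rewrite /lamsum big_map /amp2 ampl_sum; apply: eq_bigr => p _.
  by rewrite amplZ -amp2_lam.
by rewrite /amp2 -amplB; apply: le_lt_trans (nr_ampl _ _ _ _) ha.
Qed.

Lemma tga_min_tensor : min_tensor (tga R E) (tga R F) (tga R EF).
Proof.
pose tau := l2tens (mk := fun (i : E) (j : F) => (i, j)) (p1 := fst) (p2 := snd)
    pair_mkK (fun _ _ => erefl) (fun _ _ => erefl) : {bilinear l2 R E -> l2 R F -> l2 R EF}.
pose t (c : tga R E) (d : tga R F) : tga R EF :=
  SubElt (tga_mul (amp1_tga (tgaP c)) (amp2_tga (tgaP d)) : tga_sub R EF _).
exists (l2 R E), (l2 R F), (l2 R EF), (fun T : tga R E => bopf (sc_val T)),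
  (fun T : tga R F => bopf (sc_val T)), (fun T : tga R EF => bopf (sc_val T)), tau, t; split; split.
- exact: sub_bop_faithful.
- exact: sub_bop_faithful.
- exact: sub_bop_faithful.
- split; first by move=> x x' y y'; exact: dot_tens.
  apply/seteqP; split => // x _; apply/closure_nr => e e0.
  have [r ur hr] := delta_dense x e0; exists (\sum_(f <- r) x f *: delta f) => //.
  apply: lin_span_sum => -[i j]; exists (delta i), (delta j).
  apply: l2_ext => -[k l]; by rewrite l2tensE !deltaE -natrM mulnb.
- move=> c d x y; rewrite /t /= -[LHS]/(amp1 (sc_val c) (amp2 (sc_val d) (tau x y))).
  have -> : amp2 (sc_val d) (tau x y) = tau x (sc_val d y).
    have -> : tau x y = l2tens (mk := fun (j : F) (i : E) => (i, j)) (p1 := snd) (p2 := fst) pair_mkK (fun _ _ => erefl) (fun _ _ => erefl) y x.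
      by apply: l2_ext => z; rewrite !l2tensE mulrC.
    rewrite /amp2 ampl_tens; apply: l2_ext => z; rewrite !l2tensE mulrC//.
  by rewrite /amp1 ampl_tens.
- apply/seteqP; split => // x _; apply/closure_nr => e e0.
  have [a ha] := tga_dense x e0; exists (lamsumA a) => //.
  apply: (@lin_span_sum _ _ _ _ a (fun p => p.1) (fun p => lamA p.2)) => -[k [g h]] /=; exists (lamA g), (lamA h).
  apply: sc_val_inj; rewrite -[LHS]/(lam ((g, h) : EF)).
  have e1 : ((g, 0) : EF) + (0, h) = (g, h) by congr pair; rewrite /= ?addr0 ?add0r.
  have e2 : tw (t := EF) (g, 0) (0, h) = false by rewrite /= /twp /= tw0r tw0l.
  by rewrite -[RHS]/(amp1 (lam g) ** amp2 (lam h)) amp1_lam amp2_lam lamM e1 e2 sg0 scale1r.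
Qed.

End TgaTensor.

(** * Nuclearity *)

Section TensorNorms.
Context {R : realType} {A B : cstarAlgType R}.
Implicit Types (u v : seq (A * B)) (a : A) (b : B).

Section Bilin.
Context {W : lmodType R[i]} (f : {bilinear A -> B -> W}).
Lemma bilDl a a' b : f (a + a') b = f a b + f a' b. Proof. exact: linearDl. Qed.
Lemma bilDr a b b' : f a (b + b') = f a b + f a b'. Proof. exact: linearDr. Qed.
Lemma bilZl (k : R[i]) a b : f (k *: a) b = k *: f a b. Proof. exact: linearZl_LR. Qed.
Lemma bilZr (k : R[i]) a b : f a (k *: b) = k *: f a b. Proof. exact: linearZr_LR. Qed.
Lemma bil_suml (I : Type) (r : seq I) (F : I -> A) b :
  f (\sum_(i <- r) F i) b = \sum_(i <- r) f (F i) b. Proof. exact: linear_sumlz. Qed.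
Lemma bil_sumr (I : Type) (r : seq I) (P : pred I) (F : I -> B) a :
  f a (\sum_(i <- r | P i) F i) = \sum_(i <- r | P i) f a (F i). Proof. exact: linear_sumr. Qed.
End Bilin.

Context {N : seq (A * B) -> R[i]} (hN : tensor_cstar_norm N).

Definition tn u : R := complex.Re (N u).

Lemma tnE u : N u = (tn u)%:C.
Proof. by rewrite RRe_real// ger0_real// (tensN_ge0 hN). Qed.

Lemma tn_ge0 u : 0 <= tn u.
Proof. by have := tensN_ge0 hN u; rewrite tnE ler0c. Qed.

Lemma tn_wd u v : tens_eq u v -> tn u = tn v.
Proof. by move=> /(tensN_wd hN) e; rewrite /tn e. Qed.

Lemma tn_cat u v : tn (u ++ v) <= tn u + tn v.
Proof. by have := tensN_add hN u v; rewrite !tnE -rmorphD lecR. Qed.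

Lemma tn_scale (k : R[i]) u : tn (tens_scale k u) = nr k * tn u.
Proof. by have := tensN_scale hN k u; rewrite !tnE nrE -rmorphM => /(@complexI R). Qed.

Lemma tn_mul u v : tn (tens_mul u v) <= tn u * tn v.
Proof. by have := tensN_mul hN u v; rewrite !tnE -rmorphM lecR. Qed.

Lemma tn_starmul u : tn (tens_mul (tens_star u) u) = tn u ^+ 2.
Proof. by have := tensN_star hN u; rewrite !tnE -rmorphXn => /(@complexI R). Qed.

Lemma tn_nil : tn [::] = 0.
Proof. by have := tn_scale 0 [::]; rewrite nr0 mul0r. Qed.

Lemma tens_starK u : tens_star (tens_star u) = u.
Proof. by rewrite /tens_star -map_comp map_id_in// => -[a b] _ /=; rewrite !starK. Qed.

Lemma tn_star u : tn (tens_star u) = tn u.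
Proof.
have le v : tn v <= tn (tens_star v).
  have := tn_ge0 v; rewrite le_eqVlt => /orP[/eqP <-|v0]; first exact: tn_ge0.
  by rewrite -(ler_pM2r v0) -expr2 -tn_starmul tn_mul.
by apply/eqP; rewrite eq_le le andbT -{2}[u]tens_starK le.
Qed.

Lemma tn_pS u v : tens_mul (tens_star u) u = tens_mul (tens_star v) v -> tn u = tn v.
Proof.
by move=> e; apply/eqP; rewrite -(@eqrXn2 _ 2) ?tn_ge0// -!tn_starmul e.
Qed.

Lemma tens_mul_map (F G : A * B -> A * B) u v :
  tens_mul (map F u) (map G v) =
  [seq ((F x).1 ** (G y).1, (F x).2 ** (G y).2) | x <- u, y <- v].
Proof. by rewrite /tens_mul; elim: u => //= x u ->; rewrite -map_comp. Qed.

(** The multiplier c (x) 1 on formal sums; B may lack a unit, so it is not itself a tensor. *)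
Definition tens_left (c : A) u := [seq (c ** x.1, x.2) | x <- u].
Definition tens_right (c : A) u := [seq (x.1 ** c, x.2) | x <- u].

Lemma tn_left (c : A) u : is_unit (star c ** c) -> tn (tens_left c u) = tn u.
Proof.
move=> hc; apply: tn_pS; rewrite /tens_star /tens_left -map_comp tens_mul_map.
rewrite -[u in RHS]map_id -map_comp tens_mul_map.
apply: eq_allpairs => x y /=; rewrite starM cmulA -(cmulA (star x.1)).
by rewrite (proj2 (hc (star x.1))).
Qed.

Lemma tn_right (c : A) u : is_unit (c ** star c) -> tn (tens_right c u) = tn u.
Proof.
move=> hc; rewrite -tn_star -[RHS]tn_star.
have -> : tens_star (tens_right c u) = tens_left (star c) (tens_star u).
  by rewrite /tens_star /tens_left -!map_comp; apply: eq_map => x /=; rewrite starM.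
by apply: tn_left; rewrite starK.
Qed.

(** A C*-norm on the algebraic tensor product is not given as a cross norm. For fixed b, however,
    the norm of x (x) b depends only on x^* x, so [selfadjoint_contracts] yields continuity in the
    first leg; the factor 2 comes from splitting a into its real and imaginary parts. *)
Lemma tn_factor_bound (e : A) a b : is_unit e -> tn [:: (a, b)] <= 2 * nr a * tn [:: (e, b)].
Proof.
move=> he; pose p x := tn [:: (x, b)].
have pD x y : p (x + y) <= p x + p y.
  rewrite /p (tn_wd (v := [:: (x, b)] ++ [:: (y, b)])) ?tn_cat// => W f.
  by rewrite big_cat !big_seq1 /= bilDl.
have pZ (k : R[i]) x : p (k *: x) = nr k * p x by rewrite /p -tn_scale.
have pS x y : star x ** x = star y ** y -> p x = p y.
  by move=> h; apply: tn_pS; rewrite /tens_mul /= h.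
have sa h : star h = h -> p h <= nr h * p e.
  move=> sh; have [->|h0] := eqVneq h 0.
    by rewrite nr0 mul0r -(scale0r (0 : A)) pZ nr0 mul0r.
  have nh : 0 < nr h by rewrite nr_gt0.
  have ih0 : 0 < (nr h)^-1 by rewrite invr_gt0.
  have := selfadjoint_contracts pD pZ pS (h := (nr h)^-1%:C *: h) e.
  rewrite starZ conjR sh nrZ nrR gtr0_norm// mulVf ?gt_eqF// => /(_ erefl (lexx _)).
  by rewrite cmulZl (proj2 (he h)) pZ nrR gtr0_norm// ler_pdivrMl.
have nI : nr ('i%R : R[i]) = 1.
  by rewrite -complexiE /nr normc_def/= expr0n/= add0r expr1n sqrtr1.
pose h := (2^-1 : R)%:C *: (a + star a).
pose k := (2^-1 : R)%:C *: ('i *: (star a - a)).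
have ea : a = h + 'i *: k.
  have -> : 'i *: k = (2^-1 : R)%:C *: (a - star a).
    by rewrite /k !scalerA mulrAC -expr2 sqr_i mulN1r scaleNr -scalerN opprB.
  by rewrite /h -scalerDr addrACA subrr addr0 halfC.
have eb : nr (2^-1 : R)%:C = 2^-1 :> R by rewrite nrR ger0_norm.
have hh : p h <= nr a * p e.
  apply: le_trans (sa _ _) _; first by rewrite starZ conjR starD starK addrC.
  rewrite ler_wpM2r ?tn_ge0// nrZ eb ler_pdivrMl// mulr_natl mulr2n.
  by apply: le_trans (nrD _ _) _; rewrite nr_star.
have hk : p k <= nr a * p e.
  apply: le_trans (sa _ _) _.
    rewrite /k !starZ conjR starB starK.
    have -> : Num.conj 'i = - 'i :> R[i] by rewrite conjE /= -[RHS]/((- 0) +i* (- 1)) oppr0.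
    by rewrite scaleNr -scalerN opprB.
  rewrite ler_wpM2r ?tn_ge0// nrZ eb ler_pdivrMl// mulr_natl mulr2n nrZ nI mul1r.
  by apply: le_trans (nrB _ _) _; rewrite nr_star.
rewrite -/(p a) {1}ea; apply: le_trans (pD _ _) _; rewrite (pZ 'i%R) nI mul1r.
by rewrite -mulrA mulr_natl mulr2n lerD.
Qed.

End TensorNorms.

Section TgaNuclear.
Context {R : realType} {V : twist} {B : cstarAlgType R}.
Local Notation A := (tga R V).
Implicit Types (w : seq (V * B)) (g h : V) (b : B).

Definition lifts w : seq (A * B) := [seq (lamA p.1, p.2) | p <- w].

Definition coef g w : B := \sum_(p <- w | p.1 == g) p.2.

(** The coordinates of u^* u for the element u represented by [lifts w]. *)
Definition sqw w : seq (V * B) :=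
  [seq (p.1 + q.1, (sg (tw p.1 p.1) * sg (tw p.1 q.1)) *: (star p.2 ** q.2)) | p <- w, q <- w].

Lemma sqw_eq w : tens_eq (tens_mul (tens_star (lifts w)) (lifts w)) (lifts (sqw w)).
Proof.
move=> W f; rewrite /tens_mul /tens_star /lifts /sqw -map_comp big_map.
rewrite !big_allpairs_dep big_map; apply: eq_bigr => p _.
rewrite big_map; apply: eq_bigr => q _ /=.
by rewrite star_lamA cmulZl lamAM scalerA bilZl bilZr.
Qed.

Definition trace (a : A) : R[i] := (sc_val a (delta 0) : l2 R V) 0.

(** The slice map given by the trace. Being bilinear it is available to [tens_eq], and it recovers b
    from 1 (x) b. *)
Definition tr_map (a : A) (b : B) : B := trace a *: b.

Lemma tr_map_bilinear : bilinear_for (GRing.Scale.Law.clone _ _ *:%R _)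
  (GRing.Scale.Law.clone _ _ *:%R _) tr_map.
Proof.
split=> u k x y; rewrite /tr_map /=.
  by rewrite /trace -[sc_val (k *: x + y)]/(k *: sc_val x + sc_val y) bopDE bopZE l2DE l2ZE scalerDl scalerA.
by rewrite scalerDr !scalerA mulrC.
Qed.

HB.instance Definition _ := bilinear_isBilinear.Build R[i] A B B
  _ _ tr_map tr_map_bilinear.

Lemma trace_lamA0 : trace (lamA 0) = 1.
Proof. by rewrite /trace -[sc_val (lamA 0)]/(lam 0) lam_delta0 deltaE eqxx. Qed.

Lemma coef_lifts w (G : seq V) : uniq G -> (forall p, p \in [seq p.1 | p <- w] -> p \in G) ->
  tens_eq (lifts w) (lifts [seq (g, coef g w) | g <- G]).
Proof.
move=> uG wG W f; rewrite /lifts !big_map.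
under [RHS]eq_bigr do rewrite /= /coef bil_sumr big_mkcond.
rewrite exchange_big/= !big_seq; apply: eq_bigr => p pw.
rewrite (bigD1_seq p.1)//=; last by apply: wG; exact: map_f.
by rewrite eqxx big1 ?addr0// => g; rewrite eq_sym => /negPf ->.
Qed.

Section OneNorm.
Context {N : seq (A * B) -> R[i]} (hN : tensor_cstar_norm N).
Local Notation n := (@tn R A B N).

(** b |-> N (1 (x) b) is a faithful submultiplicative C*-norm on B, hence the norm of B by
    uniqueness. *)
Lemma tn_lam0 b : n [:: (lamA 0, b)] = nr b.
Proof.
pose p b := n [:: (lamA 0, b)]; rewrite -/(p b).
have l00 : lamA 0 ** lamA 0 = lamA 0 :> A by rewrite (proj1 (lamA0_unit _)).
have sl0 : star (lamA 0) = lamA 0 :> A by rewrite star_lamA tw0l scale1r.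
apply: (@cstar_norm_unique R B p).
- split => [x|x y|k x|x]; first exact: tn_ge0.
  + rewrite /p (tn_wd hN (v := [:: (lamA 0, x)] ++ [:: (lamA 0, y)])) ?(tn_cat hN)// => W f.
    by rewrite big_cat !big_seq1 /= bilDr.
  + rewrite /p -(tn_scale hN); apply: (tn_wd hN) => W f.
    by rewrite !big_seq1 /= bilZl bilZr.
  + by rewrite /p -(tn_starmul hN) /tens_mul /= sl0 l00.
- by move=> x y; apply: le_trans (tn_mul hN _ _); rewrite /tens_mul /= l00.
- move=> x h; have : N [:: (lamA 0, x)] = 0 by rewrite (tnE hN) -/(p x) h.
  move=> /(tensN_eq0 hN) /(_ _ tr_map); rewrite big_seq1 big_nil /=.
  by rewrite /tr_map trace_lamA0 scale1r.
Qed.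

Lemma tn_lam g b : n [:: (lamA g, b)] = nr b.
Proof.
apply/eqP; rewrite -(@eqrXn2 _ 2) ?(tn_ge0 hN) ?nr_ge0//.
by rewrite -(tn_starmul hN) /tens_mul /= lamA_star_mul tn_lam0 nr_star_cmul.
Qed.

Lemma tn_le_coef w (G : seq V) : uniq G -> (forall p, p \in [seq p.1 | p <- w] -> p \in G) ->
  n (lifts w) <= \sum_(g <- G) nr (coef g w).
Proof.
move=> uG wG; rewrite (tn_wd hN (coef_lifts uG wG)).
elim: G {uG wG} => [|g G IH]; first by rewrite big_nil (tn_nil hN).
rewrite big_cons -cat1s map_cat /lifts map_cat; apply: le_trans (tn_cat hN _ _) _.
by rewrite lerD// tn_lam.
Qed.

(** Conjugation by the unitary lam h (x) 1 is isometric, and its average with the identity keeps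
    exactly the terms whose g has [om h g] false. *)
Lemma tn_filter h w : n (lifts [seq p <- w | ~~ om h p.1]) <= n (lifts w).
Proof.
set w' := [seq p <- w | ~~ om h p.1].
have unit1 : is_unit (star (lamA h : A) ** lamA h) by rewrite lamA_star_mul; exact: lamA0_unit.
have unit2 : is_unit (star (lamA h : A) ** star (star (lamA h))) by rewrite starK; exact: unit1.
have e : tens_eq (lifts w ++ tens_right (star (lamA h)) (tens_left (lamA h) (lifts w)))
    (tens_scale 2%:R (lifts w')).
  move=> W f; rewrite big_cat/= /tens_right /tens_left /tens_scale /lifts /w'.
  rewrite !big_map big_filter [RHS]big_mkcond/= -big_split/=; apply: eq_bigr => p _ /=.
  rewrite lamA_conj bilZl; case: (om _ _); first by rewrite sg1 scaleN1r subrr.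
  by rewrite sg0 scale1r bilZl scaler_nat mulr2n.
have := tn_cat hN (lifts w) (tens_right (star (lamA h)) (tens_left (lamA h) (lifts w))).
rewrite (tn_wd hN e) (tn_scale hN) (tn_right hN _ unit2) (tn_left hN _ unit1).
have -> : nr (2%:R : R[i]) = 2 by rewrite -(rmorph_nat (real_complex R)) nrR ger0_norm.
by move=> h2; lra.
Qed.

Lemma tn_coef0 w : nr (coef 0 w) <= n (lifts w).
Proof.
have [hs hhs] := @separating_list V [seq p.1 | p <- w].
have key : forall hs, n (lifts [seq p <- w | ~~ has (fun h => om h p.1) hs]) <= n (lifts w).
  elim => [|h l IH] /=; first by rewrite filter_predT.
  apply: le_trans IH; apply: le_trans (tn_filter h _).
  rewrite -filter_predI le_eqVlt; apply/orP; left; apply/eqP; congr (n (lifts _)).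
  by apply: eq_filter => p /=; rewrite negb_or.
apply: le_trans (key hs).
have -> : [seq p <- w | ~~ has (fun h => om h p.1) hs] = [seq p <- w | p.1 == 0].
  apply: eq_in_filter => p pw; have [->|p0] := eqVneq p.1 0.
    by apply/hasPn => h _; rewrite om0r.
  by rewrite hhs// map_f.
rewrite -(tn_lam0 (coef 0 w)) le_eqVlt; apply/orP; left; apply/eqP.
apply: (tn_wd hN) => W f; rewrite big_seq1 /lifts big_map big_filter /= /coef bil_sumr.
by apply: eq_bigr => p /eqP ->.
Qed.

(** Left multiplication by the unitary [lam g] moves the coefficient at g to 0, up to a sign. *)
Lemma tn_coef g w : nr (coef g w) <= n (lifts w).
Proof.
have unit1 : is_unit (star (lamA g : A) ** lamA g) by rewrite lamA_star_mul; exact: lamA0_unit.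
pose w' := [seq (g + p.1, sg (tw g p.1) *: p.2) | p <- w].
have e : tens_eq (tens_left (lamA g) (lifts w)) (lifts w').
  move=> W f; rewrite /tens_left /lifts /w' !big_map; apply: eq_bigr => p _ /=.
  by rewrite lamAM bilZl bilZr.
rewrite -(tn_left hN _ unit1) (tn_wd hN e); apply: le_trans (tn_coef0 w').
have -> : coef 0 w' = sg (tw g g) *: coef g w.
  rewrite /coef /w' big_map scaler_sumr; apply: eq_big => [p|p /=].
    by rewrite /= addrC add_eq add0r.
  by rewrite addrC add_eq add0r => /eqP ->.
by rewrite nrZ nr_sg mul1r.
Qed.

Lemma tn_sqw w : n (lifts (sqw w)) = n (lifts w) ^+ 2.
Proof. by rewrite -(tn_wd hN (sqw_eq w)) (tn_starmul hN). Qed.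

Lemma tn_iter_sqw w k : n (lifts (iter k sqw w)) = n (lifts w) ^+ (2 ^ k).
Proof.
elim: k => [|k IH]; first by rewrite expr1.
by rewrite iterS tn_sqw IH -exprM -expnSr.
Qed.

End OneNorm.

Lemma finite_hull (s : seq V) : exists G : seq V,
  [/\ uniq G, {subset s <= G} & forall g h, g \in G -> h \in G -> g + h \in G].
Proof.
suff [G [G0 sG addG]] : exists G : seq V,
    [/\ 0 \in G, {subset s <= G} & forall g h, g \in G -> h \in G -> g + h \in G].
  exists (undup G); split; first exact: undup_uniq.
    by move=> x /sG; rewrite mem_undup.
  by move=> g h; rewrite !mem_undup; exact: addG.
elim: s => [|x s [G [G0 sG addG]]].
  by exists [:: 0]; split => [|//|g h]; rewrite !inE ?eqxx// => /eqP -> /eqP ->; rewrite addr0.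
exists (G ++ [seq x + g | g <- G]); split.
- by rewrite mem_cat G0.
- move=> y; rewrite inE mem_cat => /orP[/eqP ->|/sG ->//].
  by apply/orP; right; apply/mapP; exists 0; rewrite ?addr0.
- move=> g h; rewrite !mem_cat => /orP[gG|/mapP [g' gG ->]] /orP[hG|/mapP [h' hG ->]].
  + by rewrite addG.
  + by apply/orP; right; apply/mapP; exists (g + h'); [exact: addG|rewrite addrCA].
  + by apply/orP; right; apply/mapP; exists (g' + h); [exact: addG|rewrite addrA].
  + by rewrite addrACA tw_char2 add0r addG.
Qed.

(** Taking roots of order 2^k washes out the constant C. *)
Lemma le_of_pow (x y C : R) : 0 <= x -> 0 <= y ->
  (forall k, x ^+ (2 ^ k) <= C * y ^+ (2 ^ k)) -> x <= y.
Proof.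
move=> x0 y0 h; rewrite leNgt; apply/negP => yx.
have xp : 0 < x by exact: le_lt_trans yx.
have r1 : 0 <= y / x < 1 by rewrite divr_ge0//= ltr_pdivrMr// mul1r.
have c0 : 0 < (1 + `|C|)^-1 by rewrite invr_gt0 ltr_wpDr.
have [k hk] := exp2n_small r1 c0.
have := h k; apply/negP; rewrite -ltNge.
have xk : 0 < x ^+ (2 ^ k) by rewrite exprn_gt0.
move: hk; rewrite expr_div_n ltr_pdivrMr// mulrC ltr_pdivlMr ?ltr_wpDr// => hk.
apply: le_lt_trans hk; rewrite mulrC ler_wpM2l ?exprn_ge0//.
by apply: le_trans (ler_norm C) _; rewrite lerDr.
Qed.

(* The support of [iter k sqw w] stays in the finite subgroup generated by the support
   of w, so both norms of it are compared with a constant independent of k. *)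
Lemma tn_lifts_le N N' w : tensor_cstar_norm N -> tensor_cstar_norm N' ->
  @tn R A B N (lifts w) <= @tn R A B N' (lifts w).
Proof.
move=> hN hN'; have [G [uG wG addG]] := finite_hull [seq p.1 | p <- w].
apply: (@le_of_pow _ _ (size G)%:R); [exact: tn_ge0|exact: tn_ge0|move=> k].
rewrite -(tn_iter_sqw hN) -(tn_iter_sqw hN').
have sub : {subset [seq p.1 | p <- iter k sqw w] <= G}.
  elim: k => [//|k IH] _ /mapP [p + ->]; rewrite iterS => /allpairsP [[q r] /= [hq hr ->]] /=.
  by apply: addG; apply: IH; exact: map_f.
apply: le_trans (tn_le_coef hN uG sub) _.
apply: (@le_trans _ _ (\sum_(g <- G) @tn R A B N' (lifts (iter k sqw w)))).
  by apply: ler_sum => g _; exact: (tn_coef hN').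
by rewrite big_const_seq count_predT iter_addr addr0 -[leLHS]mulr_natl.
Qed.

(** One finitely supported w serves both norms: first legs are approximated in the norm of the
    algebra, which controls either tensor norm through [tn_factor_bound]. *)
Lemma tens_approx N N' (u : seq (A * B)) (e : R) :
  tensor_cstar_norm N -> tensor_cstar_norm N' -> 0 < e ->
  exists w d, [/\ tens_eq u (lifts w ++ d), @tn R A B N d <= e & @tn R A B N' d <= e].
Proof.
move=> hN hN'; elim: u e => [|[a b] u IH] e e0.
  by exists [::], [::]; rewrite !(tn_nil _)// ltW.
have e2 : 0 < e / 2 by rewrite divr_gt0.
have [w [d [ed dN dN']]] := IH _ e2.
pose c := 2 * (@tn R A B N [:: (lamA 0, b)] + @tn R A B N' [:: (lamA 0, b)]) + 1.
have hc : 0 < c by rewrite /c ltr_wpDl// mulr_ge0// addr_ge0 ?tn_ge0.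
have [s hs] := tga_dense a (divr_gt0 e2 hc).
exists ([seq (p.2, p.1 *: b) | p <- s] ++ w), ((a - lamsumA s, b) :: d).
have small M : tensor_cstar_norm M -> 2 * @tn R A B M [:: (lamA 0, b)] <= c ->
    @tn R A B M d <= e / 2 -> @tn R A B M ((a - lamsumA s, b) :: d) <= e.
  move=> hM Mc dM; rewrite -cat1s; apply: le_trans (tn_cat hM _ _) _; rewrite [e]splitr.
  rewrite lerD//; apply: le_trans (tn_factor_bound hM _ _ lamA0_unit) _.
  move: hs; rewrite ltr_pdivlMr// => /ltW hs; apply: le_trans hs.
  by rewrite mulrAC mulrC ler_wpM2l ?nr_ge0.
have n0 := tn_ge0 hN [:: (lamA 0, b)]; have n0' := tn_ge0 hN' [:: (lamA 0, b)].
split; last 2 first.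
- by apply: small => //; rewrite /c; lra.
- by apply: small => //; rewrite /c; lra.
move=> W f; rewrite /lifts map_cat !big_cat !big_map !big_cons /= (ed W f) big_cat /= big_map.
have -> : f a b = f (a - lamsumA s) b + \sum_(p <- s) f (lamA p.2) (p.1 *: b).
  rewrite -[in LHS](subrK (lamsumA s) a) (bilDl f (a - lamsumA s)); congr (_ + _).
  by rewrite bil_suml; apply: eq_bigr => p _; rewrite bilZl bilZr.
by rewrite /= [f _ b + _]addrC addrACA.
Qed.

End TgaNuclear.

Lemma tga_nuclear (R : realType) (V : twist) : nuclear (tga R V).
Proof.
move=> B.
have le N N' u : tensor_cstar_norm N -> tensor_cstar_norm N' ->
    @tn R (tga R V) B N u <= @tn R (tga R V) B N' u.
  move=> hN hN'; apply/ler_addgt0Pr => e e0.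
  have [w [d [ed dN dN']]] := tens_approx u hN hN' (divr_gt0 e0 (ltr0Sn R 1)).
  rewrite (tn_wd hN ed); apply: le_trans (tn_cat hN _ _) _.
  have h1 := tn_lifts_le w hN hN'.
  have h2 : tn (N := N') (lifts w) <= tn (N := N') u + tn (N := N') d.
    have e1 : tens_eq (lifts w) (u ++ tens_scale (-1) d).
      move=> W f; rewrite big_cat/= (ed W f) big_cat/= -addrA -[LHS]addr0; congr (_ + _).
      rewrite /tens_scale big_map -big_split/= big1// => p _ /=.
      by rewrite bilZl scaleN1r subrr.
    rewrite (tn_wd hN' e1); apply: le_trans (tn_cat hN' _ _) _.
    by rewrite (tn_scale hN') nrN nr1 mul1r.
  by rewrite [e]splitr; lra.
move=> N N' hN hN'; apply/funext => u.
by rewrite (tnE hN) (tnE hN'); congr (_%:C); apply/eqP; rewrite eq_le !le.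
Qed.

(** * Dimension drop algebras *)

Section ContinuityOnUnitInterval.
Context {R : realType}.
Implicit Types (phi psi : R -> R) (s t : R).

Definition rcont phi := {within `[0, 1], continuous phi}.

Lemma in01 s : 0 <= s <= 1 -> (`[0, 1]%classic : set R) s.
Proof. by rewrite /= in_itv. Qed.

Lemma rcontP phi : rcont phi -> forall s, 0 <= s <= 1 -> forall e : R, 0 < e ->
  exists2 d : R, 0 < d & forall t, 0 <= t <= 1 -> `|s - t| < d -> `|phi s - phi t| < e.
Proof.
move=> /subspace_continuousP h s s01 e e0.
have /(_ _ (nbhsx_ballx _ _ e0)) := h s (in01 s01).
rewrite /= /within /= => /nbhs_ballP [d /= d0 hd]; exists d => // t t01 st.
by apply: (hd t) => //; exact: in01.
Qed.

Lemma rcont_of phi : (forall s, 0 <= s <= 1 -> forall e : R, 0 < e ->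
  exists2 d : R, 0 < d & forall t, 0 <= t <= 1 -> `|s - t| < d -> `|phi s - phi t| < e) -> rcont phi.
Proof.
move=> h; apply/subspace_continuousP => s /=; rewrite in_itv /= => s01 W /nbhs_ballP [e /= e0 sW].
have [d d0 hd] := h s s01 e e0; rewrite /within /=; apply/nbhs_ballP; exists d => //= t st.
by rewrite in_itv /= => t01; apply: sW; apply: hd.
Qed.

Lemma rcont_cst (c : R) : rcont (fun=> c).
Proof. by apply: continuous_subspaceT => s; exact: cvg_cst. Qed.

Lemma rcont_id : rcont id.
Proof. by apply: continuous_subspaceT => s; exact: cvg_id. Qed.

Lemma rcontD phi psi : rcont phi -> rcont psi -> rcont (fun s => phi s + psi s).
Proof. by move=> h h' s; apply: cvgD; [exact: h|exact: h']. Qed.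

Lemma rcontM phi psi : rcont phi -> rcont psi -> rcont (fun s => phi s * psi s).
Proof. by move=> h h' s; apply: cvgM; [exact: h|exact: h']. Qed.

Lemma rcontN phi : rcont phi -> rcont (fun s => - phi s).
Proof. by move=> h s; apply: cvgN; exact: h. Qed.

Lemma rcontB phi psi : rcont phi -> rcont psi -> rcont (fun s => phi s - psi s).
Proof. by move=> h h'; apply: rcontD => //; exact: rcontN. Qed.

Lemma rcont_sqrt phi : rcont phi -> rcont (fun s => Num.sqrt (phi s)).
Proof. by move=> h s; apply: continuous_cvg; [exact: sqrt_continuous|exact: h]. Qed.

Lemma rcont_unif phi (e : R) : rcont phi -> 0 < e -> exists n : nat, forall s t,
  0 <= s <= 1 -> 0 <= t <= 1 -> `|s - t| <= n.+1%:R^-1 -> `|phi s - phi t| < e.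
Proof.
move=> h e0; have /compact_near_coveringP cov := @segment_compact R 0 1.
have [|n _ hn] := cov nat \oo (fun n s => forall t, 0 <= s <= 1 -> 0 <= t <= 1 -> `|s - t| <= n.+1%:R^-1 -> `|phi s - phi t| < e).
  move=> s /=; rewrite in_itv /= => s01.
  have [d d0 hd] := rcontP h s01 (divr_gt0 e0 (ltr0Sn _ 1)).
  have d2 : 0 < d / 2 by rewrite divr_gt0.
  near=> s' n => t s'01 t01 st.
  have s's : `|s - s'| < d / 2 by near: s'; exact: nbhsx_ballx.
  have nd : n.+1%:R^-1 < d / 2 by near: n; exact: (near_infty_natSinv_lt (PosNum d2)).
  have -> : phi s' - phi t = (phi s' - phi s) + (phi s - phi t) by rewrite addrA subrK.
  apply: le_lt_trans (ler_normD _ _) _; rewrite [e]splitr ltrD//.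
    rewrite distrC; apply: hd => //; apply: lt_le_trans s's _.
  apply: hd => //; have -> : s - t = (s - s') + (s' - t) by rewrite addrA subrK.
  by apply: le_lt_trans (ler_normD _ _) _; rewrite [d]splitr ltrD// (le_lt_trans st).
exists n => s t s01 t01; apply: (hn n) => //=; exact: in01.
Unshelve. all: by end_near. Qed.

Definition vanishing phi := [/\ rcont phi, phi 0 = 0 & phi 1 = 0].

(** No polygonal functions are built. A code records a grid, a tolerance and rational values near
    the grid points; for each code that is realized, one function realizing it is picked, and two
    functions with the same code differ by at most twice the tolerance. *)
Lemma vanishing_separable : exists beta : nat -> R -> R,
  (forall k, vanishing (beta k)) /\
  forall phi, vanishing phi -> forall e : R, 0 < e ->
    exists k, forall s, 0 <= s <= 1 -> `|phi s - beta k s| <= e.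
Proof.
pose near_code (c : nat * nat * seq rat) phi := vanishing phi /\
  forall s, 0 <= s <= 1 -> forall i, (i <= c.1.1)%N -> `|s - i%:R / c.1.1.+1%:R| <= c.1.1.+1%:R^-1 ->
    `|phi s - ratr (nth 0%Q c.2 i)| <= c.1.2.+1%:R^-1.
have van0 : vanishing (fun=> 0) by split => //; exact: rcont_cst.
have /choice [pick hpick] : forall c, exists phi, vanishing phi /\
    ((exists psi, near_code c psi) -> near_code c phi).
  move=> c; have [[psi h]|h] := pselect (exists psi, near_code c psi).
    by exists psi; split => //; case: h.
  by exists (fun=> 0).
exists (fun k => if unpickle k is Some c then pick c else (fun=> 0)); split.
  by move=> k; case: (unpickle k) => // c; have [] := hpick c.
move=> phi vphi e e0.
have [r] : exists r : nat, 2 * r.+1%:R^-1 < e.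
  have [r _ hr] := near_infty_natSinv_lt (PosNum (divr_gt0 e0 (ltr0Sn R 1))).
  by exists r; have := hr r (leqnn r); rewrite /= ltr_pdivlMr// mulrC.
move=> hr; have r0 : 0 < r.+1%:R^-1 / 2 :> R by rewrite divr_gt0// invr_gt0 ltr0n.
have [cphi _ _] := vphi; have [n hn] := rcont_unif cphi r0.
have n0 : 0 < n.+1%:R :> R by rewrite ltr0n.
have /choice [q hq] : forall i : nat, exists q : rat, `|phi (i%:R / n.+1%:R) - ratr q| < r.+1%:R^-1 / 2.
  move=> i; have lt : phi (i%:R / n.+1%:R) - r.+1%:R^-1 / 2 < phi (i%:R / n.+1%:R) + r.+1%:R^-1 / 2.
    by rewrite ltrD2l gt0_cp.
  have [q] := rat_in_itvoo lt; rewrite in_itv /= => /andP[q1 q2].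
  by exists q; rewrite distrC ltr_norml ltrBrDl q1 ltrBlDl q2.
pose c := (n, r, [seq q i | i <- iota 0 n.+1]).
have cc : near_code c phi.
  split=> // s s01 i i_n si; have {}i_n : (i <= n)%N := i_n.
  have {}si : `|s - i%:R / n.+1%:R| <= n.+1%:R^-1 := si.
  have -> : nth 0%Q c.2 i = q i.
    by rewrite (nth_map 0%N) ?size_iota ?ltnS// nth_iota ?ltnS.
  rewrite -[c.1.2]/r.
  have i01 : 0 <= (i%:R / n.+1%:R : R) <= 1.
    by rewrite divr_ge0//= ler_pdivrMr// mul1r ler_nat leqW.
  have h1 := hn _ _ s01 i01 si.
  have -> : phi s - ratr (q i) = (phi s - phi (i%:R / n.+1%:R)) + (phi (i%:R / n.+1%:R) - ratr (q i)).
    by rewrite addrA subrK.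
  apply: le_trans (ler_normD _ _) _; rewrite [leRHS]splitr lerD// ltW//.
exists (pickle c) => s s01; rewrite pickleK.
have [_ /(_ (ex_intro _ _ cc)) [_ hc]] := hpick c.
have [_ hphi] := cc.
(* The last grid point is n / (n + 1); the minimum assigns s = 1 to it. *)
pose i := minn n (Num.truncn (s * n.+1%:R)).
have sn0 : 0 <= s * n.+1%:R by case/andP: s01 => s0 _; rewrite mulr_ge0.
have /andP[t1 t2] := truncn_itv sn0.
have i_n : (i <= n)%N by exact: geq_minl.
have si : `|s - i%:R / n.+1%:R| <= n.+1%:R^-1.
  have -> : s - i%:R / n.+1%:R = (s * n.+1%:R - i%:R) / n.+1%:R by rewrite mulrBl mulfK// gt_eqF.
  rewrite normrM [`|_^-1|]gtr0_norm ?invr_gt0// ler_pdivrMr// mulVf ?gt_eqF//.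
  have yn : s * n.+1%:R <= n.+1%:R by case/andP: s01 => _ s1; rewrite ler_piMl.
  rewrite /i; move: (s * _) yn t1 t2 => y; rewrite -!natr1 => yn t1 t2.
  rewrite ler_norml /minn; case: ltnP => [nt|tn]; last by apply/andP; split; lra.
  have : n%:R + 1 <= y by apply: le_trans t1; rewrite natr1 ler_nat.
  by move=> ny; apply/andP; split; lra.
have h1 := hphi s s01 i i_n si; have h2 := hc s s01 i i_n si.
have -> : phi s - pick c s = (phi s - ratr (nth 0%Q c.2 i)) - (pick c s - ratr (nth 0%Q c.2 i)).
  by rewrite opprB addrA subrK.
apply: le_trans (ler_normB _ _) _; apply: le_trans (lerD h1 h2) _.
by apply: le_trans (ltW hr); rewrite mulr_natl mulr2n.
Qed.

End ContinuityOnUnitInterval.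

Section MatrixContinuity.
Context {R : realType} {n : nat}.
Implicit Types (f : R -> 'M[R[i]]_n) (s t : R).

Lemma mx_rcont f : {within `[0, 1], continuous (f : R -> 'M[R[i]^o]_n)} ->
  forall i j, rcont (fun s => complex.Re (f s i j)) /\ rcont (fun s => complex.Im (f s i j)).
Proof.
move=> /subspace_continuousP h i j.
have key (s e : R) : 0 <= s <= 1 -> 0 < e -> exists2 d : R, 0 < d &
    forall t, 0 <= t <= 1 -> `|s - t| < d -> nr (f s i j - f t i j) < e.
  move=> s01 e0; have eC : 0 < e%:C :> R[i] by rewrite ltcR.
  have /(_ _ (nbhsx_ballx _ _ eC)) := h s (in01 s01).
  rewrite /= /within /= => /nbhs_ballP [d /= d0 hd]; exists d => // t t01 st.
  have [_ /(_ i j)] := hd t st (in01 t01).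
  by rewrite -ball_normE /ball_/= nrE ltcR.
split; apply: rcont_of => s s01 e e0; have [d d0 hd] := key s e s01 e0;
  exists d => // t t01 st; apply: le_lt_trans (hd t t01 st); rewrite -raddfB.
- exact: norm_Re_le_nr.
- exact: norm_Im_le_nr.
Qed.

Lemma rcont_mx f :
  (forall i j, rcont (fun s => complex.Re (f s i j)) /\ rcont (fun s => complex.Im (f s i j))) ->
  {within `[0, 1], continuous (f : R -> 'M[R[i]^o]_n)}.
Proof.
move=> h; apply/subspace_continuousP => s /=; rewrite in_itv /= => s01 W /nbhs_ballP [e /= /posC [r r0 ->]] sW.
have r2 : 0 < r / 2 by rewrite divr_gt0.
have key i j : \forall t \near within (`[0, 1]%classic : set R) (nbhs s), nr (f s i j - f t i j) < r.
  have [hRe hIm] := h i j.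
  have [d d0 hd] := rcontP hRe s01 r2; have [d' d'0 hd'] := rcontP hIm s01 r2.
  apply/nbhs_ballP; exists (Num.min d d') => /=; first by rewrite lt_min d0.
  move=> t; rewrite /ball/= lt_min => /andP[st st'] /=; rewrite in_itv /= => t01.
  apply: le_lt_trans (nr_le_ReIm _) _; rewrite [r]splitr !raddfB/=.
  by rewrite ltrD// ?hd// hd'.
have : \forall t \near within (`[0, 1]%classic : set R) (nbhs s), forall i j, nr (f s i j - f t i j) < r.
  by apply: filter_forall => i; apply: filter_forall => j; exact: key.
apply: filterS => t ht; apply: sW; split; first by rewrite ltcR.
by move=> i j; rewrite -ball_normE /ball_/= nrE ltcR.
Qed.

End MatrixContinuity.

Section TensorMatrices.
Context {R : realType} {p q : nat}.
Implicit Types (M : 'M[R[i]]_p) (N : 'M[R[i]]_q).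

Lemma tensmxDl M M' N : (M + M') *t N = M *t N + M' *t N.
Proof. by apply/matrixP => i j; rewrite !mxE mulrDl. Qed.
Lemma tensmxDr M N N' : M *t (N + N') = M *t N + M *t N'.
Proof. by apply/matrixP => i j; rewrite !mxE mulrDr. Qed.
Lemma tensmxZl (k : R[i]) M N : (k *: M) *t N = k *: (M *t N).
Proof. by apply/matrixP => i j; rewrite !mxE mulrA. Qed.
Lemma tensmxZr (k : R[i]) M N : M *t (k *: N) = k *: (M *t N).
Proof. by apply/matrixP => i j; rewrite !mxE mulrCA. Qed.
Lemma tensmx_suml (I : Type) (r : seq I) (F : I -> 'M[R[i]]_p) N :
  (\sum_(i <- r) F i) *t N = \sum_(i <- r) F i *t N.
Proof. by elim/big_rec2: _ => [|i u v _ <-]; rewrite ?tens0mx ?tensmxDl. Qed.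
Lemma tensmx_sumr (I : Type) (r : seq I) (F : I -> 'M[R[i]]_q) M :
  M *t (\sum_(i <- r) F i) = \sum_(i <- r) M *t F i.
Proof. by elim/big_rec2: _ => [|i u v _ <-]; rewrite ?tensmx0 ?tensmxDr. Qed.
Lemma tensmx11 : (1%:M : 'M[R[i]]_p) *t (1%:M : 'M[R[i]]_q) = 1%:M.
Proof.
apply/matrixP => i j; rewrite !mxE -natrM mulnb -(inj_eq (can_inj (@mxtens_unindexK p q))).
by rewrite -pair_eqE.
Qed.

Lemma tensmx1_inj M M' : (0 < q)%N ->
  M *t (1%:M : 'M[R[i]]_q) = M' *t (1%:M : 'M[R[i]]_q) -> M = M'.
Proof.
case: q => // q' _ /matrixP h; apply/matrixP => i j.
by have := h (mxtens_index (i, ord0)) (mxtens_index (j, ord0)); rewrite !tensmxE !mxE eqxx !mulr1.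
Qed.

Lemma tens1mx_inj N N' : (0 < p)%N ->
  (1%:M : 'M[R[i]]_p) *t N = (1%:M : 'M[R[i]]_p) *t N' -> N = N'.
Proof.
case: p => // p' _ /matrixP h; apply/matrixP => i j.
by have := h (mxtens_index (ord0, i)) (mxtens_index (ord0, j)); rewrite !tensmxE !mxE eqxx !mul1r.
Qed.

End TensorMatrices.

(* [m] is the image of the matrix units under a completely positive contractive
   order zero map, [h] that of its square root. *)
Definition order_zero (R : realType) (S : cstarAlgType R) (e : S) (n : nat)
    (m h : 'I_n -> 'I_n -> S) : Prop :=
  [/\ forall i j k, m i j = h i k ** h k j,
      forall i j, star (h i j) = h j i &
      forall k, exists2 c, star c = c & \sum_(j < n) h j k ** h k j + c ** c = e].

Section DimDrop.
Context {R : realType} {p q : nat} {S : cstarAlgType R}.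
Context (ev : S -> R -> 'M[R[i]]_(p * q)).
Hypothesis ev_fun : forall b, dim_drop_fun (ev b).
Hypothesis ev_surj : forall f, dim_drop_fun f ->
  exists b, forall s, 0 <= s <= 1 -> ev b s = f s.
Hypothesis ev_inj : forall b, (forall s, 0 <= s <= 1 -> ev b s = 0) -> b = 0.
Hypothesis ev_hom : forall s, 0 <= s <= 1 ->
  [/\ (forall (k : R[i]) a b, ev (k *: a + b) s = k *: ev a s + ev b s),
      (forall a b, ev (a ** b) s = ev a s *m ev b s) &
      (forall a, ev (star a) s = map_mx Num.conj (ev a s)^T)].
Local Notation MM := 'M[R[i]]_(p * q).
Implicit Types (phi psi : R -> R) (M : MM) (s : R).

Let le01 : 0 <= (0 : R) <= 1. Proof. by rewrite lexx ler01. Qed.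
Let le11 : 0 <= (1 : R) <= 1. Proof. by rewrite lexx ler01. Qed.

Lemma evM a b s : 0 <= s <= 1 -> ev (a ** b) s = ev a s *m ev b s.
Proof. by move=> /ev_hom []. Qed.
Lemma evS a s : 0 <= s <= 1 -> ev (star a) s = map_mx Num.conj (ev a s)^T.
Proof. by move=> /ev_hom []. Qed.
Lemma ev0 s : 0 <= s <= 1 -> ev 0 s = 0.
Proof.
move=> /ev_hom [h _ _]; have := h 1 0 0; rewrite !scale1r addr0 => e.
by apply/(@addrI _ (ev 0 s)); rewrite -e addr0.
Qed.
Lemma evD a b s : 0 <= s <= 1 -> ev (a + b) s = ev a s + ev b s.
Proof. by move=> /ev_hom [h _ _]; have := h 1 a b; rewrite !scale1r. Qed.
Lemma evZ (k : R[i]) a s : 0 <= s <= 1 -> ev (k *: a) s = k *: ev a s.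
Proof. by move=> s01; have [h _ _] := ev_hom s01; have := h k a 0; rewrite addr0 ev0// addr0. Qed.
Lemma ev_sum (I : Type) (r : seq I) (F : I -> S) s : 0 <= s <= 1 ->
  ev (\sum_(i <- r) F i) s = \sum_(i <- r) ev (F i) s.
Proof. by move=> s01; elim/big_rec2: _ => [|i u v _ <-]; rewrite ?ev0 ?evD. Qed.

Lemma ev_ext a b : (forall s, 0 <= s <= 1 -> ev a s = ev b s) -> a = b.
Proof.
move=> h; apply/eqP; rewrite -subr_eq0; apply/eqP/ev_inj => s s01.
by rewrite evD// -scaleN1r evZ// h// scaleN1r subrr.
Qed.

Definition el (f : R -> MM) : S := xget 0 [set b | forall s, 0 <= s <= 1 -> ev b s = f s].

Lemma elE f s : dim_drop_fun f -> 0 <= s <= 1 -> ev (el f) s = f s.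
Proof.
move=> hf; rewrite /el; case: xgetP => [b -> h|h]; first exact: h.
by have [b hb] := ev_surj hf; have := h b hb.
Qed.

(* The function phi M is a member when M is in the endpoint algebra wherever phi
   does not vanish. *)
Definition cel_ok phi M := [/\ rcont phi,
   (phi 0 = 0) \/ exists M1 : 'M[R[i]]_p, M = M1 *t (1%:M : 'M[R[i]]_q) &
   (phi 1 = 0) \/ exists N1 : 'M[R[i]]_q, M = (1%:M : 'M[R[i]]_p) *t N1].

Definition cel phi M : S := el (fun s => (phi s)%:C *: M).

Lemma cel_dim_drop phi M : cel_ok phi M -> dim_drop_fun (fun s => (phi s)%:C *: M).
Proof.
move=> [cphi h0 h1]; split.
- apply: rcont_mx => i j; split.
    have -> : (fun s => complex.Re (((phi s)%:C *: M) i j)) = (fun s => phi s * complex.Re (M i j)).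
      by apply/funext => s; rewrite mxE; case: (M i j) => a b /=; rewrite mul0r subr0.
    by apply: rcontM => //; exact: rcont_cst.
  have -> : (fun s => complex.Im (((phi s)%:C *: M) i j)) = (fun s => phi s * complex.Im (M i j)).
    by apply/funext => s; rewrite mxE; case: (M i j) => a b /=; rewrite mul0r addr0.
  by apply: rcontM => //; exact: rcont_cst.
- case: h0 => [->|[M1 ->]]; first by exists 0; rewrite scale0r tens0mx.
  by exists ((phi 0)%:C *: M1); rewrite tensmxZl.
- case: h1 => [->|[N1 ->]]; first by exists 0; rewrite scale0r tensmx0.
  by exists ((phi 1)%:C *: N1); rewrite tensmxZr.
Qed.

Lemma celE phi M s : cel_ok phi M -> 0 <= s <= 1 -> ev (cel phi M) s = (phi s)%:C *: M.
Proof. by move=> h s01; rewrite /cel elE//; exact: cel_dim_drop. Qed.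

Lemma cel_ok1 phi : rcont phi -> cel_ok phi 1%:M.
Proof. by move=> h; split => //; right; exists 1%:M; rewrite tensmx11. Qed.

Lemma cel_okl phi (M : 'M[R[i]]_p) : rcont phi -> phi 1 = 0 -> cel_ok phi (M *t (1%:M : 'M[R[i]]_q)).
Proof. by move=> h h1; split => //; [right; exists M|left]. Qed.

Lemma cel_okr phi (M : 'M[R[i]]_q) : rcont phi -> phi 0 = 0 -> cel_ok phi ((1%:M : 'M[R[i]]_p) *t M).
Proof. by move=> h h1; split => //; [left|right; exists M]. Qed.

Lemma cel_ok0 phi M : vanishing phi -> cel_ok phi M.
Proof. by move=> [h h0 h1]; split => //; left. Qed.

Lemma cel_star phi M : cel_ok phi M -> cel_ok phi (map_mx Num.conj M^T) ->
  star (cel phi M) = cel phi (map_mx Num.conj M^T).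
Proof.
move=> h h'; apply: ev_ext => s s01; rewrite evS// !celE//.
by apply/matrixP => i j; rewrite !mxE rmorphM /= conjR.
Qed.

Definition dd_unit : S := cel (fun=> 1) 1%:M.

Lemma dd_unitP : is_unit dd_unit.
Proof.
have h := cel_ok1 (@rcont_cst R 1).
by move=> x; split; apply: ev_ext => s s01; rewrite evM// celE// scale1r ?mul1mx ?mulmx1.
Qed.

Lemma conj_delta n (i j : 'I_n) : map_mx Num.conj (delta_mx i j : 'M[R[i]]_n)^T = delta_mx j i.
Proof. by rewrite trmx_delta map_delta_mx. Qed.

Lemma conj1 n : map_mx Num.conj (1%:M : 'M[R[i]]_n)^T = 1%:M.
Proof. by rewrite trmx1 map_mx1. Qed.

(* The common part of the two ends: E is the corner embedding M |-> M (x) 1 or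
   N |-> 1 (x) N, and phi vanishes at the other end. *)
Lemma dd_order_zero n (E : 'M[R[i]]_n -> MM) phi :
  (forall A B, E (A *m B) = E A *m E B) -> (forall A, map_mx Num.conj (E A)^T = E (map_mx Num.conj A^T)) ->
  (forall r (F : 'I_n -> 'M[R[i]]_n), \sum_(i <- r) E (F i) = E (\sum_(i <- r) F i)) ->
  E 1%:M = 1%:M ->
  rcont phi -> (forall s, 0 <= s <= 1 -> 0 <= phi s <= 1) ->
  (forall psi (M : 'M[R[i]]_n), rcont psi -> (phi 0 = 0 -> psi 0 = 0) -> (phi 1 = 0 -> psi 1 = 0) -> cel_ok psi (E M)) ->
  let m i j := cel (fun s => Num.sqrt (phi s)) (E (delta_mx i j)) in
  order_zero dd_unit m (fun i j => cel (fun s => Num.sqrt (Num.sqrt (phi s))) (E (delta_mx i j))) /\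
  \sum_(i < n) \sum_(j < n) m j i ** m i j = n%:R *: cel phi 1%:M.
Proof.
move=> EM Es Esum E1 cphi phi01 ok m.
have c1 := rcont_sqrt cphi; have c2 := rcont_sqrt c1.
have ok1 (M : 'M[R[i]]_n) : cel_ok (fun s => Num.sqrt (phi s)) (E M).
  by apply: ok => // ->; rewrite sqrtr0.
have ok2 (M : 'M[R[i]]_n) : cel_ok (fun s => Num.sqrt (Num.sqrt (phi s))) (E M).
  by apply: ok => // ->; rewrite !sqrtr0.
have hm i j k : cel (fun s => Num.sqrt (Num.sqrt (phi s))) (E (delta_mx i k)) **
     cel (fun s => Num.sqrt (Num.sqrt (phi s))) (E (delta_mx k j)) = m i j.
  apply: ev_ext => s s01; rewrite evM// !celE// -scalemxAl -scalemxAr scalerA -EM mul_delta_mx.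
  by rewrite -rmorphM/= -expr2 sqr_sqrtr ?sqrtr_ge0.
split.
  split => [i j k|i j|k]; first by rewrite hm.
    by rewrite cel_star ?Es ?conj_delta.
  (* The column sum of products of the h is the scalar function sqrt phi, so this c completes it to
     the unit. *)
  exists (cel (fun s => Num.sqrt (1 - Num.sqrt (phi s))) 1%:M).
    have okc := cel_ok1 (rcont_sqrt (rcontB (@rcont_cst R 1) c1)).
    by rewrite cel_star ?conj1.
  have okc := cel_ok1 (rcont_sqrt (rcontB (@rcont_cst R 1) c1)).
  apply: ev_ext => s s01; rewrite evD// ev_sum// evM// !celE//; last exact: cel_ok1 (@rcont_cst R 1).
  rewrite -scalemxAl -scalemxAr scalerA mulmx1 -rmorphM/= -expr2 sqr_sqrtr; last first.
    have /andP[p0 p1] := phi01 s s01.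
    by rewrite subr_ge0 -sqrtr1 ler_sqrt.
  under eq_bigr do rewrite hm celE//.
  by rewrite -scaler_sumr Esum -mx1_sum_delta E1 -scalerDl -rmorphD/= addrC subrK.
apply: ev_ext => s s01; rewrite evZ// ev_sum// celE; last 2 first.
- exact: cel_ok1.
- by [].
under eq_bigr => i _ do [rewrite ev_sum//; under eq_bigr do rewrite evM// !celE// -scalemxAl -scalemxAr scalerA -EM mul_delta_mx -rmorphM/= -expr2].
have /andP[p0 p1] := phi01 s s01.
rewrite sqr_sqrtr//.
under eq_bigr do rewrite -scaler_sumr Esum -mx1_sum_delta E1.
by rewrite big_const_ord iter_addr addr0 scaler_nat.
Qed.

Let pl (M : 'M[R[i]]_p) : MM := M *t (1%:M : 'M[R[i]]_q).
Let pr (N : 'M[R[i]]_q) : MM := (1%:M : 'M[R[i]]_p) *t N.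

(** M_p (x) 1 is allowed away from the end 1 and 1 (x) M_q away from the end 0. The weights 1 - s
    and s vanish where they must and add up to 1, so the two order zero families together decompose
    the unit. *)
Lemma dd_frames : (0 < p)%N -> (0 < q)%N ->
  exists (m h : 'I_p -> 'I_p -> S) (m' h' : 'I_q -> 'I_q -> S),
  [/\ order_zero dd_unit m h, order_zero dd_unit m' h' &
    p%:R^-1 *: (\sum_i \sum_j m j i ** m i j) + q%:R^-1 *: (\sum_i \sum_j m' j i ** m' i j) = dd_unit].
Proof.
move=> p0 q0.
have c1 : rcont (fun s : R => 1 - s) by apply: rcontB; [exact: rcont_cst|exact: rcont_id].
have c2 : rcont (fun s : R => s) by exact: rcont_id.
have [||||||| o1 s1] := @dd_order_zero p pl (fun s => 1 - s); last 1 first.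
have [||||||| o2 s2] := @dd_order_zero q pr (fun s => s); last 1 first.
- do 4 eexists; split; [exact: o1|exact: o2|].
  rewrite s1 s2 !scalerA !mulVf ?pnatr_eq0 -?lt0n// !scale1r.
  apply: ev_ext => s s01; rewrite evD// !celE//; try exact: cel_ok1.
    by rewrite -scalerDl -rmorphD/= subrK.
  exact: cel_ok1 (@rcont_cst R 1).
- by move=> A B; rewrite /pr tensmx_mul mul1mx.
- by move=> A; rewrite /pr trmx_tens map_mxT conj1.
- by move=> r F; rewrite /pr tensmx_sumr.
- by rewrite /pr tensmx11.
- exact: c2.
- by [].
- by move=> psi M cpsi h _; apply: cel_okr => //; exact: h.
- by move=> A B; rewrite /pl tensmx_mul mul1mx.
- by move=> A; rewrite /pl trmx_tens map_mxT conj1.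
- by move=> r F; rewrite /pl tensmx_suml.
- by rewrite /pl tensmx11.
- exact: c1.
- by move=> s /andP[? ?]; apply/andP; split; lra.
- by move=> psi M cpsi _ h; apply: cel_okl => //; apply: h; rewrite subrr.
Qed.

End DimDrop.

Section Units.
Context {R : realType} {A : cstarAlgType R} {e : A} (he : is_unit e).

Lemma unit_star : star e = e.
Proof.
have h : e ** star e = star e by case: (he (star e)).
by move: (congr1 star h); rewrite starM !starK h.
Qed.

Lemma nr_unit_le1 : nr e <= 1.
Proof.
have : nr e ^+ 2 = nr e by rewrite -nr_star_cmul unit_star (proj1 (he e)).
have := nr_ge0 e; move: (nr e) => t t0 tt; rewrite leNgt; apply/negP => t1.
have : t < t ^+ 2 by rewrite expr2 ltr_pMl// (lt_trans ltr01).
by rewrite tt ltxx.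
Qed.
End Units.

Lemma unit_uniq (R : realType) (A : cstarAlgType R) (e e' : A) : is_unit e -> is_unit e' -> e = e'.
Proof. by move=> h h'; rewrite -[LHS](proj2 (h' e)) (proj1 (h e')). Qed.

Section StarHomLinear.
Context {R : realType} {A B : cstarAlgType R} (f : A -> B) (hf : star_hom f).
Lemma shD a b : f (a + b) = f a + f b.
Proof. by case: hf => l _ _; have := l 1 a b; rewrite !scale1r. Qed.
Lemma sh0 : f 0 = 0.
Proof. by apply/(@addrI _ (f 0)); rewrite -shD !addr0. Qed.
Lemma shZ (k : R[i]) a : f (k *: a) = k *: f a.
Proof. by case: hf => l _ _; have := l k a 0; rewrite sh0 !addr0. Qed.
Lemma shB a b : f (a - b) = f a - f b.
Proof. by rewrite shD -scaleN1r shZ scaleN1r. Qed.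
Lemma shM a b : f (a ** b) = f a ** f b. Proof. by case: hf. Qed.
Lemma shS a : f (star a) = star (f a). Proof. by case: hf. Qed.
Lemma sh_sum (I : Type) (r : seq I) (F : I -> A) :
  f (\sum_(i <- r) F i) = \sum_(i <- r) f (F i).
Proof. by elim/big_rec2: _ => [|i u v _ <-]; rewrite ?sh0 ?shD. Qed.
End StarHomLinear.

Lemma star_hom_comp (R : realType) (A B C : cstarAlgType R) (f : A -> B) (g : B -> C) :
  star_hom f -> star_hom g -> star_hom (g \o f).
Proof.
move=> hf hg; split => [k x y|x y|x] /=.
- by rewrite (shD hf) (shZ hf) (shD hg) (shZ hg).
- by rewrite (shM hf) (shM hg).
- by rewrite (shS hf) (shS hg).
Qed.

Lemma nr_sh_sqr (R : realType) (A : cstarAlgType R) (H : hilbertType R) (f : A -> bop H)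
    (a : A) (x : H) : star_hom f -> nr (f a x) ^+ 2 = complex.Re (dot (f (star a ** a) x) x).
Proof. by move=> hf; rewrite (shM hf) (shS hf) bopME -[star _]/(adj _) adjE' Re_dot. Qed.

(** * Countable generation of dimension drop algebras *)

Section DimDropGenerated.
Context {R : realType} {p q : nat} {S : cstarAlgType R}.
Context (ev : S -> R -> 'M[R[i]]_(p * q)).
Hypothesis ev_fun : forall b, dim_drop_fun (ev b).
Hypothesis ev_surj : forall f, dim_drop_fun f ->
  exists b, forall s, 0 <= s <= 1 -> ev b s = f s.
Hypothesis ev_inj : forall b, (forall s, 0 <= s <= 1 -> ev b s = 0) -> b = 0.
Hypothesis ev_hom : forall s, 0 <= s <= 1 ->
  [/\ (forall (k : R[i]) a b, ev (k *: a + b) s = k *: ev a s + ev b s),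
      (forall a b, ev (a ** b) s = ev a s *m ev b s) &
      (forall a, ev (star a) s = map_mx Num.conj (ev a s)^T)].
Local Notation MM := 'M[R[i]]_(p * q).
Local Notation cel := (cel ev).
Local Notation dd_unit := (dd_unit ev).
Implicit Types (phi psi : R -> R) (M : MM) (s : R).

(* D is a matrix unit times phi with |phi| <= c; then D^* D + C^2 = c^2 for the
   self-adjoint C = c - (c - sqrt (c^2 - phi^2)) E_jj. *)
Lemma dd_corner_bound (H : hilbertType R) (f : S -> bop H) phi (c : R) i j : star_hom f ->
  vanishing phi -> 0 <= c -> (forall s, 0 <= s <= 1 -> `|phi s| <= c) ->
  nr (f (cel phi (delta_mx i j))) <= c.
Proof.
move=> hf vphi c0 hc; have [cphi phi0 phi1] := vphi.
pose psi s := Num.sqrt (c ^+ 2 - phi s * phi s) - c.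
have vpsi : vanishing psi.
  split; rewrite /psi ?phi0 ?phi1 ?mulr0 ?subr0 ?sqrtr_sqr ?ger0_norm ?subrr//.
  apply: rcontB; last exact: rcont_cst.
  by apply/rcont_sqrt/rcontB; [exact: rcont_cst|exact: rcontM].
pose D := cel phi (delta_mx i j); pose C := c%:C *: dd_unit + cel psi (delta_mx j j).
have okD := cel_ok0 (delta_mx i j : MM) vphi.
have okP := cel_ok0 (delta_mx j j : MM) vpsi.
have ok1 := @cel_ok1 R p q _ (@rcont_cst R 1).
have e1 : star D ** D + star C ** C = (c ^+ 2)%:C *: dd_unit.
  apply: (ev_ext ev_inj ev_hom) => s s01.
  rewrite (evD ev_hom)// !(evM ev_hom)// !(evS ev_hom)// (evD ev_hom)// !(evZ ev_hom)//.
  rewrite !(celE ev_surj)// scale1r.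
  have -> : map_mx Num.conj ((phi s)%:C *: (delta_mx i j : MM))^T = (phi s)%:C *: delta_mx j i.
    by apply/matrixP => a b; rewrite !mxE rmorphM /= conjR rmorph_nat andbC.
  have -> (r r' : R) : map_mx Num.conj (r%:C *: 1%:M + r'%:C *: (delta_mx j j : MM))^T =
      r%:C *: 1%:M + r'%:C *: delta_mx j j.
    by apply/matrixP => a b; rewrite !mxE rmorphD !rmorphM /= !conjR [b == a]eq_sym !rmorph_nat andbC.
  rewrite -scalemxAl -scalemxAr mul_delta_mx scalerA.
  rewrite mulmxDl !mulmxDr -!scalemxAl -!scalemxAr !mul1mx mulmx1 mul_delta_mx !scalerA.
  rewrite addrCA -addrA -rmorphM -expr2 -[RHS]addr0; congr (_ + _).
  have p2 : phi s * phi s <= c ^+ 2.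
    by rewrite -expr2 -[phi s ^+ 2]real_normK ?num_real// lerXn2r ?nnegrE// hc.
  have e0 : phi s * phi s + (c * psi s + (psi s * c + psi s * psi s)) = 0.
    have : (psi s + c) ^+ 2 = c ^+ 2 - phi s * phi s by rewrite /psi subrK sqr_sqrtr// subr_ge0.
    rewrite sqrrD => h; rewrite -[0](subrr (c ^+ 2 - phi s * phi s)) -{1}h; ring.
  rewrite addrCA -!scalerDl; move: (psi s) (phi s) e0 => u v e0.
  by rewrite -!rmorphM -!rmorphD /= e0 scale0r.
apply: opn_le => // x; rewrite -/D.
rewrite -(@ler_pXn2r _ 2)// ?nnegrE ?mulr_ge0 ?nr_ge0//.
have h1 := nr_sh_sqr D x hf; have h2 := nr_sh_sqr C x hf.
have : nr (f D x) ^+ 2 + nr (f C x) ^+ 2 = complex.Re (dot (f ((c ^+ 2)%:C *: dd_unit) x) x).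
  by rewrite h1 h2 -raddfD /= -dotDl -bopDE -(shD hf) e1.
have h3 : complex.Re (dot (f ((c ^+ 2)%:C *: dd_unit) x) x) <= c ^+ 2 * nr x ^+ 2.
  rewrite (shZ hf) bopZE dotZl; apply: le_trans (Re_le_nr _) _.
  rewrite nrM nrR ger0_norm ?sqr_ge0// ler_wpM2l ?sqr_ge0//.
  apply: le_trans (cauchy_schwarz _ _) _; rewrite expr2 ler_wpM2r ?nr_ge0//.
  apply: le_trans (bop_le _ _) _; rewrite -[leRHS]mul1r ler_wpM2r ?nr_ge0//.
  apply: le_trans (star_hom_le hf _) (nr_unit_le1 _).
  exact: (dd_unitP ev_surj ev_inj ev_hom).
by have := sqr_ge0 (nr (f C x)); rewrite exprMn; lra.
Qed.

(** Separability, phrased through representations because distances in S are known only via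
    [dd_corner_bound]. An element is the affine interpolation of its two end values, which costs
    finitely many generators, plus a function vanishing at both ends, whose entries are approximated
    from the countable family of [vanishing_separable]. *)
Lemma dd_generated : exists x : nat -> S,
  forall (H : hilbertType R) (f : S -> bop H), star_hom f -> forall T : bop H -> Prop,
  closed (T : set (bop H)) -> T 0 -> (forall (k : R[i]) U V, T U -> T V -> T (k *: U + V)) ->
  (forall k, T (f (x k))) -> forall b, T (f b).
Proof.
have [beta [vbeta hbeta]] := @vanishing_separable R.
have c1 : rcont (fun s : R => 1 - s) by apply: rcontB; [exact: rcont_cst|exact: rcont_id].
have c2 : rcont (fun s : R => s) by exact: rcont_id.
pose P (i j : 'I_p) := cel (fun s => 1 - s) (delta_mx i j *t (1%:M : 'M[R[i]]_q)).
pose Q (i j : 'I_q) := cel id ((1%:M : 'M[R[i]]_p) *t delta_mx i j).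
pose code := ((('I_p * 'I_p) + ('I_q * 'I_q)) + ('I_(p * q) * 'I_(p * q) * nat))%type.
pose xc (c : code) := match c with
  | inl (inl ij) => P ij.1 ij.2
  | inl (inr ij) => Q ij.1 ij.2
  | inr ijk => cel (beta ijk.2) (delta_mx ijk.1.1 ijk.1.2)
  end.
exists (fun k => if unpickle k is Some c then xc c else 0).
move=> H f hf T cT T0 Tlin hT b.
have TZ (k : R[i]) U : T U -> T (k *: U) by move=> TU; rewrite -[_ *: _]addr0; exact: Tlin.
have TD U V : T U -> T V -> T (U + V) by move=> TU TV; rewrite -[U]scale1r; exact: Tlin.
have Tsum (I : Type) (r : seq I) (F : I -> bop H) : (forall i, T (F i)) -> T (\sum_(i <- r) F i).
  by move=> h; elim/big_rec: _ => // i U _; exact: TD.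
have Tx c : T (f (xc c)) by have := hT (pickle c); rewrite pickleK.
have TP i j : T (f (P i j)) by exact: (Tx (inl (inl (i, j)))).
have TQ i j : T (f (Q i j)) by exact: (Tx (inl (inr (i, j)))).
have TE i j phi : vanishing phi -> T (f (cel phi (delta_mx i j))).
  move=> vphi; apply: (iffLR (closed_nr (T : set (bop H))) cT) => e e0.
  have [k hk] := hbeta _ vphi _ (divr_gt0 e0 (ltr0Sn _ 1)).
  exists (f (cel (beta k) (delta_mx i j))); first exact: (Tx (inr (i, j, k))).
  have vd : vanishing (fun s => phi s - beta k s).
    have [? a0 a1] := vphi; have [? b0 b1] := vbeta k.
    by split; rewrite ?a0 ?a1 ?b0 ?b1 ?subrr//; exact: rcontB.
  have -> : f (cel phi (delta_mx i j)) - f (cel (beta k) (delta_mx i j)) =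
      f (cel (fun s => phi s - beta k s) (delta_mx i j)).
    rewrite -(shB hf); congr f; apply: (ev_ext ev_inj ev_hom) => s s01.
    rewrite (evD ev_hom)// -scaleN1r (evZ ev_hom)// !(celE ev_surj)//; try exact: cel_ok0.
    by rewrite scaleN1r -scalerBl -rmorphB.
  apply: (@le_lt_trans _ _ (e / 2)); last by rewrite ltr_pdivrMr// mulr_natr mulr2n ltrDl.
  by apply: dd_corner_bound => //; rewrite ltW// divr_gt0.
have [cb [M0 eM0] [N1 eN1]] := ev_fun b.
pose W s : MM := (1 - s)%:C *: (M0 *t (1%:M : 'M[R[i]]_q)) + s%:C *: ((1%:M : 'M[R[i]]_p) *t N1).
have ReZ (r : R) (z : R[i]) : complex.Re (r%:C * z) = r * complex.Re z.
  by case: z => a1 a2 /=; rewrite mul0r subr0.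
have ImZ (r : R) (z : R[i]) : complex.Im (r%:C * z) = r * complex.Im z.
  by case: z => a1 a2 /=; rewrite mul0r addr0.
have vanRe i j : vanishing (fun s => complex.Re (ev b s i j) - complex.Re (W s i j)).
  split; last 2 first.
  - by rewrite /W subr0 scale1r scale0r addr0 -eM0 subrr.
  - by rewrite /W subrr scale1r scale0r add0r -eN1 subrr.
  apply: rcontB; first by have [] := mx_rcont cb i j.
  have -> : (fun s => complex.Re (W s i j)) = (fun s => (1 - s) * complex.Re ((M0 *t (1%:M : 'M[R[i]]_q)) i j) +
      s * complex.Re (((1%:M : 'M[R[i]]_p) *t N1) i j)).
    by apply/funext => s; rewrite /W mxE -[LHS]/(complex.Re (_ + _)) raddfD; congr (_ + _); rewrite [in LHS]mxE; exact: ReZ.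
  by apply: rcontD; apply: rcontM => //; exact: rcont_cst.
have vanIm i j : vanishing (fun s => complex.Im (ev b s i j) - complex.Im (W s i j)).
  split; last 2 first.
  - by rewrite /W subr0 scale1r scale0r addr0 -eM0 subrr.
  - by rewrite /W subrr scale1r scale0r add0r -eN1 subrr.
  apply: rcontB; first by have [] := mx_rcont cb i j.
  have -> : (fun s => complex.Im (W s i j)) = (fun s => (1 - s) * complex.Im ((M0 *t (1%:M : 'M[R[i]]_q)) i j) +
      s * complex.Im (((1%:M : 'M[R[i]]_p) *t N1) i j)).
    by apply/funext => s; rewrite /W mxE -[LHS]/(complex.Im (_ + _)) raddfD; congr (_ + _); rewrite [in LHS]mxE; exact: ImZ.
  by apply: rcontD; apply: rcontM => //; exact: rcont_cst.
have -> : b = (\sum_i \sum_j M0 i j *: P i j) + (\sum_i \sum_j N1 i j *: Q i j) +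
   \sum_i \sum_j (cel (fun s => complex.Re (ev b s i j) - complex.Re (W s i j)) (delta_mx i j) +
     'i%C *: cel (fun s => complex.Im (ev b s i j) - complex.Im (W s i j)) (delta_mx i j)).
  apply: (ev_ext ev_inj ev_hom) => s s01.
  rewrite !(evD ev_hom)// !(ev_sum ev_hom)//.
  have -> : \sum_i ev (\sum_j M0 i j *: P i j) s = (1 - s)%:C *: (M0 *t (1%:M : 'M[R[i]]_q)).
    rewrite {2}[M0]matrix_sum_delta tensmx_suml scaler_sumr; apply: eq_bigr => i _.
    rewrite (ev_sum ev_hom)// tensmx_suml scaler_sumr; apply: eq_bigr => j _.
    rewrite (evZ ev_hom)// (celE ev_surj)//; last by apply: cel_okl => //; rewrite subrr.
    by rewrite tensmxZl !scalerA mulrC.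
  have -> : \sum_i ev (\sum_j N1 i j *: Q i j) s = s%:C *: ((1%:M : 'M[R[i]]_p) *t N1).
    rewrite {2}[N1]matrix_sum_delta tensmx_sumr scaler_sumr; apply: eq_bigr => i _.
    rewrite (ev_sum ev_hom)// tensmx_sumr scaler_sumr; apply: eq_bigr => j _.
    rewrite (evZ ev_hom)// (celE ev_surj)//; last exact: cel_okr.
    by rewrite tensmxZr !scalerA mulrC.
  rewrite -/(W s) -[LHS](subrK (W s)) addrC; congr (_ + _).
  rewrite [LHS]matrix_sum_delta; apply: eq_bigr => i _.
  rewrite (ev_sum ev_hom)//; apply: eq_bigr => j _.
  rewrite (evD ev_hom)// (evZ ev_hom)// !(celE ev_surj)//; try exact: cel_ok0.
  rewrite scalerA -scalerDl; congr (_ *: _).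
  by rewrite !mxE -!raddfB/= [LHS]complexE.
rewrite !(shD hf) !(sh_sum hf); apply: (TD); first apply: (TD).
- by apply: (Tsum) => i; rewrite (sh_sum hf); apply: (Tsum) => j; rewrite (shZ hf); exact: TZ.
- by apply: (Tsum) => i; rewrite (sh_sum hf); apply: (Tsum) => j; rewrite (shZ hf); exact: TZ.
apply: (Tsum) => i; rewrite (sh_sum hf); apply: (Tsum) => j; rewrite (shD hf) (shZ hf).
by apply: (TD); [exact: TE|apply: (TZ); exact: TE].
Qed.

End DimDropGenerated.

(** * The Jiang-Su algebra has large matrix sizes *)

Section MatrixOperators.
Context {R : realType}.

Section RankOne.
Context {H : hilbertType R} (v u : H).

Lemma rank1_adjointable : adjointable (fun x : H => dot x u *: v).
Proof.
split.
- by move=> k x y; rewrite dotDl dotZl scalerDl scalerA.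
- exists (nr v * nr u) => x; rewrite nrZ mulrC -mulrA ler_wpM2l ?nr_ge0// [nr u * _]mulrC.
  exact: cauchy_schwarz.
- exists (fun y => dot y v *: u) => x y.
  by rewrite dotZl dotZr -dotC mulrC.
Qed.
Definition rank1 : bop H := Bop rank1_adjointable.
End RankOne.

Context {n : nat}.
Implicit Types (M N : 'M[R[i]]_n) (x : l2 R 'I_n).

Definition mxop M : bop (l2 R 'I_n) := \sum_i \sum_j M i j *: rank1 (delta i) (delta j).

Lemma mxopE M x i : mxop M x i = \sum_j M i j * x j.
Proof.
rewrite /mxop bop_sumE l2_sumE (bigD1 i)//= [X in _ + X]big1 ?addr0 => [|k ki].
  rewrite bop_sumE l2_sumE; apply: eq_bigr => j _.
  by rewrite /= dot_delta eqxx mulr1.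
rewrite bop_sumE l2_sumE big1// => j _.
by rewrite /= eq_sym (negbTE ki) !mulr0.
Qed.

Lemma mxop_deltaE M i j : mxop M (delta j) i = M i j.
Proof.
rewrite mxopE (bigD1 j)//= eqxx mulr1 big1 ?addr0// => k kj.
by rewrite (negbTE kj) mulr0.
Qed.

Lemma mxop_lin (k : R[i]) M N : mxop (k *: M + N) = k *: mxop M + mxop N.
Proof.
apply: bop_delta_ext => j; apply: l2_ext => i.
by rewrite mxop_deltaE bopDE bopZE l2DE l2ZE !mxop_deltaE !mxE.
Qed.

Lemma mxopM M N : mxop (M *m N) = mxop M ** mxop N.
Proof.
apply: bop_delta_ext => j; apply: l2_ext => i.
rewrite mxop_deltaE bopME mxopE mxE.
by apply: eq_bigr => k _; rewrite mxop_deltaE.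
Qed.

Lemma mxopS M : mxop (map_mx Num.conj M^T) = star (mxop M).
Proof.
apply: bop_delta_ext => j; apply: l2_ext => i; rewrite mxop_deltaE -[RHS]dot_delta.
by rewrite -[star _]/(adj _) adjE' dotC dot_delta mxop_deltaE !mxE.
Qed.

Lemma nr_mxop M i j : nr (M i j) <= nr (mxop M).
Proof.
rewrite -mxop_deltaE; apply: le_trans (nr_coef _ _) _.
by apply: le_trans (bop_le _ _) _; rewrite nr_delta mulr1 opnE.
Qed.

End MatrixOperators.

(** The clause on units is what keeps limits of such representations nonzero. *)
Definition mx_rep (R : realType) (S : cstarAlgType R) (n : nat) (E : S -> 'M[R[i]]_n) : Prop :=
  [/\ linear E, {morph E : a b / a ** b >-> a *m b},
      (forall a, E (star a) = map_mx Num.conj (E a)^T) &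
      forall e, is_unit e -> E e = 1%:M].

Lemma mx_rep_star_hom (R : realType) (S : cstarAlgType R) (n : nat) (E : S -> 'M[R[i]]_n) :
  mx_rep E -> star_hom (fun a => mxop (E a)).
Proof.
move=> [l m s _]; split => [k a b|a b|a].
- by rewrite l mxop_lin.
- by rewrite m mxopM.
- by rewrite s mxopS.
Qed.

Lemma mx_rep_le (R : realType) (S : cstarAlgType R) (n : nat) (E : S -> 'M[R[i]]_n) a i j :
  mx_rep E -> nr (E a i j) <= nr a.
Proof. by move=> /mx_rep_star_hom h; apply: le_trans (nr_mxop _ _ _) (star_hom_le h a). Qed.

(** The value at an end has a trivial tensor factor; deleting it leaves unital representations of
    sizes p and q. *)
Lemma dd_endpoints (R : realType) (p q : nat) (S : cstarAlgType R) : prime_dim_drop p q S ->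
  (exists E : S -> 'M[R[i]]_p, mx_rep E) /\ (exists E : S -> 'M[R[i]]_q, mx_rep E).
Proof.
move=> [[p0 q0 _] [ev [evf evs evi evh]]].
have le01 : 0 <= (0 : R) <= 1 by rewrite lexx ler01.
have le11 : 0 <= (1 : R) <= 1 by rewrite lexx ler01.
have u1 e s : is_unit e -> 0 <= s <= 1 -> ev e s = 1%:M.
  move=> he s01; rewrite (unit_uniq he (dd_unitP evs evi evh)) (celE evs)// ?scale1r//.
  exact: cel_ok1 (@rcont_cst R 1).
have [h0l h0m h0s] := evh 0 le01; have [h1l h1m h1s] := evh 1 le11.
split.
- have /(_ _)/cid hE b : exists M : 'M[R[i]]_p, ev b 0 = M *t (1%:M : 'M[R[i]]_q) by have [] := evf b.
  pose E b := sval (hE b); have EP b : ev b 0 = E b *t (1%:M : 'M[R[i]]_q) := svalP (hE b).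
  exists E; split => [k a b|a b|a|e he]; apply: (tensmx1_inj q0); rewrite -EP.
  + by rewrite h0l tensmxDl tensmxZl -!EP.
  + by rewrite h0m !EP tensmx_mul mulmx1.
  + by rewrite h0s EP trmx_tens map_mxT trmx1 map_mx1.
  + by rewrite u1// tensmx11.
- have /(_ _)/cid hE b : exists M : 'M[R[i]]_q, ev b 1 = (1%:M : 'M[R[i]]_p) *t M by have [] := evf b.
  pose E b := sval (hE b); have EP b : ev b 1 = (1%:M : 'M[R[i]]_p) *t E b := svalP (hE b).
  exists E; split => [k a b|a b|a|e he]; apply: (tens1mx_inj p0); rewrite -EP.
  + by rewrite h1l tensmxDr tensmxZr -!EP.
  + by rewrite h1m !EP tensmx_mul mulmx1.
  + by rewrite h1s EP trmx_tens map_mxT trmx1 map_mx1.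
  + by rewrite u1// tensmx11.
Qed.

(** * Limits of bounded sequences along an ultrafilter *)

Section UltraLimits.
Context {R : realType} (U : set_system nat) {UU : UltraFilter U}.
Implicit Types (u v : nat -> R[i]) (l m : R[i]).

Lemma ultra_meet (A B : set nat) : U A -> U B -> exists n, A n /\ B n.
Proof. by move=> hA hB; apply: (@filter_ex _ U _ (A `&` B)); exact: filterI. Qed.

Definition ulim u l := forall e : R, 0 < e -> U [set n | nr (u n - l) < e].

Lemma ulim_uniq u l l' : ulim u l -> ulim u l' -> l = l'.
Proof.
move=> h h'; apply/eqP; rewrite -subr_eq0 -nr_eq0; apply/eqP/le_anti; rewrite nr_ge0 andbT.
apply/ler_addgt0Pr => e e0; rewrite add0r.
have e2 : 0 < e / 2 by rewrite divr_gt0.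
have [n [/= h1 h2]] := ultra_meet (h _ e2) (h' _ e2).
by apply: le_trans (nr_tri (u n) _ _) _; rewrite [e]splitr lerD// ltW// nrC.
Qed.

Lemma ulim_near u v l : U [set n | u n = v n] -> ulim u l -> ulim v l.
Proof.
move=> h hl e e0; apply: filterS2 h (hl e e0) => n /= ->; by [].
Qed.

Lemma ulim_cst l : ulim (fun=> l) l.
Proof. by move=> e e0; apply: filterE => n /=; rewrite subrr nr0. Qed.

Lemma ulimD u v l m : ulim u l -> ulim v m -> ulim (fun n => u n + v n) (l + m).
Proof.
move=> h h' e e0; have e2 : 0 < e / 2 by rewrite divr_gt0.
apply: filterS2 (h _ e2) (h' _ e2) => n /= h1 h2.
by rewrite opprD addrACA; apply: le_lt_trans (nrD _ _) _; rewrite [e]splitr ltrD.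
Qed.

Lemma ulimM u v l m : ulim u l -> ulim v m -> ulim (fun n => u n * v n) (l * m).
Proof.
move=> h h' e e0.
have c0 : 0 < nr l + 1 + nr m by rewrite ltr_wpDr ?nr_ge0// ltr_wpDl ?nr_ge0.
have e2 : 0 < e / (nr l + 1 + nr m) by rewrite divr_gt0.
apply: filterS3 (h _ ltr01) (h _ e2) (h' _ e2) => n /= h0 h1 h2.
have -> : u n * v n - l * m = u n * (v n - m) + m * (u n - l) by ring.
apply: le_lt_trans (nrD _ _) _; rewrite !nrM.
have hu : nr (u n) <= nr l + 1.
  by rewrite -[u n](subrK l) (le_trans (nrD _ _))// addrC lerD2l ltW.
rewrite -[e](divfK (lt0r_neq0 c0)) mulrDr; apply: ltr_leD.
  rewrite mulrC; apply: (@le_lt_trans _ _ (nr (v n - m) * (nr l + 1))).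
    by rewrite ler_wpM2l ?nr_ge0.
  by rewrite ltr_pM2r// ltr_wpDl ?nr_ge0.
by rewrite mulrC ler_wpM2r ?nr_ge0// ltW.
Qed.

Lemma ulim_sum (I : Type) (r : seq I) (F : I -> nat -> R[i]) (L : I -> R[i]) :
  (forall i, ulim (F i) (L i)) -> ulim (fun n => \sum_(i <- r) F i n) (\sum_(i <- r) L i).
Proof.
move=> h; elim: r => [|i r IH].
  by rewrite big_nil; under eq_fun do rewrite big_nil; exact: ulim_cst.
by rewrite big_cons; under eq_fun do rewrite big_cons; exact: ulimD.
Qed.

Lemma ulim_conj u l : ulim u l -> ulim (fun n => Num.conj (u n)) (Num.conj l).
Proof.
by move=> h e e0; apply: filterS (h e e0) => n /=; rewrite -rmorphB nr_conj.
Qed.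

(** The limit is the supremum of the x that lie below v on a large set; slightly above it the
    ultrafilter decides for the complement. *)
Lemma ultra_real (v : nat -> R) (C : R) : U [set n | `|v n| <= C] ->
  exists l : R, forall e : R, 0 < e -> U [set n | `|v n - l| < e].
Proof.
move=> hC; pose T := [set x : R | U [set n | x <= v n]].
have supT : has_sup T.
  split; first by exists (- C); apply: filterS hC => n /=; rewrite ler_norml => /andP[].
  exists C => x /(ultra_meet hC) [n [/= h1 h2]].
  by apply: le_trans h2 _; move: h1; rewrite ler_norml => /andP[].
exists (sup T) => e e0.
have [x Tx hx] := sup_adherent e0 supT.
have nT : ~ T (sup T + e / 2).
  move=> /(ub_le_sup (proj2 supT)); rewrite gerDl leNgt divr_gt0//.
have [//|hc] := in_ultra_setVsetC [set n | sup T + e / 2 <= v n] UU.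
apply: filterS2 Tx hc => n /= h1 /negP; rewrite -ltNge => h2.
rewrite ltr_norml; apply/andP; split; first by rewrite ltrBrDl; apply: lt_le_trans h1.
rewrite ltrBlDl; apply: lt_trans h2 _; rewrite ltrD2l ltr_pdivrMr//.
by rewrite mulr_natr mulr2n ltrDl.
Qed.

Lemma ulim_ex u (C : R) : U [set n | nr (u n) <= C] -> exists l, ulim u l.
Proof.
move=> h.
have [|a ha] := @ultra_real (fun n => complex.Re (u n)) C.
  by apply: filterS h => n /=; apply: le_trans; exact: norm_Re_le_nr.
have [|b hb] := @ultra_real (fun n => complex.Im (u n)) C.
  by apply: filterS h => n /=; apply: le_trans; exact: norm_Im_le_nr.
exists (a +i* b)%C => e e0; have e2 : 0 < e / 2 by rewrite divr_gt0.
apply: filterS2 (ha _ e2) (hb _ e2) => n /= h1 h2.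
by apply: le_lt_trans (nr_le_ReIm _) _; rewrite !raddfB/= [e]splitr ltrD.
Qed.

Definition ul u : R[i] := xget 0 [set l | ulim u l].

Lemma ulP u (C : R) : U [set n | nr (u n) <= C] -> ulim u (ul u).
Proof. by move=> /ulim_ex [l hl]; rewrite /ul; case: xgetP => // h; have := h l hl. Qed.

End UltraLimits.

(** * Ultralimits of representations of a sequence of algebras *)

Section LimitRepresentation.
Context {R : realType} {S : nat -> cstarAlgType R} {phi : forall n, S n -> S n.+1}.
Context {k : nat} (E : forall n, S n -> 'M[R[i]]_k) (U : set_system nat) {UU : UltraFilter U}.
Hypothesis phi_hom : forall n, star_hom (@phi n).
Hypothesis phi_unit : forall n (e : S n), is_unit e -> is_unit (phi e).
Hypothesis Utail : forall m, U [set n | (m <= n)%N].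
Hypothesis Ugood : U [set n | mx_rep (@E n)].

(** [pull d] moves an element d steps along the sequence and then applies E. Recursion on d with m
    generalized avoids casts between [S (d.+1 + m)] and [S (d + m.+1)]. *)
Fixpoint pull d : forall m, S m -> 'M[R[i]]_k :=
  if d is d'.+1 then fun m a => pull d' (phi a) else fun m a => @E m a.

Lemma pull_rep d m : mx_rep (@E (d + m)) -> mx_rep (@pull d m).
Proof.
elim: d m => [//|d IH] m; rewrite addSnnS => /IH [l mu s u].
split => [c a b|a b|a|e he] /=.
- by rewrite (shD (phi_hom m)) (shZ (phi_hom m)) l.
- by rewrite (shM (phi_hom m)) mu.
- by rewrite (shS (phi_hom m)) s.
- by apply: u; exact: phi_unit.
Qed.

Definition ulrep m (a : S m) : 'M[R[i]]_k :=
  \matrix_(i, j) ul U (fun n => @pull (n - m) m a i j).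

Lemma pull_good m : U [set n | mx_rep (@pull (n - m) m)].
Proof.
apply: filterS2 Ugood (Utail m) => n /= h mn; apply: pull_rep.
by rewrite subnK.
Qed.

Lemma ulrepP m (a : S m) i j : ulim U (fun n => @pull (n - m) m a i j) (ulrep a i j).
Proof.
rewrite mxE; apply: (@ulP _ _ _ _ (nr a)); apply: filterS (pull_good m) => n /= h.
exact: mx_rep_le.
Qed.

Lemma ulrep_eq m (a : S m) (M : 'M[R[i]]_k) :
  (forall i j, ulim U (fun n => @pull (n - m) m a i j) (M i j)) -> ulrep a = M.
Proof. by move=> h; apply/matrixP => i j; apply: ulim_uniq (h i j); exact: ulrepP. Qed.

Lemma ulrep_rep m : mx_rep (@ulrep m).
Proof.
split => [c a b|a b|a|e he]; apply: ulrep_eq => i j.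
- rewrite !mxE; apply: (@ulim_near _ _ _ (fun n => c * @pull (n - m) m a i j + @pull (n - m) m b i j)).
    by apply: filterS (pull_good m) => n /= [l _ _ _]; rewrite l !mxE.
  by apply: ulimD; [apply: ulimM; [exact: ulim_cst|]|]; have := ulrepP; rewrite /ulrep => h; move: (h m a i j) (h m b i j); rewrite !mxE.
- rewrite mxE; apply: (@ulim_near _ _ _ (fun n => \sum_l @pull (n - m) m a i l * @pull (n - m) m b l j)).
    by apply: filterS (pull_good m) => n /= [_ l _ _]; rewrite l !mxE.
  by apply: ulim_sum => l; apply: ulimM; exact: ulrepP.
- rewrite mxE; apply: (@ulim_near _ _ _ (fun n => Num.conj (@pull (n - m) m a j i))).
    by apply: filterS (pull_good m) => n /= [_ _ l _]; rewrite l !mxE.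
  by rewrite mxE; apply: ulim_conj; exact: ulrepP.
- apply: (@ulim_near _ _ _ (fun=> (1%:M : 'M[R[i]]_k) i j)); last exact: ulim_cst.
  by apply: filterS (pull_good m) => n /= [_ _ _ l]; rewrite l.
Qed.

Lemma ulrep_phi m (a : S m) : ulrep (phi a) = ulrep a.
Proof.
apply: ulrep_eq => i j; apply: ulim_near (ulrepP a i j).
by apply: filterS (Utail m.+1) => n /= mn; rewrite -(subnSK mn).
Qed.

End LimitRepresentation.

(** Choose a finite family whose images have maximal rank: the image of any further vector lies in
    their row space, and injectivity lifts the relation. *)
Lemma finite_dim_of_inj (K : numFieldType) (W : lmodType K) (N : nat) (g : W -> 'rV[K]_N) :
  linear g -> injective g -> exists (n : nat) (v : 'I_n -> W), lin_span (range v) = setT.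
Proof.
move=> gl gi.
have gD x y : g (x + y) = g x + g y by have := gl 1 x y; rewrite !scale1r.
have g0 : g 0 = 0 by apply/(@addrI _ (g 0)); rewrite -gD !addr0.
have gZ k x : g (k *: x) = k *: g x by have := gl k x 0; rewrite g0 !addr0.
have gsum n (F : 'I_n -> W) : g (\sum_i F i) = \sum_i g (F i).
  by elim/big_rec2: _ => [|i u v _ <-]; rewrite ?g0 ?gD.
pose P r := `[< exists n (v : 'I_n -> W), \rank (\matrix_i g (v i)) = r >].
have P0 : exists r, P r by exists 0%N; apply/asboolP; exists 0%N, (fun=> 0); rewrite flatmx0 mxrank0.
have Pb r : P r -> (r <= N)%N by move=> /asboolP [n [v <-]]; exact: rank_leq_col.
have [r /asboolP [n [v rv]] rmax] := ex_maxnP P0 Pb.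
exists n, v; apply/seteqP; split => // z _.
have : (g z <= \matrix_i g (v i))%MS.
  have : (\rank (col_mx (g z) (\matrix_i g (v i))) <= r)%N.
    apply: rmax; apply/asboolP.
    exists (1 + n)%N, (fun i : 'I_(1 + n) => match fintype.split i with inl _ => z | inr j => v j end).
    congr (\rank _); apply/matrixP => i j; rewrite !mxE.
    by case: (fintype.split i) => [a|b]; rewrite ?mxE// ord1.
  rewrite -addsmxE -rv => h.
  have /mxrank_leqif_sup := addsmxSr (g z) (\matrix_i g (v i)).
  move=> /leqifP; case: ifP => [h2 _|_]; last by rewrite ltnNge h.
  by apply: submx_trans h2; exact: addsmxSl.
move=> /submxP [D hD]; exists n, (fun i => D 0 i), v; split; first by move=> i; exists i.
apply: gi; rewrite hD gsum mulmx_sum_row; apply: eq_bigr => i _.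
by rewrite gZ rowK.
Qed.

Lemma star_hom_injective (R : realType) (A B : cstarAlgType R) (f : A -> B) :
  simple_cstar A -> star_hom f -> (exists a, f a <> 0) -> injective f.
Proof.
move=> [_ simp] hf [a0 fa0].
have [|e|e] := simp [set a | f a = 0].
- split => /=; last 3 first.
  + exact: sh0.
  + by move=> k x y hx hy; rewrite (shD hf) (shZ hf) hx hy scaler0 addr0.
  + by move=> x y hx; rewrite !(shM hf) hx cmul0l cmul0r.
  apply/closed_nr => x h /=; apply: nr0_eq; apply/le_anti; rewrite nr_ge0 andbT.
  apply/ler_addgt0Pr => e e0; rewrite add0r; have [y fy xy] := h e e0.
  by rewrite -[f x]subr0 -fy -(shB hf) (le_trans (star_hom_le hf _))// ltW.
- move=> x y fxy; apply/eqP; rewrite -subr_eq0; apply/eqP.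
  have : [set a | f a = 0] (x - y) by rewrite /= (shB hf) fxy subrr.
  by rewrite e.
- by exfalso; apply: fa0; rewrite -[_ = _]/([set a | f a = 0] a0) e.
Qed.

(* Otherwise infinitely many of the endpoint representations act on the same C^k;
   an ultralimit of them embeds Z into a matrix algebra. *)
Lemma jiang_su_large (R : realType) (Z : cstarAlgType R) (p q : nat -> nat)
    (S : nat -> cstarAlgType R) (phi : forall n, S n -> S n.+1) (mu : forall n, S n -> Z) :
  simple_cstar Z -> infinite_dimensional Z ->
  (forall n, prime_dim_drop (p n) (q n) (S n)) ->
  (forall n, star_hom (phi n)) -> (forall n e, is_unit e -> is_unit (phi n e)) ->
  inductive_limit phi mu ->
  forall k, exists n, (k <= p n)%N && (k <= q n)%N.
Proof.
move=> Zs Zi dd hphi uphi [cmu univ] k; apply: contrapT => /forallNP small.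
have [U [UU Utail0]] := @ultraFilterLemma _ (\oo : set_system nat) _.
have Utail m : U [set n | (m <= n)%N] by apply: Utail0; exists m.
pose G k' := [set n | exists E : S n -> 'M[R[i]]_k', mx_rep E /\ (0 < k')%N].
(* Every n has an endpoint representation of some size below k, and there are finitely many sizes,
   so the ultrafilter selects one of them. *)
have [k' Gk'] : exists k', U (G k').
  apply: contrapT => /forallNP hk.
  have : U [set n | forall i : 'I_k, ~ G i n].
    apply: filter_forall => i; have [/hk//|] := in_ultra_setVsetC (G i) UU; exact.
  move=> /filter_ex [n /= hn].
  have [[[p0 q0 _] _] [E1 E2]] := (dd n, dd_endpoints (dd n)).
  have : (p n < k)%N || (q n < k)%N by rewrite !ltnNge -negb_and; apply/negP; exact: small.
  case/orP => lt.
  - by apply: (hn (Ordinal lt)); have [E hE] := E1; exists E.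
  - by apply: (hn (Ordinal lt)); have [E hE] := E2; exists E.
have k'0 : (0 < k')%N by have /filter_ex [n [E []]] := Gk'.
pose E n : S n -> 'M[R[i]]_k' := xget (fun=> 0) [set E | mx_rep E].
have Ugood : U [set n | mx_rep (E n)].
  apply: filterS Gk' => n /= [F [hF _]]; rewrite /E; case: xgetP => // h; by have := h F hF.
pose nu n (a : S n) := mxop (@ulrep R S phi k' E U n a).
have rep n := @ulrep_rep R S phi k' E U UU hphi uphi Utail Ugood n.
have cnu : cocone phi nu.
  move=> n; split; first exact: mx_rep_star_hom.
  by move=> a; rewrite /nu (ulrep_phi hphi uphi Utail Ugood).
have [psi [[hpsi epsi] _]] := univ _ _ cnu.
have [ev [_ evs evi evh]] := proj2 (dd 0%N).
have inj : injective psi.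
  apply: star_hom_injective => //.
  exists (mu 0%N (dd_unit ev)); rewrite epsi /nu; have [_ _ _ ->] := rep 0%N; last first.
    exact: (dd_unitP evs evi evh).
  move=> h; have := mxop_deltaE (1%:M : 'M[R[i]]_k') (Ordinal k'0) (Ordinal k'0).
  by rewrite h bop0E l20E mxE eqxx => /esym/eqP; rewrite oner_eq0.
apply: Zi.
apply: (@finite_dim_of_inj _ _ _ (fun z => mxvec (\matrix_(i, j) psi z (delta j) i))).
- move=> c x y; rewrite -linearP; congr mxvec; apply/matrixP => i j; rewrite !mxE.
  by rewrite (shD hpsi) (shZ hpsi).
- move=> x y /(can_inj mxvecK)/matrixP h; apply: inj.
  apply: bop_delta_ext => j; apply: l2_ext => i; have := h i j; by rewrite !mxE.
Qed.

Lemma lin_span_approx (R : realType) (V W : normedModType R[i]) (f g : V -> W) (S : set V) (C : R) :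
  linear f -> linear g -> (forall x, nr (f x - g x) <= C * nr x) ->
  closure (lin_span S) = setT -> (forall s, S s -> f s = g s) -> f =1 g.
Proof.
move=> fl gl fgC dS fg x.
have lD h (hl : linear h) (a b : V) : h (a + b) = h a + h b :> W.
  by have := hl 1 a b; rewrite !scale1r.
have l0 h (hl : linear h) : h (0 : V) = 0 :> W.
  by apply/(@addrI _ (h 0)); rewrite -lD// !addr0.
have lZ h (hl : linear h) (k : R[i]) (a : V) : h (k *: a) = k *: h a :> W.
  by have := hl k a 0; rewrite l0// !addr0.
have lB h (hl : linear h) (a b : V) : h (a - b) = h a - h b :> W.
  by rewrite -[- b]scaleN1r lD// lZ// scaleN1r.
have eqs y : lin_span S y -> f y = g y.
  move=> [n [c [v [Sv ->]]]]; elim/big_rec: _ => [|i y' _ IH]; first by rewrite (l0 f fl) (l0 g gl).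
  by rewrite (lD f fl) (lD g gl) IH (lZ f fl) (lZ g gl) fg.
apply/eqP; rewrite -subr_eq0 -nr_eq0; apply/eqP/le_anti; rewrite nr_ge0 andbT.
apply/ler_addgt0Pr => e e0; rewrite add0r.
have C1 : 0 < `|C| + 1 by rewrite ltr_wpDl.
have : closure (lin_span S) x by rewrite dS.
move/closure_nr/(_ _ (divr_gt0 e0 C1)) => [y Sy xy].
have -> : f x - g x = f (x - y) - g (x - y).
  by rewrite (lB f fl) (lB g gl) (eqs y)// opprB addrA subrK.
apply: le_trans (fgC _) _; apply: (@le_trans _ _ ((`|C| + 1) * nr (x - y))).
  by rewrite ler_wpM2r ?nr_ge0// (le_trans (ler_norm C))// lerDl.
by rewrite mulrC -ler_pdivlMr// ltW.
Qed.

Lemma lin_span_orth (R : realType) (H : hilbertType R) (S : set H) (v : H) :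
  closure (lin_span S) = setT -> (forall s, S s -> dot s v = 0) -> v = 0.
Proof.
move=> dS h; apply: nr0_eq; apply/eqP; rewrite -sqrf_eq0; apply/eqP/le_anti; rewrite sqr_ge0 andbT.
apply/ler_addgt0Pr => e e0; rewrite add0r.
have C1 : 0 < nr v + 1 by rewrite ltr_wpDl ?nr_ge0.
have : closure (lin_span S) v by rewrite dS.
move/closure_nr/(_ _ (divr_gt0 e0 C1)) => [y [n [c [w [Sw yE]]]] vy].
have y0 : dot y v = 0 by rewrite yE dot_suml big1// => i _; rewrite dotZl h ?mulr0.
rewrite -Re_dot -[dot v v]subr0 -y0 -dotBl; apply: le_trans (Re_le_nr _) _.
apply: le_trans (cauchy_schwarz _ _) _; apply: (@le_trans _ _ (nr (v - y) * (nr v + 1))).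
  by rewrite ler_wpM2l ?nr_ge0// lerDl.
by rewrite -ler_pdivlMr// ltW.
Qed.

(** * Jiang-Su stability and right multiplication *)

Section TensorFactor.
Context {R : realType} {A Z : cstarAlgType R} (e : A) (eZ : Z).
Hypotheses (he : is_unit e) (hZ : is_unit eZ).

(** Through the isomorphism with the spatial tensor product, j z is 1 (x) z and B is A (x) 1; the
    tensor t itself is recovered from its action on elementary vectors. *)
Lemma min_tensor_factor : min_tensor A Z A ->
  exists (j : Z -> A) (B : set A),
  [/\ star_hom j, j eZ = e, (forall b z, B b -> b ** j z = j z ** b) &
      closure (lin_span [set a | exists b z, B b /\ a = b ** j z]) = setT].
Proof.
move=> [H [K [T [pi [rho [sigma [tau [t [[fpi frho fsig [tdot tdense]] [hs tspan]]]]]]]]]].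
have [[pb pl pm ps] _] := fpi; have [[rb rl rm rs] _] := frho.
have [[sb sl sm ss] sinj] := fsig.
have key a a' : (forall x y, sigma a (tau x y) = sigma a' (tau x y)) -> a = a'.
  move=> h; apply: sinj; apply/funext.
  have [[la ca] [la' ca']] := (sb a, sb a').
  have [C C0 hC] := linear_bounded la ca; have [C' C'0 hC'] := linear_bounded la' ca'.
  apply: (@lin_span_approx R T T _ _ _ (C + C') la la' _ tdense).
    by move=> x; rewrite mulrDl (le_trans (nrB _ _))// lerD.
  by move=> _ [x [y ->]].
have tM c d c' d' : t c d ** t c' d' = t (c ** c') (d ** d').
  by apply: key => x y; rewrite sm !hs pm rm.
have tS c d : star (t c d) = t (star c) (star d).
  apply: key => x y; rewrite hs; apply/eqP; rewrite -subr_eq0; apply/eqP.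
  apply: lin_span_orth tdense _ => _ [x' [y' ->]].
  by rewrite dotBr -ss hs !tdot ps rs subrr.
have tlin c (k : R[i]) d d' : t c (k *: d + d') = k *: t c d + t c d'.
  apply: key => x y; rewrite sl !hs rl.
  by rewrite linearDr linearZr_LR.
(* 1 (x) 1 fixes elementary tensors, hence by density it is a left unit, which identifies it with
   e. *)
have left_unit x : t e eZ ** x = x.
  move: x; apply: (@lin_span_approx R A A (fun x => t e eZ ** x) id _ (nr (t e eZ) + 1) _ _ _ tspan).
  - by move=> k x y; rewrite cmulDr cmulZr.
  - by [].
  - move=> x; rewrite mulrDl mul1r (le_trans (nrB _ _))// lerD2r; exact: nr_cmul.
  - by move=> _ [c [d ->]]; rewrite tM (proj1 (he c)) (proj1 (hZ d)).
exists (t e), [set t a eZ | a in setT]; split.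
- split => [k x y|x y|x]; first exact: tlin.
    by rewrite tM (proj1 (he e)).
  by rewrite tS (unit_star he).
- by rewrite -[LHS](proj2 (he _)) left_unit.
- by move=> _ z [a _ <-]; rewrite !tM (proj1 (he a)) (proj2 (he a)) (proj1 (hZ z)) (proj2 (hZ z)).
- rewrite -[RHS]tspan; congr (closure (lin_span _)); apply/seteqP; split => [_ [_ [z [[a _ <-] ->]]]|_ [c [d ->]]] /=.
    by exists a, z; rewrite tM (proj2 (he a)) (proj1 (hZ z)).
  exists (t c eZ), d; split; first by exists c.
  by rewrite tM (proj2 (he c)) (proj1 (hZ d)).
Qed.

End TensorFactor.

(** * Right multiplication on trace vectors *)

Section RightAction.
Context {R : realType} {V : twist}.
Implicit Types (f g h : V) (T U : bop (l2 R V)) (x y : l2 R V).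

Lemma tga_ind (P : bop (l2 R V) -> Prop) : closed (P : set (bop (l2 R V))) -> P 0 ->
  (forall (k : R[i]) T U, P T -> P U -> P (k *: T + U)) -> (forall g, P (lam g)) ->
  forall T, tga_set T -> P T.
Proof.
move=> Pc P0 Pl Pg T hT; apply: (iffLR (closed_nr (P : set (bop (l2 R V)))) Pc) => e e0.
have [a ha] := hT e e0; exists (lamsum a) => //.
by rewrite /lamsum; elim/big_rec: _ => // p U _ PU; exact: Pl.
Qed.

Lemma closed_kernel (W : normedZmodType R[i]) (F : bop (l2 R V) -> W) (C : R) :
  (forall T U, nr (F T - F U) <= C * nr (T - U)) -> closed ([set T | F T = 0] : set (bop (l2 R V))).
Proof.
move=> hF; apply/closed_nr => T h /=; apply: nr0_eq; apply/le_anti; rewrite nr_ge0 andbT.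
apply/ler_addgt0Pr => e e0; rewrite add0r.
have C1 : 0 < `|C| + 1 by rewrite ltr_wpDl.
have [U U0 TU] := h _ (divr_gt0 e0 C1).
rewrite -[F T]subr0 -U0; apply: le_trans (hF _ _) _.
apply: (@le_trans _ _ ((`|C| + 1) * nr (T - U))).
  by rewrite ler_wpM2r ?nr_ge0// (le_trans (ler_norm C))// lerDl.
by rewrite mulrC -ler_pdivlMr// ltW.
Qed.

Lemma sqs_tconj x : sqs (fun f => sg (tw f f) * Num.conj (x f)).
Proof.
have [C hC] := l2P x; exists C => r ur; rewrite (le_trans _ (hC r ur))//.
by apply: ler_sum => i _; rewrite nrM nr_sg nr_conj mul1r.
Qed.
(** The modular conjugation of the trace, that is, T delta_0 |-> T^* delta_0. *)
Definition tconj x : l2 R V := L2 (sqs_tconj x).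

Lemma tconjE x f : tconj x f = sg (tw f f) * Num.conj (x f). Proof. by []. Qed.

Lemma tconjK : involutive tconj.
Proof.
by move=> x; apply: l2_ext => f; rewrite !tconjE rmorphM /= sg_conj conjCK mulrA sgK mul1r.
Qed.

Lemma tconj_lin (k : R[i]) x y : tconj (k *: x + y) = Num.conj k *: tconj x + tconj y.
Proof.
apply: l2_ext => f; rewrite l2DE l2ZE !tconjE l2DE l2ZE rmorphD rmorphM.
by rewrite mulrDr mulrCA.
Qed.

Lemma nr_tconj x : nr (tconj x) = nr x.
Proof.
have le z : nr (tconj z) <= nr z.
  apply: l2_nr_le; first exact: nr_ge0.
  move=> r ur; apply: le_trans (l2_sum_le z ur).
  by apply: ler_sum => i _; rewrite tconjE nrM nr_sg nr_conj mul1r.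
by apply/le_anti; rewrite le/= -{1}[x]tconjK le.
Qed.

Lemma tconj_restr (C : pred V) x : tconj (restr C x) = restr C (tconj x).
Proof.
apply: l2_ext => f; rewrite tconjE !restrE tconjE; case: ifP => // _.
by rewrite rmorph0 mulr0.
Qed.

(* Right multiplication by T on the trace vectors of the algebra. *)
Definition rgt T x : l2 R V := tconj (star T (tconj x)).

Lemma rgt_lin T (k : R[i]) x y : rgt T (k *: x + y) = k *: rgt T x + rgt T y.
Proof. by rewrite /rgt tconj_lin bopD bopZ tconj_lin conjCK. Qed.

Lemma rgtZ T (k : R[i]) x : rgt T (k *: x) = k *: rgt T x.
Proof.
have r0 : rgt T 0 = 0.
  by have := rgt_lin T (-1) 0 0; rewrite scaler0 addr0 scaleN1r addNr.
by rewrite -[k *: x]addr0 rgt_lin r0 addr0.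
Qed.

Lemma nr_rgt T x : nr (rgt T x) = nr (star T (tconj x)). Proof. exact: nr_tconj. Qed.

Lemma rgt_delta T f : tga_set T -> rgt T (delta f) = lam f (T (delta 0)).
Proof.
move=> hT; apply: l2_ext => h.
have tcd : tconj (delta f) = sg (tw f f) *: delta f.
  apply: l2_ext => i; rewrite tconjE l2ZE deltaE.
  by case: eqP => [->|_]; rewrite ?rmorph1// rmorph0 !mulr0.
rewrite /rgt tcd tconjE bopZ l2ZE -dot_delta -[star T]/(adj T) adjE' (tga_delta h hT) dotC dot_delta.
rewrite !rmorphM /= !sg_conj [X in _ * (_ * (_ * X))]conjCK !mulrA !sgM [h + f]addrC; congr (sg _ * _).
by rewrite twDl !twDr; do ![case: (tw _ _)].
Qed.

(** Indeed [rgt T] sends U delta_0 to U T delta_0: both sides are linear and continuous in U, and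
    for U = [lam g] this is [rgt_delta]. *)
Lemma rgt_mul T U : tga_set T -> tga_set U -> rgt T (U (delta 0)) = U (T (delta 0)).
Proof.
move=> hT hU; apply/eqP; rewrite -subr_eq0; apply/eqP.
apply: (@tga_ind (fun U => rgt T (U (delta 0)) - U (T (delta 0)) = 0)) hU.
- apply: (@closed_kernel _ _ (nr (star T) + nr (T (delta 0)))) => S S'.
  have -> : rgt T (S (delta 0)) - S (T (delta 0)) - (rgt T (S' (delta 0)) - S' (T (delta 0))) =
      rgt T ((S - S') (delta 0)) - (S - S') (T (delta 0)).
    have -> : (S - S') (delta 0) = -1 *: S' (delta 0) + S (delta 0) by rewrite bopBE addrC scaleN1r.
    rewrite rgt_lin scaleN1r bopBE !opprD !opprK.
    by rewrite [LHS](AC (2*2) ((3*1)*(2*4)))/=.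
  apply: le_trans (nrB _ _) _; rewrite nr_rgt mulrDl lerD//.
    apply: le_trans (bop_le _ _) _; rewrite nr_tconj ler_wpM2l ?opn_ge0//.
    by apply: le_trans (bop_le _ _) _; rewrite nr_delta mulr1.
  by rewrite mulrC; exact: bop_le.
- by rewrite !bop0E subr0 -[X in rgt T X](scale0r (0 : l2 R V)) rgtZ scale0r.
- move=> k S S' hS hS'; rewrite !bopDE !bopZE rgt_lin opprD addrACA -scalerBr hS hS'.
  by rewrite scaler0 addr0.
- by move=> g; rewrite lam_delta0 rgt_delta// subrr.
Qed.

End RightAction.

(** * Operators supported on a subgroup *)

Section CosetSupports.
Context {R : realType} {V : twist}.
Implicit Types (f g h : V) (T U : bop (l2 R V)) (x y : l2 R V).

(** An approximation of T within 1 / (n + 1) involves finitely many group elements, and off them the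
    coefficients of T are at most 1 / (n + 1). *)
Lemma countable_support T : tga_set T -> exists W : nat -> seq V,
  forall f, (forall n, f \notin W n) -> T (delta 0) f = 0.
Proof.
move=> hT.
have /(_ _)/cid hW n : exists a, nr (T - lamsum a) < (n.+1%:R^-1 : R) by apply: hT; rewrite invr_gt0.
exists (fun n => map snd (sval (hW n))) => f hf.
apply: nr0_eq; apply/le_anti; rewrite nr_ge0 andbT leNgt; apply/negP => n0.
have [n hn] : exists n, (n.+1%:R^-1 : R) < nr (T (delta 0) f).
  by have [n _ hn] := near_infty_natSinv_lt (PosNum n0); exists n; exact: (hn n (leqnn n)).
have := svalP (hW n); set a := sval _ => ha.
have a0 : lamsum a (delta 0) f = 0.
  rewrite /lamsum bop_sumE l2_sumE big1_seq// => p /andP[_ pa].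
  rewrite bopZE l2ZE lam_delta0 deltaE; case: eqP => [fp|]; last by rewrite mulr0.
  by have := hf n; rewrite fp (map_f snd pa).
have : nr (T (delta 0) f) <= nr (T - lamsum a).
  rewrite -[X in nr X]subr0 -a0 -l2BE -bopBE; apply: le_trans (nr_coef _ _) _.
  by apply: le_trans (bop_le _ _) _; rewrite nr_delta mulr1 opnE.
by rewrite leNgt (lt_trans ha hn).
Qed.

Section Cosets.
Context {G : set V}.
Hypothesis GD : forall f g, G f -> G g -> G (f + g).

(** The coset h + G: in exponent two, f + h is the difference of f and h. *)
Definition in_coset h : pred V := fun f => `[< G (f + h) >].

Lemma in_cosetP h f : reflect (G (f + h)) (in_coset h f). Proof. exact: asboolP. Qed.

(** Being supported on the subgroup G, expressed as commutation with the projections onto its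
    cosets; in this form the property passes to products, adjoints and limits. *)
Definition coset_inv T := forall h, T ** restr_op (in_coset h) = restr_op (in_coset h) ** T.

Lemma supp_coset_inv T : tga_set T -> (forall f, ~ G f -> T (delta 0) f = 0) -> coset_inv T.
Proof.
move=> hT supp h; apply: bop_delta_ext => f; rewrite !bopME.
have GDr i : G (i + f) -> G (f + h) -> G (i + h).
  by move=> h1 h2; have := GD h1 h2; rewrite addrA addKK.
have Tf i : ~ G (i + f) -> T (delta f) i = 0.
  by move=> nG; rewrite tga_delta// monoE supp// mulr0.
have -> : restr_op (in_coset h) (delta f) = (if in_coset h f then delta f else 0) :> l2 R V.
  apply: l2_ext => i; rewrite restrE deltaE; case: eqP => [->|ne].
    by case: ifP => // _; rewrite ?l20E// deltaE eqxx.
  by rewrite if_same; case: ifP => _; rewrite ?l20E// deltaE; case: eqP.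
apply: l2_ext => i; rewrite [RHS]restrE; case: (in_cosetP h f) => hf; case: (in_cosetP h i) => hi.
- by [].
- by apply: Tf => hif; apply: hi; exact: GDr.
- rewrite bop0 l20E Tf// => hif; apply: hf.
  by have := GD hif hi; rewrite addrACA [i + i]tw_char2 add0r.
- by rewrite bop0 l20E.
Qed.

Lemma coset_inv0 : coset_inv 0.
Proof. by move=> h; rewrite cmul0l cmul0r. Qed.

Lemma coset_inv_lin (k : R[i]) T U : coset_inv T -> coset_inv U -> coset_inv (k *: T + U).
Proof. by move=> hT hU h; rewrite cmulDl cmulDr cmulZl cmulZr hT hU. Qed.

Lemma coset_inv_mul T U : coset_inv T -> coset_inv U -> coset_inv (T ** U).
Proof. by move=> hT hU h; rewrite -cmulA hU cmulA hT cmulA. Qed.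

Lemma star_restr (C : pred V) : star (restr_op C : bop (l2 R V)) = restr_op C.
Proof.
apply: bop_delta_ext => j; apply: l2_ext => i.
rewrite -dot_delta -[star _]/(adj _) adjE' dotC dot_delta !restrE !deltaE eq_sym.
case: eqP => [->|_]; last by rewrite !if_same rmorph0.
by case: (C j); rewrite ?rmorph1 ?rmorph0.
Qed.

Lemma coset_inv_star T : coset_inv T -> coset_inv (star T).
Proof.
by move=> hT h; rewrite -[restr_op _]star_restr -!starM hT.
Qed.

Lemma coset_inv_closed : closed (coset_inv : set (bop (l2 R V))).
Proof.
have -> : (coset_inv : set (bop (l2 R V))) =
    \bigcap_(h in setT) [set T | T ** restr_op (in_coset h) - restr_op (in_coset h) ** T = 0].
  apply/seteqP; split => [T hT h _ | T hT h] /=; first by rewrite hT subrr.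
  by apply/eqP; rewrite -subr_eq0; apply/eqP; exact: (hT h I).
apply: closed_bigI => h _; apply: (@closed_kernel _ _ _ _ (2 * nr (restr_op (in_coset h) : bop (l2 R V)))) => T U.
set r := restr_op _.
have -> : T ** r - r ** T - (U ** r - r ** U) = (T - U) ** r - r ** (T - U).
  by rewrite cmulBl cmulBr !opprB [LHS](AC (2*2) ((1*4)*(3*2)))/=.
apply: le_trans (nrB _ _) _; rewrite -mulrA mulr2n mulrDl !mul1r lerD//.
  by apply: le_trans (nr_cmul _ _) _; rewrite mulrC.
exact: nr_cmul.
Qed.

Definition coset_sub := SubCstar coset_inv0 coset_inv_lin coset_inv_mul coset_inv_star coset_inv_closed.

Lemma rgt_restr T h x : coset_inv T -> rgt T (restr (in_coset h) x) = restr (in_coset h) (rgt T x).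
Proof.
move=> /coset_inv_star/(_ h)/(congr1 (fun U : bop (l2 R V) => U (tconj x))); rewrite !bopME => e.
by rewrite /rgt tconj_restr -[restr _ (tconj x)]/(restr_op _ _) e tconj_restr.
Qed.

End Cosets.
End CosetSupports.

Arguments coset_inv {R V} G T.
Arguments coset_sub {R V} G.

(** * Countable support of the image of a limit of dimension drop algebras *)

Section JiangSuSupport.
Context {R : realType} {V : twist} {Z : cstarAlgType R} (j : Z -> tga R V).
Hypothesis hj : star_hom j.

Lemma pullback_closed (Q : sub_cstar (bop (l2 R V))) :
  closed ((fun z => Q (sc_val (j z))) : set Z).
Proof.
apply/closed_nr => z h; apply: (iffLR (closed_nr _) (@sc_closed _ _ Q)) => e e0.
have [y Qy zy] := h e e0; exists (sc_val (j y)) => //.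
by rewrite -sc_valB -sc_nrE -(shB hj) (le_lt_trans (star_hom_le hj _)).
Qed.

Definition pullback (Q : sub_cstar (bop (l2 R V))) : sub_cstar Z.
Proof.
refine (@SubCstar R Z (fun z => Q (sc_val (j z))) _ _ _ _ (@pullback_closed Q)).
- by rewrite (sh0 hj); exact: sc0.
- by move=> k x y hx hy; rewrite (shD hj) (shZ hj); exact: sc_lin.
- by move=> x y hx hy; rewrite (shM hj); exact: sc_mul.
- by move=> x hx; rewrite (shS hj); exact: sc_star.
Defined.

(** Each stage has countably many generators and each generator has countable support; G is the
    subgroup generated by all of these supports. The elements of Z supported on G form a closed
    *-subalgebra containing the stages, hence all of Z. *)
Lemma limit_countable_support (p q : nat -> nat) (S : nat -> cstarAlgType R)
    (phi : forall n, S n -> S n.+1) (mu : forall n, S n -> Z) :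
  (forall n, prime_dim_drop (p n) (q n) (S n)) -> inductive_limit phi mu ->
  exists gam : nat -> V, [/\ range gam 0, (forall f g, range gam f -> range gam g -> range gam (f + g)) &
    forall z, coset_inv (range gam) (sc_val (j z))].
Proof.
move=> dd lim; have [cmu _] := lim.
have gen n : exists x : nat -> S n,
  forall (H : hilbertType R) (f : S n -> bop H), star_hom f -> forall T : bop H -> Prop,
  closed (T : set (bop H)) -> T 0 -> (forall (k : R[i]) U V, T U -> T V -> T (k *: U + V)) ->
  (forall k, T (f (x k))) -> forall b, T (f b).
  by have [_ [ev [evf evs evi evh]]] := dd n; exact: (dd_generated evf evs evi evh).
pose x n := sval (cid (gen n)); have xP n := svalP (cid (gen n)).
pose op n k := sc_val (j (mu n (x n k))).
have /(_ _ _)/cid hW n k := countable_support (tgaP (j (mu n (x n k)))).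
(* The code (n, k, m, i) names the entry i of the list m in the support of generator k at stage
   n. *)
pose W (c : nat * nat * nat * nat) : V :=
  nth 0 (sval (hW c.1.1.1 c.1.1.2) c.1.2) c.2.
pose W' n := if unpickle n is Some c then W c else 0.
pose gam n := if unpickle n is Some l then \sum_(i <- (l : seq nat)) W' i else 0.
have gamS l : range gam (\sum_(i <- (l : seq nat)) W' i).
  by exists (pickle l) => //; rewrite /gam pickleK.
have g0 : range gam 0 by have := gamS [::]; rewrite big_nil.
have gD f g : range gam f -> range gam g -> range gam (f + g).
  move=> [n _ <-] [m _ <-]; rewrite /gam.
  case: (unpickle n) => [l|]; case: (unpickle m) => [l'|]; rewrite ?add0r ?addr0//.
  by rewrite -big_cat; exact: gamS.
have Wg c : range gam (W c).
  by have := gamS [:: pickle c]; rewrite big_seq1 /W' pickleK.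
exists gam; split => // z.
suff key n a : pullback (coset_sub (range gam)) (mu n a) by exact: (inductive_limit_dense lim key z).
have hf : star_hom (fun a => sc_val (j (mu n a))).
  exact: (star_hom_comp (star_hom_comp (proj1 (cmu n)) hj) sc_val_star_hom).
apply: (xP n _ _ hf (coset_inv (range gam)) _ _ _ _ a).
- exact: coset_inv_closed.
- exact: coset_inv0.
- by move=> k U U'; exact: coset_inv_lin.
- move=> k; apply: supp_coset_inv => //; first exact: tgaP.
  move=> f nf; apply: (svalP (hW n k)) => m; apply/negP => fW; apply: nf.
  by have := Wg (n, k, m, index f (sval (hW n k) m)); rewrite /W /= nth_index.
Qed.

End JiangSuSupport.

Section AlmostInvariantVectors.
Context {R : realType} {V : twist} {Z : cstarAlgType R} (j : Z -> tga R V) (B : set (tga R V)).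
Hypothesis hj : star_hom j.
Hypothesis jB : forall b z, B b -> b ** j z = j z ** b.
Hypothesis dense : closure (lin_span [set a | exists b z, B b /\ a = b ** j z]) = setT.
Context {G : set V}.
Hypothesis G0 : G 0.
Hypothesis jG : forall z, coset_inv G (sc_val (j z)).
Local Notation op z := (sc_val (j z)).

(** If all b delta_0 vanished on the coset t + G, then so would all b j(z) delta_0 = j(z) b delta_0,
    because j(z) preserves cosets, and by density so would lam t delta_0 = delta_t. *)
Lemma commutant_vector (t : V) : exists b, B b /\ restr (in_coset (G := G) t) (sc_val b (delta 0)) <> 0.
Proof.
apply: contrapT => /forallNP h.
have hB b : B b -> restr (in_coset (G := G) t) (sc_val b (delta 0)) = 0.
  by move=> Bb; apply: contrapT => ne; apply: (h b).
have : closure (lin_span [set a | exists b z, B b /\ a = b ** j z]) (lamA t) by rewrite dense.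
move/closure_nr/(_ _ ltr01) => [_ [n [c [v [hv ->]]]]].
rewrite ltNge => /negP; apply.
set y := \sum_i _; have y0 : sc_val y (delta 0) t = 0.
  have : restr (in_coset (G := G) t) (sc_val y (delta 0)) t = 0.
    rewrite -[restr _ _]/(restr_op _ _) /y sc_val_sum bop_sumE bop_sum l2_sumE big1// => i _.
    have [b [z [Bb ->]]] := hv i.
    rewrite sc_valZ bopZE bopZ l2ZE jB// sc_valM bopME -[restr_op _ (sc_val (j z) _)]bopME -jG bopME.
    by rewrite -[restr_op _ _]/(restr _ _) hB// bop0 l20E mulr0.
  by rewrite restrE; case: in_cosetP => //; rewrite tw_char2.
rewrite sc_nrE sc_valB opnE.
have := nr_coef ((sc_val (lamA t) - sc_val y) (delta 0)) t.
rewrite bopBE l2BE y0 subr0 lam_delta0 deltaE eqxx nr1 => h1.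
apply: (le_trans h1); have := bop_le (sc_val (lamA t) - sc_val y) (delta 0).
by rewrite nr_delta mulr1 bopBE lam_delta0.
Qed.

(* b commutes with j Z, so b delta_0 is a vector on which left and right
   multiplication by j z agree; cut it down to the coset t + G and move it back. *)
Lemma invariant_vector (t : V) : (forall v, tw v t = false) ->
  exists a : l2 R V, [/\ nr a = 1, (forall f, ~ G f -> a f = 0) &
    forall z, op z a = rho t (rgt (op z) (rho t a))].
Proof.
move=> ht; have [b [Bb nz]] := commutant_vector t.
set be := restr _ _ in nz.
have n0 : nr be != 0 by rewrite nr_eq0; apply/eqP.
have tt x : rho t (rho t x) = x :> l2 R V.
  by apply: l2_ext => i; rewrite !monoE !ht sg0 !mul1r addKK.
have inv z : op z be = rgt (op z) be.
  rewrite /be rgt_restr// rgt_mul; [|exact: tgaP..].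
  rewrite -[restr _ _]/(restr_op _ _) -[LHS]bopME jG bopME -[op z (sc_val b _)]bopME -sc_valM -jB//.
exists ((nr be)^-1%:C *: rho t be); split.
- by rewrite nrZ nrR ger0_norm ?invr_ge0 ?nr_ge0// nr_mono mulVf.
- move=> f nf; rewrite l2ZE monoE restrE; case: in_cosetP; rewrite ?addKK// => _.
  by rewrite !mulr0.
- move=> z; rewrite !bopZ rgtZ bopZ tt -inv; congr (_ *: _).
  by rewrite -[LHS]bopME tga_rho ?bopME//; exact: tgaP.
Qed.

End AlmostInvariantVectors.

(** * Order zero frames *)

Section SignSums.
Context {R : realType}.

Lemma sg_big (r : nat) (b : 'I_r -> bool) :
  sg (\big[addb/false]_(i < r) b i) = \prod_(i < r) sg (b i) :> R[i].
Proof. by apply: (big_morph (@sg R) _ (@sg0 R)) => u v; rewrite sgM. Qed.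

(** Orthogonality of characters: the sum factors over the coordinates, and a coordinate where b
    holds contributes 1 - 1. *)
Lemma sum_sg (r : nat) (b : 'I_r -> bool) :
  \sum_(x : {ffun 'I_r -> bool}) sg (\big[addb/false]_(i < r) (x i && b i)) =
  (if [exists i, b i] then 0 else (2 ^ r)%:R) :> R[i].
Proof.
under eq_bigr do rewrite sg_big.
rewrite -(bigA_distr_bigA (fun i y => sg (y && b i))).
case: ifP => [/existsP [i bi]|/negbT/existsPn nb].
  by rewrite (bigD1 i)//= big_bool /= bi sg1 sg0 addNr mul0r.
under eq_bigr do rewrite big_bool /= (negbTE (nb _)) sg0.
by rewrite prodr_const card_ord natrX.
Qed.

Lemma sqr_sum_le (I : Type) (s : seq I) (F : I -> R) :
  (\sum_(i <- s) F i) ^+ 2 <= (size s)%:R * \sum_(i <- s) F i ^+ 2.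
Proof.
elim: s => [|i s IH]; first by rewrite !big_nil expr0n mulr0.
rewrite !big_cons /= -natr1.
have h : 2 * F i * \sum_(k <- s) F k <= (size s)%:R * F i ^+ 2 + \sum_(k <- s) F k ^+ 2.
  elim: s {IH} => [|k s IH]; first by rewrite !big_nil mulr0 mul0r addr0.
  rewrite !big_cons /= -natr1; have := sqr_ge0 (F i - F k); rewrite sqrrB.
  move: IH; set S1 := \sum_(_ <- s) _; set S2 := \sum_(_ <- s) _; nra.
by move: IH h; set S1 := \sum_(_ <- s) _; set S2 := \sum_(_ <- s) _; nra.
Qed.

Lemma nr_avg_sqr (W : normedModType R[i]) (I : finType) (F : I -> W) : (0 < #|I|)%N ->
  nr ((#|I|%:R^-1 : R)%:C *: \sum_i F i) ^+ 2 <= #|I|%:R^-1 * \sum_i nr (F i) ^+ 2.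
Proof.
move=> I0; have I0' : 0 < #|I|%:R :> R by rewrite ltr0n.
rewrite nrZ nrR ger0_norm ?invr_ge0 ?ler0n// exprMn [X in X * _]expr2 -mulrA ler_pM2l ?invr_gt0//.
rewrite ler_pdivrMl//; apply: (@le_trans _ _ ((\sum_i nr (F i)) ^+ 2)).
  by rewrite lerXn2r ?nnegrE ?nr_ge0 ?sumr_ge0 ?nr_sum// => i _; rewrite nr_ge0.
by have := sqr_sum_le (enum I) (fun i => nr (F i)); rewrite !big_enum -cardE.
Qed.

End SignSums.

Section OrderZero.
Context {R : realType}.

Lemma order_zero_hom (A B : cstarAlgType R) (f : A -> B) (e : A) n (m h : 'I_n -> 'I_n -> A) :
  star_hom f -> order_zero e m h -> order_zero (f e) (fun i j => f (m i j)) (fun i j => f (h i j)).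
Proof.
move=> hf [h1 h2 h3]; split => [i j k|i j|k].
- by rewrite (h1 i j k) (shM hf).
- by rewrite -(shS hf) h2.
- have [c sc ce] := h3 k; exists (f c); first by rewrite -(shS hf) sc.
  rewrite -ce (shD hf) (sh_sum hf) (shM hf); congr (_ + _).
  by apply: eq_bigr => i _; rewrite (shM hf).
Qed.

Lemma order_zero_star (A : cstarAlgType R) (e : A) n (m h : 'I_n -> 'I_n -> A) i j :
  order_zero e m h -> star (m i j) = m j i.
Proof. by move=> [h1 h2 _]; rewrite (h1 i j i) starM !h2 -h1. Qed.

(** Factoring every m i j through the index 0 turns its matrix coefficient into <h 0 j x, h 0 i y>.
    By Cauchy-Schwarz the double sum is at most a product of two column sums, each bounded by the
    squared norm of its vector. *)
Lemma order_zero_bound (H : hilbertType R) n (m h : 'I_n -> 'I_n -> bop H) (x y : H) :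
  order_zero (@bop_one R H) m h ->
  \sum_i \sum_j nr (dot (m i j x) y) ^+ 2 <= nr x ^+ 2 * nr y ^+ 2.
Proof.
case: n m h => [|n] m h [h1 h2 h3].
  by rewrite big_ord0 mulr_ge0 ?sqr_ge0.
have col z : \sum_j nr (h ord0 j z) ^+ 2 <= nr z ^+ 2.
  have [c sc ce] := h3 ord0.
  have : nr z ^+ 2 = \sum_j nr (h ord0 j z) ^+ 2 + nr (c z) ^+ 2.
    transitivity (complex.Re (dot (@bop_one R H z) z)); first by rewrite -Re_dot.
    rewrite -ce bopDE dotDl raddfD /=; congr (_ + _).
      rewrite bop_sumE dot_suml raddf_sum.
      by apply: eq_bigr => j _; rewrite bopME -(h2 ord0 j) -[star _]/(adj _) adjE' -[LHS]/(complex.Re _) Re_dot.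
    by rewrite -{1}sc -[star _]/(adj _) adjE' Re_dot.
  by move=> ->; rewrite lerDl sqr_ge0.
apply: (@le_trans _ _ (\sum_i \sum_j nr (h ord0 j x) ^+ 2 * nr (h ord0 i y) ^+ 2)).
  apply: ler_sum => i _; apply: ler_sum => j _.
  rewrite (h1 i j ord0) bopME -h2 -[star _]/(adj _) adjE' -exprMn.
  by rewrite lerXn2r ?nnegrE ?mulr_ge0 ?nr_ge0// cauchy_schwarz.
under eq_bigr do rewrite -mulr_suml.
rewrite -mulr_sumr; apply: ler_pM; rewrite ?sumr_ge0 ?col// => k _; exact: sqr_ge0.
Qed.

Context {V : twist}.
Implicit Types (f g l : V).

(* Testing order_zero_bound on the vectors sum theta(l) delta_l over a finite
   subgroup L, for all characters theta of L, and applying Parseval. *)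
Lemma order_zero_class_bound n (m h : 'I_n -> 'I_n -> bop (l2 R V)) (F : seq V) :
  order_zero (@bop_one R (l2 R V)) m h -> (forall i j, tga_set (m i j)) -> uniq F ->
  (forall f g v, f \in F -> g \in F -> tw v (f + g) = false) ->
  \sum_i \sum_j \sum_(g <- F) nr (m i j (delta 0) g) ^+ 2 <= 1.
Proof.
move=> oz mA uF cF; case: F uF cF => [|x0 F] uF cF.
  rewrite big1 ?ler01// => i _; rewrite big1// => j _; by rewrite big_nil.
have [G [uG sG GD]] := finite_hull [seq x0 + g | g <- x0 :: F].
(* The part of the finite group G in the right kernel of the cocycle; the hypothesis on F keeps all
   x0 + g with g in F inside it. *)
pose L := [seq l <- G | `[< forall v, tw v l = false >]].
have uL : uniq L by rewrite filter_uniq.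
have Ltw l v : l \in L -> tw v l = false by rewrite mem_filter => /andP[/asboolP].
have LD l l' : l \in L -> l' \in L -> l + l' \in L.
  move=> hl hl'; rewrite mem_filter; apply/andP; split.
    by apply/asboolP => v; rewrite twDr !Ltw.
  by move: hl hl'; rewrite !mem_filter => /andP[_ ?] /andP[_ ?]; exact: GD.
have LF g : g \in x0 :: F -> x0 + g \in L.
  move=> hg; rewrite mem_filter sG ?(map_f (fun g => x0 + g))// andbT.
  by apply/asboolP => v; apply: cF => //; rewrite mem_head.
have L0 : 0 \in L by have := LF x0 (mem_head _ _); rewrite tw_char2.
have szL : 0 < (size L)%:R :> R by rewrite ltr0n; case: (L) L0.
(* On L the commutator form reduces to l |-> tw l h, a character; those for h in hs separate L, and
   [ch x] runs through their products. *)
have [hs hhs] := separating_list L.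
pose r := size hs; pose ch (x : {ffun 'I_r -> bool}) l :=
  \big[addb/false]_(i < r) (x i && tw l (nth 0 hs i)).
have chD x l l' : ch x (l + l') = ch x l (+) ch x l'.
  by rewrite /ch -big_split; apply: eq_bigr => i _; rewrite twDl andb_addr.
have chsum l : l \in L -> \sum_x sg (ch x l) = (if l == 0 then (2 ^ r)%:R else 0) :> R[i].
  move=> hl; rewrite /ch sum_sg; case: (eqVneq l 0) => [->|l0].
    by case: existsP => //; case=> i; rewrite tw0l.
  case: existsP => // ne; exfalso; apply: ne.
  have /hasP [w wh] := hhs l hl l0; rewrite /om Ltw// => tlw.
  have iw : (index w hs < r)%N by rewrite index_mem.
  by exists (Ordinal iw); rewrite /= nth_index.
pose phi i j l := m i j (delta 0) (x0 + l).
have key x : \sum_i \sum_j nr (\sum_(l <- L) sg (ch x l) * phi i j l) ^+ 2 <= 1.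
  pose eta : l2 R V := \sum_(l <- L) sg (ch x l) *: delta l.
  pose zeta : l2 R V := \sum_(l <- L) sg (ch x l) *: delta (x0 + l).
  have nle (t : V) (T : l2 R V) : T = \sum_(l <- L) sg (ch x l) *: delta (t + l) -> nr T ^+ 2 = (size L)%:R.
    move=> ->; rewrite -Re_dot dot_suml (eq_big_seq (fun=> 1)).
      by rewrite big_const_seq count_predT iter_addr addr0 raddfMn.
    move=> l hl; rewrite dotZl dot_sumr (bigD1_seq l)//= big1_seq => [|l' /andP[ne _]].
      by rewrite dotZr dot_delta deltaE eqxx sg_conj mulr1 addr0 sgK.
    by rewrite dotZr dot_delta deltaE (inj_eq (addrI _)) (negbTE ne) mulr0.
  have neta : nr eta ^+ 2 = (size L)%:R.
    by apply: (nle 0); apply: eq_bigr => l _; rewrite add0r.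
  have nzeta : nr zeta ^+ 2 = (size L)%:R by exact: (nle x0).
  (* Each point l' of zeta contributes the same Fourier coefficient of [phi i j], after the
     substitution of l + l' for l; hence the factor |L|, which cancels against the norms of eta and
     zeta. *)
  have e i j : dot (m i j eta) zeta = (size L)%:R * \sum_(l <- L) sg (ch x l) * phi i j l.
    rewrite /zeta dot_sumr (eq_big_seq (fun=> \sum_(l <- L) sg (ch x l) * phi i j l)).
      by rewrite big_const_seq count_predT iter_addr addr0 mulr_natl.
    move=> l' hl'; rewrite dotZr sg_conj dot_delta /eta bop_sum l2_sumE mulr_sumr.
    rewrite [RHS](perm_big [seq l + l' | l <- L])/=; last first.
      apply: uniq_perm => //; first by rewrite map_inj_uniq//; exact: addIr.
      move=> l; apply/idP/mapP => [hl|[l2' hl2 ->]]; last exact: LD.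
      by exists (l + l'); rewrite ?LD// addKK.
    rewrite big_map; apply: eq_big_seq => l hl.
    rewrite bopZ l2ZE tga_delta// monoE Ltw// sg0 mul1r chD -sgM /phi.
    by rewrite mulrA [sg (ch x l') * _]mulrC -addrA [l' + l]addrC.
  have := order_zero_bound eta zeta oz; rewrite neta nzeta.
  under eq_bigr do under eq_bigr do rewrite e nrM exprMn.
  rewrite (_ : nr ((size L)%:R : R[i]) = (size L)%:R); last first.
    by rewrite -[_%:R](rmorph_nat (real_complex R)) nrR ger0_norm.
  under eq_bigr do rewrite -mulr_sumr.
  by rewrite -mulr_sumr expr2 -[leRHS]mulr1 ler_pM2l// mulr_gt0.
have pars i j : \sum_x nr (\sum_(l <- L) sg (ch x l) * phi i j l) ^+ 2 =
    (2 ^ r)%:R * \sum_(l <- L) nr (phi i j l) ^+ 2.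
  apply: (@complexI R); rewrite rmorph_sum rmorphM rmorph_nat rmorph_sum /=.
  under eq_bigr do rewrite -mul_conj rmorph_sum mulr_suml.
  rewrite exchange_big /= mulr_sumr; apply: eq_big_seq => l hl.
  under eq_bigr do rewrite mulr_sumr.
  rewrite exchange_big /= (bigD1_seq l)//= [X in _ + X]big1_seq ?addr0.
    under eq_bigr do rewrite rmorphM /= sg_conj mulrACA sgK mul1r mul_conj.
    rewrite sumr_const card_ffun card_bool card_ord.
    by rewrite mulr_natl.
  move=> l' /andP[ne hl'].
  under eq_bigr do rewrite rmorphM /= sg_conj mulrACA sgM -chD.
  by rewrite -mulr_suml chsum ?LD// add_eq add0r eq_sym (negbTE ne) mul0r.
have : \sum_i \sum_j (2 ^ r)%:R * (\sum_(l <- L) nr (phi i j l) ^+ 2) <= (2 ^ r)%:R.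
  under eq_bigr do under eq_bigr do rewrite -pars.
  under eq_bigr do rewrite exchange_big.
  rewrite exchange_big /=; apply: (@le_trans _ _ (\sum_(x : {ffun 'I_r -> bool}) 1)).
    by apply: ler_sum => x _; exact: key.
  by rewrite sumr_const card_ffun card_bool card_ord.
under eq_bigr do rewrite -mulr_sumr.
rewrite -mulr_sumr -[leRHS]mulr1 ler_pM2l ?ltr0n ?expn_gt0//; apply: le_trans.
apply: ler_sum => i _; apply: ler_sum => j _; rewrite /phi.
have -> : \sum_(g <- x0 :: F) nr (m i j (delta 0) g) ^+ 2 =
   \sum_(l <- [seq x0 + g | g <- x0 :: F]) nr (m i j (delta 0) (x0 + l)) ^+ 2.
  by rewrite big_map; apply: eq_bigr => g _; rewrite addrA tw_char2 add0r.
apply: (@ler_sum_subset R _ (fun l => nr (m i j (delta 0) (x0 + l)) ^+ 2)).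
- by move=> l; exact: sqr_ge0.
- by rewrite map_inj_uniq//; exact: addrI.
- by move=> l /mapP [g hg ->]; exact: LF.
Qed.

End OrderZero.

Section SmallFrames.
Context {R : realType} {V : twist} {p q : nat} {S : cstarAlgType R}.
Context (dd : prime_dim_drop p q S) (f : S -> bop (l2 R V)) (hf : star_hom f).
Hypothesis fA : forall b, tga_set (f b).
Hypothesis f1 : forall e, is_unit e -> f e = (@bop_one R (l2 R V)).

(** The scaling by n^(-1/2) gives the squares the weight 1 / n that they have in [dd_frames]. *)
Definition oz_seq n (m : 'I_n -> 'I_n -> S) : seq S :=
  [seq ((Num.sqrt n%:R)^-1 : R)%:C *: m x.1 x.2 | x <- enum {: 'I_n * 'I_n}].

Lemma oz_seq_sum n (m : 'I_n -> 'I_n -> S) (F : S -> R) :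
  (forall (k : R) a, F (k%:C *: a) = k ^+ 2 * F a) ->
  \sum_(z <- oz_seq m) F z = n%:R^-1 * \sum_i \sum_j F (m i j).
Proof.
move=> hF; rewrite big_map big_enum /=; under eq_bigr do rewrite hF exprVn sqr_sqrtr ?ler0n//.
by rewrite -mulr_sumr pair_big.
Qed.

Lemma sum_sqr_oz n (m : 'I_n -> 'I_n -> S) x : (forall i j, star (m i j) = m j i) ->
  \sum_i \sum_j nr (f (m i j) x) ^+ 2 =
  complex.Re (dot (f (\sum_i \sum_j m j i ** m i j) x) x).
Proof.
move=> sm; rewrite (sh_sum hf) bop_sumE dot_suml raddf_sum; apply: eq_bigr => i _ /=.
rewrite (sh_sum hf) bop_sumE dot_suml raddf_sum; apply: eq_bigr => j _ /=.
by rewrite (nr_sh_sqr _ _ hf) sm.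
Qed.

(** The two order zero families of [dd_frames] with weights 1 / p and 1 / q. As the adjoint of m i j
    is m j i, the frame identity also holds for adjoints; on one class each family contributes at
    most 1 before weighting, so together at most 1 / p + 1 / q. *)
Lemma small_frame (k : nat) : (0 < k)%N -> (k <= p)%N -> (k <= q)%N ->
  exists es : seq S, [/\ forall x, \sum_(z <- es) nr (f z x) ^+ 2 = nr x ^+ 2,
    forall x, \sum_(z <- es) nr (star (f z) x) ^+ 2 = nr x ^+ 2 &
    forall F : seq V, uniq F -> (forall g h v, g \in F -> h \in F -> tw v (g + h) = false) ->
      \sum_(z <- es) \sum_(g <- F) nr (f z (delta 0) g) ^+ 2 <= 2 / k%:R].
Proof.
move=> k0 kp kq; have [[p0 q0 _] [ev [evf evs evi evh]]] := dd.
have [m [h [m' [h' [oz oz' e]]]]] := dd_frames evs evi evh p0 q0.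
have sm i j := order_zero_star i j oz; have sm' i j := order_zero_star i j oz'.
have u1 := dd_unitP evs evi evh.
have fZ (r : R) a x : nr (f (r%:C *: a) x) ^+ 2 = r ^+ 2 * nr (f a x) ^+ 2.
  by rewrite (shZ hf) bopZE nrZ nrR exprMn real_normK ?num_real.
have fr x : p%:R^-1 * (\sum_i \sum_j nr (f (m i j) x) ^+ 2) +
            q%:R^-1 * (\sum_i \sum_j nr (f (m' i j) x) ^+ 2) = nr x ^+ 2.
  have ReZ (r : R) (z : R[i]) : r * complex.Re z = complex.Re (r%:C * z).
    by case: z => a1 a2 /=; rewrite mul0r subr0.
  have nC n : ((n%:R^-1 : R)%:C : R[i]) = n%:R^-1 by rewrite fmorphV rmorph_nat.
  rewrite !sum_sqr_oz// !ReZ -!dotZl -!bopZE -!(shZ hf) -raddfD -dotDl -bopDE -(shD hf) !nC e f1//.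
  by rewrite -[LHS]/(complex.Re _) -Re_dot.
have cat (F : S -> R) : (forall (r : R) a, F (r%:C *: a) = r ^+ 2 * F a) ->
    \sum_(z <- oz_seq m ++ oz_seq m') F z =
    p%:R^-1 * (\sum_i \sum_j F (m i j)) + q%:R^-1 * (\sum_i \sum_j F (m' i j)).
  by move=> hF; rewrite big_cat /= !oz_seq_sum.
exists (oz_seq m ++ oz_seq m'); split => [x|x|F uF hF].
- by rewrite cat ?fr.
- have sZ (r : R) a : nr (star (f (r%:C *: a)) x) ^+ 2 = r ^+ 2 * nr (star (f a) x) ^+ 2.
    by rewrite -!(shS hf) starZ conjR fZ.
  rewrite cat// -fr; congr (_ * _ + _ * _).
    by rewrite exchange_big; do 2 apply: eq_bigr => ? _; rewrite -(shS hf) sm.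
  by rewrite exchange_big; do 2 apply: eq_bigr => ? _; rewrite -(shS hf) sm'.
- have sZ (r : R) a : \sum_(g <- F) nr (f (r%:C *: a) (delta 0) g) ^+ 2 =
      r ^+ 2 * \sum_(g <- F) nr (f a (delta 0) g) ^+ 2.
    rewrite mulr_sumr; apply: eq_bigr => g _.
    by rewrite (shZ hf) bopZE l2ZE nrM nrR exprMn real_normK ?num_real.
  rewrite cat//.
  have := order_zero_hom hf oz; rewrite f1// => /order_zero_class_bound/(_ _ uF hF) b1.
  have := order_zero_hom hf oz'; rewrite f1// => /order_zero_class_bound/(_ _ uF hF) b2.
  have inv n : (0 < n)%N -> (k <= n)%N -> (n%:R^-1 : R) <= k%:R^-1.
    by move=> n0 kn; rewrite lef_pV2 ?posrE ?ltr0n// ler_nat.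
  have -> : 2 / k%:R = k%:R^-1 + k%:R^-1 :> R by rewrite mulrDl mul1r.
  apply: lerD.
    rewrite -[leRHS]mulr1; apply: ler_pM; rewrite ?invr_ge0 ?ler0n ?inv ?b1//.
    by do 3 (apply: sumr_ge0 => ? _); exact: sqr_ge0.
  rewrite -[leRHS]mulr1; apply: ler_pM; rewrite ?invr_ge0 ?ler0n ?inv ?b2//.
  by do 3 (apply: sumr_ge0 => ? _); exact: sqr_ge0.
Qed.

End SmallFrames.

(** * The averaging argument *)

Definition extends (s : seq bool) (chi : nat -> bool) := forall i, (i < size s)%N -> chi i = nth false s i.

(** Baire category on the Cantor space: some N n is dense in a cylinder. Otherwise each prefix could
    be extended so as to leave N n, and the limit of the prefixes would lie in no N n. *)
Lemma cantor_baire (N : nat -> (nat -> bool) -> Prop) : (forall chi, exists n, N n chi) ->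
  exists n s, forall t, exists chi, extends (s ++ t) chi /\ N n chi.
Proof.
move=> hN; apply: contrapT => h.
have hT n s : {t | forall chi, extends (s ++ t) chi -> ~ N n chi}.
  apply: cid; apply: contrapT => h2; apply: h; exists n, s => t; apply: contrapT => h3.
  by apply: h2; exists t => chi e Nn; apply: h3; exists chi.
pose T n s := sval (hT n s).
(* The appended bit makes the prefixes grow strictly, so that together they determine chi. *)
pose s_ := fix s_ n := if n is n'.+1 then rcons (s_ n' ++ T n' (s_ n')) false else [::].
have sS n : s_ n.+1 = s_ n ++ rcons (T n (s_ n)) false by rewrite /= rcons_cat.
have size_s n : (n <= size (s_ n))%N.
  by elim: n => // n IH; rewrite sS size_cat size_rcons addnS ltnS (leq_trans IH)// leq_addr.
have pre n d i : (i < size (s_ n))%N -> nth false (s_ (d + n)%N) i = nth false (s_ n) i.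
  move=> hi; elim: d => // d IH; rewrite addSn sS nth_cat IH ifT//.
  apply: leq_trans hi _; elim: d {IH} => // d IH; apply: leq_trans IH _.
  by rewrite addSn sS size_cat leq_addr.
pose chi i := nth false (s_ i.+1) i.
have hchi n : extends (s_ n) chi.
  move=> i hi; rewrite /chi; case: (leqP n i.+1) => [le|lt].
    by rewrite -(subnK le) pre.
  by rewrite -(subnK (ltnW lt)) pre// size_s.
have [n Nn] := hN chi; apply: (svalP (hT n (s_ n)) chi) Nn => i hi.
by rewrite (hchi n.+1) /= ?size_rcons ?nth_rcons ?hi// ltnW.
Qed.

(** * Countable dense vectors and common finite supports *)

Section CountableDense.
Context {R : realType} {S : eqType} (gam : nat -> S).

Definition ccoef (t : nat * rat * rat) : R[i] := (ratr t.1.2)%:C + 'i%C * (ratr t.2)%:C.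
Definition cvec (l : seq (nat * rat * rat)) : l2 R S := \sum_(t <- l) ccoef t *: delta (gam t.1.1).

Lemma ccoef_dense (z : R[i]) i (e : R) : 0 < e -> exists t, t.1.1 = i /\ nr (z - ccoef t) < e.
Proof.
move=> e0; have e2 : 0 < e / 2 by rewrite divr_gt0.
have app (x : R) : exists r : rat, `|x - ratr r| < e / 2.
  have [|r] := @rat_in_itvoo R (x - e / 2) (x + e / 2).
    by rewrite ltrD2l (lt_trans (_ : - (e / 2) < 0)) ?oppr_lt0.
  rewrite in_itv /= => /andP[h1 h2]; exists r.
  by rewrite ltr_norml; apply/andP; split; lra.
have [a ha] := app (complex.Re z); have [b hb] := app (complex.Im z).
exists (i, a, b); split => //; apply: le_lt_trans (nr_le_ReIm _) _.
rewrite [e]splitr; case: z ha hb => x y /= ha hb; rewrite /ccoef /=.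
by apply: ltrD; rewrite ?(mul0r, mul1r, mulr0, subr0, addr0, add0r).
Qed.

Lemma cvec_dense (a : l2 R S) (e : R) : (forall f, (forall n, gam n != f) -> a f = 0) -> 0 < e ->
  exists l, nr (a - cvec l) < e.
Proof.
move=> supp e0; have e2 : 0 < e / 2 by rewrite divr_gt0.
have [r _ ar] := delta_dense a e2.
suff [l hl] : exists l, nr (\sum_(f <- r) a f *: delta f - cvec l) < e / 2.
  by exists l; rewrite [e]splitr (le_lt_trans (nr_tri _ _ _) (ltrD ar hl)).
move: (e / 2) e2 => d d0 {ar e e0}.
elim: r d d0 => [|f r IH] d d0; first by exists [::]; rewrite /cvec !big_nil subrr nr0.
have d2 : 0 < d / 2 by rewrite divr_gt0.
have [l hl] := IH _ d2; rewrite big_cons.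
case: (pselect (exists n, gam n = f)) => [[n nf]|nf].
  have [t [tn ht]] := ccoef_dense (a f) n d2.
  exists (t :: l); rewrite /cvec big_cons -/(cvec l) tn nf opprD addrACA -scalerBl.
  by apply: le_lt_trans (nrD _ _) _; rewrite nrZ nr_delta mulr1 [d]splitr ltrD.
exists l; rewrite supp ?scale0r ?add0r; last by move=> n; apply/eqP => e; apply: nf; exists n.
by apply: lt_trans hl _; rewrite ltr_pdivrMr// mulr_natr mulr2n ltrDl.
Qed.

Lemma common_tail (xs : seq (l2 R S)) (e : R) : 0 < e -> exists2 F : seq S, uniq F &
  \sum_(x <- xs) nr (x - restr (mem F) x) ^+ 2 <= e.
Proof.
move=> e0.
(* The induction enlarges F, so the bound is carried for every larger list. *)
suff [F uF hF] : exists2 F : seq S, uniq F &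
    forall F' : seq S, {subset F <= F'} -> \sum_(x <- xs) nr (x - restr (mem F') x) ^+ 2 <= e.
  by exists F => //; exact: hF.
elim: xs e e0 => [|x xs IH] e e0; first by exists [::] => // F _; rewrite big_nil ltW.
have e2 : 0 < e / 2 by rewrite divr_gt0.
have [F1 _ h1] := IH _ e2; have [F2 _ h2] := l2_tail x e2.
exists (undup (F1 ++ F2)); first exact: undup_uniq.
move=> F' sF; rewrite big_cons [e]splitr addrC lerD//.
  by apply: h1 => g gF; apply: sF; rewrite mem_undup mem_cat gF.
have e2' := ltW e2; rewrite -(sqr_sqrtr e2').
rewrite lerXn2r ?nnegrE ?nr_ge0 ?sqrtr_ge0//; apply: l2_nr_le; first exact: sqrtr_ge0.
move=> s us; rewrite sqr_sqrtr//.
have cE g : (x - restr (mem F') x) g = if g \in F' then 0 else x g.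
  by rewrite l2BE restrE -[mem F' g]/(g \in F'); case: ifP => _; rewrite ?subrr ?subr0.
under eq_bigr do rewrite cE.
rewrite (bigID (fun g => g \in F')) /= big1 ?add0r => [|g ->]; last by rewrite nr0 expr0n.
rewrite -big_filter; under eq_big_seq => g.
  rewrite mem_filter => /andP[ng _]; rewrite (negbTE ng); over.
apply: h2; first by rewrite filter_uniq.
move=> g; rewrite mem_filter => /andP[ng _]; apply/negP => gF; move: ng.
by rewrite sF// mem_undup mem_cat gF orbT.
Qed.

End CountableDense.

(** * Averaging over characters *)

Section NoInvariantVectors.
Context {R : realType} {V : twist}.
(** [emb] identifies the Cantor group with K, and [c g] is the finitely supported component of g.
    Elements with equal c differ by an element of the right kernel of the cocycle, and the character
    of [emb k] reads g through [c g] only. *)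
Context (emb : (nat -> bool) -> V) (c : V -> nat -> bool).
Hypothesis tw_emb_r : forall v k, tw v (emb k) = false.
Hypothesis c_fin : forall g, exists M, forall n, (M <= n)%N -> c g n = false.
Hypothesis tw_emb_l : forall k g M, (forall n, (M <= n)%N -> c g n = false) ->
  tw (emb k) g = \big[addb/false]_(i < M) (k i && c g i).
Hypothesis c_class : forall f g v, c f =1 c g -> tw v (f + g) = false.
Context {W : Type} (op : W -> bop (l2 R V)).
Hypothesis opA : forall w, tga_set (op w).
Implicit Types (k chi : nat -> bool) (f g : V) (x y d : l2 R V).

(** [rho (emb chi)] is a translation without sign, so conjugating by it multiplies the coefficients
    of [op w] by the character of [emb chi]; [sgn chi] is this multiplication. *)
Definition rgt_tr chi w x : l2 R V := rho (emb chi) (rgt (op w) (rho (emb chi) x)).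
Definition sgn chi : bop (l2 R V) := mono 0 (fun i => tw (emb chi) i).

Lemma rgt_tr_lin chi w (a : R[i]) x y : rgt_tr chi w (a *: x + y) = a *: rgt_tr chi w x + rgt_tr chi w y.
Proof. by rewrite /rgt_tr bopD bopZ rgt_lin bopD bopZ. Qed.

Lemma rgt_trB chi w x y : rgt_tr chi w (x - y) = rgt_tr chi w x - rgt_tr chi w y.
Proof. by rewrite addrC -scaleN1r rgt_tr_lin scaleN1r addrC. Qed.

Lemma rgt_tr_delta chi w f : rgt_tr chi w (delta f) = lam f (sgn chi (op w (delta 0))).
Proof.
rewrite /rgt_tr rho_delta tw_emb_r sg0 scale1r rgt_delta//.
apply: l2_ext => i; rewrite !monoE tw_emb_r sg0 mul1r addr0.
rewrite (_ : i + emb chi + (f + emb chi) = i + f); last first.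
  by rewrite addrACA tw_char2 addr0.
by rewrite twDl -sgM mulrA.
Qed.

Lemma rgt_tr_sum chi w (I : Type) (l : seq I) (co : I -> R[i]) (pt : I -> V) :
  rgt_tr chi w (\sum_(t <- l) co t *: delta (pt t)) =
  \sum_(t <- l) co t *: lam (pt t) (sgn chi (op w (delta 0))).
Proof.
elim: l => [|t l IH].
  by rewrite !big_nil -[X in rgt_tr _ _ X](subrr (0 : l2 R V)) rgt_trB subrr.
by rewrite !big_cons rgt_tr_lin IH rgt_tr_delta.
Qed.

Section Frame.
Context (es : seq W).
Hypothesis frame : forall x, \sum_(w <- es) nr (op w x) ^+ 2 = nr x ^+ 2.
Hypothesis frame_star : forall x, \sum_(w <- es) nr (star (op w) x) ^+ 2 = nr x ^+ 2.

(** The two frame identities bound the left and the right contribution of d - a by its squared norm,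
    so the error does not grow with the size of the frame. *)
Lemma near_invariant chi (a d : l2 R V) (e : R) : (forall w, op w a = rgt_tr chi w a) ->
  nr (a - d) <= e -> \sum_(w <- es) nr (op w d - rgt_tr chi w d) ^+ 2 <= 4 * e ^+ 2.
Proof.
move=> ha ad; pose x := d - a.
have -> : \sum_(w <- es) nr (op w d - rgt_tr chi w d) ^+ 2 =
    \sum_(w <- es) nr (op w x + - rgt_tr chi w x) ^+ 2.
  apply: eq_bigr => w _; congr (nr _ ^+ 2).
  by rewrite /x bopB rgt_trB ha opprB addrA subrK.
apply: (@le_trans _ _ (\sum_(w <- es) (2 * nr (op w x) ^+ 2 + 2 * nr (rgt_tr chi w x) ^+ 2))).
  by apply: ler_sum => w _; apply: le_trans (nr_sqrD_le _ _) _; rewrite nrN.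
rewrite big_split -!mulr_sumr /= frame.
under [X in _ + 2 * X]eq_bigr do rewrite /rgt_tr nr_mono nr_rgt.
rewrite frame_star nr_tconj nr_mono.
have : nr x ^+ 2 <= e ^+ 2 by rewrite lerXn2r ?nnegrE ?nr_ge0 ?(le_trans (nr_ge0 _) ad)// nrC.
by lra.
Qed.

(* s prescribes chi on [0, size s), T on [size s, size s + r). *)
Lemma sum_sgn (s : seq bool) r (chi : {ffun 'I_r -> bool} -> nat -> bool) g :
  (forall T : {ffun 'I_r -> bool}, extends (s ++ [seq T i | i <- enum 'I_r]) (chi T)) ->
  (forall n, (size s + r <= n)%N -> c g n = false) ->
  nr (\sum_(T : {ffun 'I_r -> bool}) sg (tw (emb (chi T)) g) : R[i]) =
  if [exists i : 'I_r, c g (size s + i)%N] then 0 else (2 ^ r)%:R.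
Proof.
move=> hchi hg.
have e (T : {ffun 'I_r -> bool}) : tw (emb (chi T)) g = \big[addb/false]_(i < size s) (nth false s i && c g i) (+)
    \big[addb/false]_(i < r) (T i && c g (size s + i)%N).
  rewrite (tw_emb_l _ hg) big_split_ord /=; congr (_ (+) _); apply: eq_bigr => i _.
    have hi : (i < size (s ++ [seq T i | i <- enum 'I_r]))%N by rewrite size_cat ltn_addr.
    by rewrite (hchi T _ hi) nth_cat ltn_ord.
  have hi : (size s + i < size (s ++ [seq T i | i <- enum 'I_r]))%N.
    by rewrite size_cat size_map size_enum_ord ltn_add2l.
  rewrite (hchi T _ hi) nth_cat ltnNge leq_addr /=.
  by rewrite addKn (nth_map i) ?size_enum_ord// nth_ord_enum.
under eq_bigr do rewrite e -sgM.
rewrite -mulr_sumr nrM nr_sg mul1r sum_sg; case: ifP => _; first by rewrite nr0.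
by rewrite -[_%:R](rmorph_nat (real_complex R)) nrR ger0_norm.
Qed.

(** Elements whose component c vanishes from m on fall into at most 2^m classes modulo the right
    kernel, and kap bounds the mass of each. *)
Lemma class_sum (kap : R) (m r : nat) (F : seq V) : uniq F ->
  (forall F' : seq V, uniq F' -> (forall g h v, g \in F' -> h \in F' -> tw v (g + h) = false) ->
      \sum_(w <- es) \sum_(g <- F') nr (op w (delta 0) g) ^+ 2 <= kap) ->
  (forall g n, g \in F -> (m <= n)%N -> c g n = false) ->
  \sum_(w <- es) \sum_(g <- F) nr (op w (delta 0) g) ^+ 2 <= (2 ^ m)%:R * kap.
Proof.
move=> uF hk hF.
pose sig g := [ffun i : 'I_m => c g i].
have -> : \sum_(w <- es) \sum_(g <- F) nr (op w (delta 0) g) ^+ 2 =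
    \sum_(s : {ffun 'I_m -> bool}) \sum_(w <- es) \sum_(g <- [seq g <- F | sig g == s]) nr (op w (delta 0) g) ^+ 2.
  rewrite [RHS]exchange_big /=; apply: eq_bigr => w _.
  under [RHS]eq_bigr do rewrite big_filter.
  by rewrite (partition_big sig xpredT).
apply: (@le_trans _ _ (\sum_(s : {ffun 'I_m -> bool}) kap)).
  apply: ler_sum => s _; apply: hk; first by rewrite filter_uniq.
  move=> g h v; rewrite !mem_filter => /andP[/eqP gs gF] /andP[/eqP hs hhF].
  apply: c_class => n; case: (ltnP n m) => nm; last by rewrite !hF.
  by have := congr1 (fun s : {ffun 'I_m -> bool} => s (Ordinal nm)) (etrans gs (esym hs)); rewrite !ffunE.
by rewrite sumr_const card_ffun card_bool card_ord mulr_natl.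
Qed.

(** Average op w d against its twisted right multiplications over all continuations of s. On the
    right this leaves, up to the tail tau, only coefficients with no component beyond s, whose total
    mass over the frame [class_sum] controls; the frame identity then bounds |d|^2. The factor D^2
    counts the left translates that make up d. *)
Lemma frame_average (kap tau : R) (s : seq bool) (d : l2 R V) (D : R) (e : R)
    (I : Type) (l : seq I) (co : I -> R[i]) (pt : I -> V) : 0 < tau ->
  (forall F' : seq V, uniq F' -> (forall g h v, g \in F' -> h \in F' -> tw v (g + h) = false) ->
      \sum_(w <- es) \sum_(g <- F') nr (op w (delta 0) g) ^+ 2 <= kap) ->
  d = \sum_(t <- l) co t *: delta (pt t) -> D = \sum_(t <- l) nr (co t) ->
  (forall t, exists chi, extends (s ++ t) chi /\
     \sum_(w <- es) nr (op w d - rgt_tr chi w d) ^+ 2 <= e) ->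
  nr d ^+ 2 <= 2 * e + 2 * D ^+ 2 * (2 * ((2 ^ size s)%:R * kap) + 2 * tau).
Proof.
move=> tau0 hk dE DE hchi; pose m := size s; pose y w := op w (delta 0).
have [F uF tailF] := common_tail [seq y w | w <- es] tau0.
rewrite big_map in tailF.
have [M hM] : exists M, forall g n, g \in F -> (M <= n)%N -> c g n = false.
  elim: (F) => [|g F' [M hM]]; first by exists 0%N.
  have [M' hM'] := c_fin g; exists (maxn M M') => g' n; rewrite inE => /orP[/eqP ->|gF] Mn.
    by apply: hM'; apply: leq_trans Mn; exact: leq_maxr.
  by apply: hM gF _; apply: leq_trans Mn; exact: leq_maxl.
(* All components of F vanish from M on, so M free bits after the prefix of length m reach each of
   them beyond m. *)
pose r := M; pose X := {ffun 'I_r -> bool}.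
have hT (T : X) : {chi | extends (s ++ [seq T i | i <- enum 'I_r]) chi /\
     \sum_(w <- es) nr (op w d - rgt_tr chi w d) ^+ 2 <= e} by apply: cid; exact: hchi.
pose chi (T : X) := sval (hT T).
have ext (T : X) : extends (s ++ [seq T i | i <- enum 'I_r]) (chi T) by case: (svalP (hT T)).
have cX : #|{: X}| = (2 ^ r)%N by rewrite card_ffun card_bool card_ord.
have X0 : (0 < #|{: X}|)%N by rewrite cX expn_gt0.
have X0' : 0 < #|{: X}|%:R :> R by rewrite ltr0n.
pose a : R := #|{: X}|%:R^-1.
pose v w := a%:C *: \sum_(T : X) (op w d - rgt_tr (chi T) w d).
pose M_ (x : l2 R V) := a%:C *: \sum_(T : X) sgn (chi T) x.
have M_D x z : M_ (x + z) = M_ x + M_ z.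
  by rewrite /M_ -scalerDr -big_split; congr (_ *: _); apply: eq_bigr => T _; rewrite bopD.
pose u w := M_ (y w).
have RE (T : X) w : rgt_tr (chi T) w d = \sum_(t <- l) co t *: lam (pt t) (sgn (chi T) (y w)).
  by rewrite dE rgt_tr_sum.
have opE w : op w d = v w + \sum_(t <- l) co t *: lam (pt t) (u w).
  have -> : \sum_(t <- l) co t *: lam (pt t) (u w) = a%:C *: \sum_(T : X) rgt_tr (chi T) w d.
    rewrite (eq_bigr _ (fun T _ => RE T w)) exchange_big scaler_sumr; apply: eq_bigr => t _.
    by rewrite /u /M_ bopZ bop_sum -scaler_sumr !scalerA [co t * _]mulrC.
  rewrite /v sumrB scalerBr subrK sumr_const -scaler_nat scalerA.
  by rewrite -(rmorph_nat (real_complex R)) -rmorphM mulVf ?gt_eqF// scale1r.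
have hv : \sum_(w <- es) nr (v w) ^+ 2 <= e.
  apply: (@le_trans _ _ (\sum_(w <- es) a * \sum_(T : X) nr (op w d - rgt_tr (chi T) w d) ^+ 2)).
    by apply: ler_sum => w _; exact: nr_avg_sqr.
  rewrite -mulr_sumr exchange_big /= ler_pdivrMl//.
  apply: (@le_trans _ _ (\sum_(T : X) e)).
    by apply: ler_sum => T _; case: (svalP (hT T)).
  by rewrite sumr_const mulr_natl.
(* Summing over the free bits cancels each coefficient with a nonzero component in [m, m + r); F0
   collects the survivors. *)
pose F0 := [seq g <- F | ~~ [exists i : 'I_r, c g (m + i)%N]].
have first_le w : nr (M_ (restr (mem F) (y w))) ^+ 2 <= \sum_(g <- F0) nr (y w g) ^+ 2.
  have S0 : 0 <= \sum_(g <- F0) nr (y w g) ^+ 2 by apply: sumr_ge0 => g _; exact: sqr_ge0.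
  rewrite -(sqr_sqrtr S0) lerXn2r ?nnegrE ?nr_ge0 ?sqrtr_ge0//.
  apply: l2_nr_le => [|z uz]; rewrite ?sqrtr_ge0// sqr_sqrtr//.
  have coefE g : nr (M_ (restr (mem F) (y w)) g) = if g \in F0 then nr (y w g) else 0.
    rewrite /M_ l2ZE l2_sumE; under eq_bigr do rewrite monoE addr0 restrE -[mem F _]/(_ \in F).
    rewrite mem_filter; case: (boolP (g \in F)) => gF; last first.
      by rewrite big1 ?mulr0 ?nr0 ?andbF// => T _; rewrite mulr0.
    rewrite -mulr_suml !nrM (@sum_sgn s r chi g ext) -/m; last first.
      by move=> n Mn; apply: hM gF _; apply: leq_trans Mn; exact: leq_addl.
    rewrite andbT; case: ifP => _ /=; first by rewrite mul0r mulr0.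
    rewrite nrR ger0_norm ?invr_ge0 ?ltW// mulrA -cX mulVf ?mul1r//.
    by rewrite gt_eqF.
  under eq_bigr do rewrite coefE.
  apply: (@le_trans _ _ (\sum_(g <- [seq g <- z | g \in F0]) nr (y w g) ^+ 2)).
    rewrite big_filter [X in _ <= X]big_mkcond; apply: ler_sum => g _.
    by case: ifP => // _; rewrite expr0n.
  apply: (@ler_sum_subset R _ (fun g => nr (y w g) ^+ 2)); rewrite ?filter_uniq//.
    by move=> g; exact: sqr_ge0.
  by move=> g; rewrite mem_filter => /andP[].
have second_le w : nr (M_ (y w - restr (mem F) (y w))) ^+ 2 <= nr (y w - restr (mem F) (y w)) ^+ 2.
  apply: le_trans (nr_avg_sqr _ X0) _; rewrite ler_pdivrMl//.
  by under eq_bigr do rewrite nr_mono; rewrite sumr_const mulr_natl.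
have hu : \sum_(w <- es) nr (u w) ^+ 2 <= 2 * ((2 ^ m)%:R * kap) + 2 * tau.
  apply: (@le_trans _ _ (\sum_(w <- es) (2 * (\sum_(g <- F0) nr (y w g) ^+ 2) +
      2 * nr (y w - restr (mem F) (y w)) ^+ 2))).
    apply: ler_sum => w _; rewrite /u -{1}[y w](subrK (restr (mem F) (y w))) addrC M_D.
    apply: le_trans (nr_sqrD_le _ _) _; apply: lerD; rewrite ler_pM2l//.
  rewrite big_split -!mulr_sumr /=; apply: lerD; rewrite ler_pM2l//.
  apply: (@class_sum kap m r F0) => //; first by rewrite filter_uniq.
  move=> g n; rewrite mem_filter => /andP[ng gF] mn.
  case: (ltnP n (m + r)%N) => nr'; last first.
    by apply: hM gF _; apply: leq_trans nr'; exact: leq_addl.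
  have ni : (n - m < r)%N by rewrite ltn_subLR.
  by have /existsPn/(_ (Ordinal ni)) := ng; rewrite /= subnKC// => /negbTE.
have D0 : 0 <= D by rewrite DE sumr_ge0// => t _; exact: nr_ge0.
rewrite -frame; apply: (@le_trans _ _ (\sum_(w <- es) (2 * nr (v w) ^+ 2 + 2 * D ^+ 2 * nr (u w) ^+ 2))).
  apply: ler_sum => w _; rewrite opE; apply: le_trans (nr_sqrD_le _ _) _.
  rewrite lerD2l -mulrA ler_pM2l// -exprMn lerXn2r ?nnegrE ?nr_ge0 ?mulr_ge0 ?nr_ge0//.
  apply: le_trans (nr_sum _ _ _) _; rewrite DE mulr_suml; apply: ler_sum => t _.
  by rewrite nrZ nr_mono.
rewrite big_split -!mulr_sumr /=; apply: lerD; first by rewrite ler_pM2l.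
by rewrite ler_wpM2l ?mulr_ge0 ?sqr_ge0.
Qed.

End Frame.

(* Uncountably many vectors in the separable space l2 (range gam): by Baire one
   vector d is within 1/8 of the vectors attached to a somewhere dense set of
   characters, and averaging over these contradicts the norm of d. *)
Lemma no_invariant_vectors (gam : nat -> V) :
  (forall kap : R, 0 < kap -> exists es : seq W,
    [/\ forall x, \sum_(w <- es) nr (op w x) ^+ 2 = nr x ^+ 2,
        forall x, \sum_(w <- es) nr (star (op w) x) ^+ 2 = nr x ^+ 2 &
        forall F : seq V, uniq F -> (forall g h v, g \in F -> h \in F -> tw v (g + h) = false) ->
          \sum_(w <- es) \sum_(g <- F) nr (op w (delta 0) g) ^+ 2 <= kap]) ->
  ~ (forall chi, exists a : l2 R V, [/\ nr a = 1, (forall f, ~ range gam f -> a f = 0) &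
      forall w, op w a = rgt_tr chi w a]).
Proof.
move=> hframe hinv; pose e : R := 8%:R^-1.
have e0 : 0 < e by rewrite invr_gt0.
pose N n chi := if unpickle n is Some l then exists a : l2 R V, [/\ nr a = 1,
  (forall w, op w a = rgt_tr chi w a) & nr (a - cvec gam l) <= e] else False.
have [|n [s hs]] := @cantor_baire N.
  move=> chi; have [a [na sa ia]] := hinv chi.
  have [|l hl] := @cvec_dense R V gam a e _ e0.
    by move=> f nf; apply: sa => -[n _ nE]; have := nf n; rewrite nE eqxx.
  by exists (pickle l); rewrite /N pickleK; exists a; rewrite ltW.
move: hs; rewrite /N; case: (unpickle n) => [l hs|h]; last by have [chi []] := h [::].
pose d : l2 R V := cvec gam l; pose D : R := \sum_(t <- l) nr (@ccoef R t).
have D0 : 0 <= D by rewrite sumr_ge0// => t _; exact: nr_ge0.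
have nd : 7 / 8 <= nr d.
  have [chi [_ [a [na _ ad]]]] := hs [::].
  have := nr_tri d a 0; rewrite !subr0 na => h; have := le_trans h (lerD ad (lexx _)).
  by rewrite /e; lra.
(* With kap = tau / 2^|s| the bound of [frame_average] is 8 e^2 + 8 D^2 tau <= 1/8 + 1/2, less than
   (7/8)^2. The frame can be chosen this late because s and D are already fixed. *)
pose tau : R := (16 * (D ^+ 2 + 1))^-1.
have D1 : 0 < 16 * (D ^+ 2 + 1) by rewrite mulr_gt0// ltr_wpDl ?sqr_ge0.
have tau0 : 0 < tau by rewrite invr_gt0.
have p0 : 0 < (2 ^ size s)%:R :> R by rewrite ltr0n expn_gt0.
pose kap : R := tau / (2 ^ size s)%:R.
have [es [fr frs cl]] := hframe kap (divr_gt0 tau0 p0).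
have := @frame_average es fr kap tau s d D (4 * e ^+ 2) _ l (@ccoef R) (fun t => gam t.1.1)
  tau0 cl erefl erefl.
have -> : (2 ^ size s)%:R * kap = tau by rewrite /kap mulrC divfK// gt_eqF.
have near t : exists chi, extends (s ++ t) chi /\
    \sum_(w <- es) nr (op w d - rgt_tr chi w d) ^+ 2 <= 4 * e ^+ 2.
  have [chi [ext [a [_ ia ad]]]] := hs t; exists chi; split => //.
  exact: near_invariant ia ad.
move/(_ near).
have tE : 16 * (D ^+ 2 + 1) * tau = 1 by rewrite mulfV// gt_eqF.
have d2 : (7 / 8) ^+ 2 <= nr d ^+ 2 by rewrite lerXn2r ?nnegrE ?nr_ge0// divr_ge0.
have eE : e ^+ 2 = 64%:R^-1 by rewrite /e exprVn -natrX.
move: d2 tE; rewrite eE; move: (nr d ^+ 2) (D ^+ 2) (sqr_ge0 D) => nd2 D2 D20 d2 tE.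
rewrite leNgt => /negP; apply; nra.
Qed.

End NoInvariantVectors.

(** The units of all stages have one image u, and the elements on which u acts as a unit form a
    closed *-subalgebra containing the stages. *)
Lemma limit_unit (R : realType) (Z : cstarAlgType R) (p q : nat -> nat)
    (S : nat -> cstarAlgType R) (phi : forall n, S n -> S n.+1) (mu : forall n, S n -> Z) :
  (forall n, prime_dim_drop (p n) (q n) (S n)) ->
  (forall n e, is_unit e -> is_unit (phi n e)) -> inductive_limit phi mu ->
  forall n e, is_unit e -> is_unit (mu n e).
Proof.
move=> dd uphi lim; have [cmu _] := lim.
have hmu n : star_hom (mu n) by case: (cmu n).
have /(_ _)/cid hu n : exists e : S n, is_unit e.
  by have [_ [ev [_ evs evi evh]]] := dd n; exists (dd_unit ev); exact: (dd_unitP evs evi evh).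
pose e n := sval (hu n); have eP n : is_unit (e n) := svalP (hu n).
pose u := mu 0%N (e 0%N).
have uE n : mu n (e n) = u.
  elim: n => // n <-; have [_ <-] := cmu n.
  by rewrite (unit_uniq (eP n.+1) (uphi n _ (eP n))).
have us : star u = u by rewrite /u -(shS (hmu 0%N)) (unit_star (eP 0%N)).
have cl : closed ([set z | u ** z = z /\ z ** u = z] : set Z).
  apply/closed_nr => z h.
  have key (F : Z -> Z) : (forall x y, F (x - y) = F x - F y) ->
      (forall x, nr (F x) <= nr x * nr u) -> (forall y, u ** y = y /\ y ** u = y -> F y = y) -> F z = z.
    move=> FB Fle Fy; apply/eqP; rewrite -subr_eq0 -nr_eq0; apply/eqP/le_anti; rewrite nr_ge0 andbT.
    apply/ler_addgt0Pr => r r0; rewrite add0r.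
    have c0 : 0 < nr u + 1 by rewrite ltr_wpDl ?nr_ge0.
    have [y yu zy] := h _ (divr_gt0 r0 c0).
    have -> : F z - z = F (z - y) - (z - y) by rewrite FB (Fy y yu) opprB addrA subrK.
    apply: le_trans (nrB _ _) _; apply: (@le_trans _ _ (nr (z - y) * (nr u + 1))).
      by rewrite mulrDr mulr1 lerD2r.
    by rewrite -ler_pdivlMr// ltW.
  split; [apply: (key (fun x => u ** x)) | apply: (key (fun x => x ** u))].
  - by move=> x y; rewrite cmulBr.
  - by move=> x; rewrite mulrC; exact: nr_cmul.
  - by move=> y [].
  - by move=> x y; rewrite cmulBl.
  - by move=> x; exact: nr_cmul.
  - by move=> y [].
have Q0 : u ** 0 = 0 /\ 0 ** u = 0 by rewrite cmul0l cmul0r.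
have Ql (k : R[i]) x y : u ** x = x /\ x ** u = x -> u ** y = y /\ y ** u = y ->
    u ** (k *: x + y) = k *: x + y /\ (k *: x + y) ** u = k *: x + y.
  by move=> [h1 h2] [h3 h4]; rewrite cmulDl cmulDr cmulZl cmulZr h1 h2 h3 h4.
have Qm x y : u ** x = x /\ x ** u = x -> u ** y = y /\ y ** u = y ->
    u ** (x ** y) = x ** y /\ (x ** y) ** u = x ** y.
  by move=> [h1 h2] [h3 h4]; rewrite cmulA h1 -cmulA h4.
have Qs x : u ** x = x /\ x ** u = x -> u ** star x = star x /\ star x ** u = star x.
  by move=> [h1 h2]; rewrite -us -!starM h1 h2.
have hQ n (a : S n) : SubCstar Q0 Ql Qm Qs cl (mu n a).
  by rewrite /= -(uE n) -!(shM (hmu n)) (proj1 (eP n a)) (proj2 (eP n a)).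
move=> n e' he'; rewrite (unit_uniq he' (eP n)) uE => z.
exact: (inductive_limit_dense lim hQ z).
Qed.

Lemma tga_not_Z_stable (R : realType) (V : twist) (emb : (nat -> bool) -> V) (c : V -> nat -> bool) :
  (forall v k, tw v (emb k) = false) ->
  (forall g, exists M, forall n, (M <= n)%N -> c g n = false) ->
  (forall k g M, (forall n, (M <= n)%N -> c g n = false) ->
    tw (emb k) g = \big[addb/false]_(i < M) (k i && c g i)) ->
  (forall f g v, c f =1 c g -> tw v (f + g) = false) ->
  ~ Z_stable (tga R V).
Proof.
move=> h1 h2 h3 h4 [Z [[[eZ heZ] Zs Zi _ [p [q [S [phi [mu [dd hphi uphi lim]]]]]]] mt]].
have [j [B [hj j1 jB dense]]] := min_tensor_factor (@lamA0_unit R V) heZ mt.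
have [gam [g0 gD jG]] := limit_countable_support hj dd lim.
apply: (@no_invariant_vectors R V emb c h1 h2 h3 h4 Z (fun z => sc_val (j z)) _ gam).
- by move=> z; exact: tgaP.
- move=> kap kap0.
  (* Matrix sizes of at least k + 1 make the class bound 2 / (k + 1) smaller than kap. *)
  have [k hk] : exists k : nat, 2 / kap < k.+1%:R.
    have k2 : 0 <= 2 / kap by rewrite divr_ge0// ltW.
    by exists (Num.bound (2 / kap)); apply: lt_trans (archi_boundP k2) _; rewrite ltr_nat.
  have [n /andP[kp kq]] := jiang_su_large Zs Zi dd hphi uphi lim k.+1.
  have hmu : star_hom (mu n) by case: lim => + _; move=> /(_ n) [].
  have hf : star_hom (fun a => sc_val (j (mu n a))).
    exact: (star_hom_comp (star_hom_comp hmu hj) sc_val_star_hom).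
  have [|||es [f1 f2 f3]] := @small_frame R V (p n) (q n) (S n) (dd n) _ hf _ _ k.+1 _ kp kq => //.
  + by move=> b; exact: tgaP.
  + move=> e he; rewrite (unit_uniq (limit_unit dd uphi lim he) heZ) j1.
    exact: lam0.
  exists (map (mu n) es); split => [x|x|F uF hF]; rewrite big_map; [exact: f1|exact: f2|].
  apply: le_trans (f3 F uF hF) _; rewrite ler_pdivrMr ?ltr0n//.
  by rewrite mulrC -ler_pdivrMr// ltW.
- move=> chi; have [a [na sa ia]] := @invariant_vector R V Z j B jB dense _ g0 jG (emb chi) (fun v => h1 v chi).
  by exists a.
Qed.

(** * The group *)

Section Pairing.
Implicit Types (k : nat -> bool) (x y : {poly bool}).

(** Polynomials over the field with two elements serve as finitely supported bit sequences; the
    characters of their additive group are exactly the arbitrary sequences k. *)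
Definition pairing k x : bool := \big[addb/false]_(i < size x) (k i && x`_i).

Lemma big_addb_widen (F : nat -> bool) M N : (M <= N)%N -> (forall n, (M <= n)%N -> F n = false) ->
  \big[addb/false]_(i < M) F i = \big[addb/false]_(i < N) F i.
Proof.
move=> MN hF; rewrite -!(big_mkord xpredT F) [RHS](big_cat_nat _ (n := M))//=.
by rewrite [X in _ = _ (+) X]big_nat_cond [X in _ = _ (+) X]big1 ?addbF// => i /andP[/andP[Mi _] _]; rewrite hF.
Qed.

Lemma pairingE k x M : (size x <= M)%N -> pairing k x = \big[addb/false]_(i < M) (k i && x`_i).
Proof.
move=> sM; apply: (@big_addb_widen (fun i => k i && x`_i)) => // n hn.
by rewrite nth_default ?andbF.
Qed.

Lemma pairingDl k k' x : pairing (k + k') x = pairing k x (+) pairing k' x.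
Proof.
by rewrite /pairing -big_split; apply: eq_bigr => i _; rewrite -[(k + k') i]/(k i (+) k' i) andb_addl.
Qed.

Lemma pairingDr k x y : pairing k (x + y) = pairing k x (+) pairing k y.
Proof.
pose M := maxn (size x) (size y).
rewrite (@pairingE k (x + y) M) ?size_polyD// (@pairingE k x M) ?leq_maxl// (@pairingE k y M) ?leq_maxr//.
rewrite -big_split; apply: eq_bigr => i _.
by rewrite coefD -[x`_i + y`_i]/(x`_i (+) y`_i) andb_addr.
Qed.

Lemma pairing0l x : pairing 0 x = false.
Proof. by rewrite /pairing big1. Qed.

Lemma pairing0r k : pairing k 0 = false.
Proof. by rewrite /pairing big1// => i _; rewrite coef0 andbF. Qed.

Lemma pairingXn k n : pairing k 'X^n = k n.
Proof.
rewrite (@pairingE k _ n.+1) ?size_polyXn// (bigD1 ord_max)//= coefXn eqxx andbT.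
rewrite big1 ?addbF// => i ni; rewrite coefXn.
by rewrite (_ : (i == n :> nat) = false) ?andbF//; apply/negbTE.
Qed.

Lemma pairing_indic n x : pairing (fun i => i == n) x = x`_n.
Proof.
rewrite (@pairingE _ _ (maxn (size x) n.+1)) ?leq_maxl//.
have nM : (n < maxn (size x) n.+1)%N by exact: leq_maxr.
rewrite (bigD1 (Ordinal nM))//= eqxx big1 ?addbF// => i ni.
by rewrite (_ : (i == n :> nat) = false)//; apply/negbTE.
Qed.

Lemma polyb_char2 x : x + x = 0.
Proof. by apply/polyP => i; rewrite coefD coef0 -[_ + _]/(x`_i (+) x`_i) addbb. Qed.

Let X : zmodType := ({poly bool} * (nat -> bool))%type.
(** Half of the symplectic form: it has the same commutators up to sign-free equivalence of
    cocycles, but puts the elements (0, k) into its right kernel. *)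
Definition tw0 (g h : X) : bool := pairing g.2 h.1.

Lemma tw0Dl (f g h : X) : tw0 (f + g) h = tw0 f h (+) tw0 g h.
Proof. exact: pairingDl. Qed.

Lemma tw0Dr (f g h : X) : tw0 h (f + g) = tw0 h f (+) tw0 h g.
Proof. exact: pairingDr. Qed.

Lemma tw0_char2 (g : X) : g + g = 0.
Proof.
case: g => x k; congr (_, _); first exact: polyb_char2.
by apply/funext => n; exact: addbb.
Qed.

Lemma tw0_nondeg (g : X) : g != 0 -> exists h, tw0 h g (+) tw0 g h.
Proof.
case: g => x k g0; case: (pselect (exists n, k n)) => [[n kn]|nk].
  by exists ('X^n, 0); rewrite /tw0 /= pairing0l pairingXn.
have k0 : k = 0 by apply/funext => n; apply/negbTE/negP => kn; apply: nk; exists n.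
have x0 : x != 0 by apply: contra_neq g0 => ->; rewrite k0.
exists (0, fun i => i == (size x).-1); rewrite /tw0 /= pairing0r addbF pairing_indic.
by have := x0; rewrite -lead_coef_eq0 lead_coefE; case: (x`_ _).
Qed.

Definition base_twist := Twist tw0Dl tw0Dr tw0_char2 tw0_nondeg.

(** Beyond the degrees in F there are 2^|F| + 1 positions to compare, so two of them carry equal
    bits in every sequence of F. The sum of the two monomials is then orthogonal to F, and the
    indicator of one of the positions is orthogonal to F but not to that sum. *)
Lemma base_twist_orthogonal (F : seq base_twist) :
  exists g h, [/\ om g h, all (fun f => ~~ om g f) F & all (fun f => ~~ om h f) F].
Proof.
have [s hs] : exists s, forall f, f \in F -> (size (f : X).1 <= s)%N.
  elim: F => [|f F [s hs]]; first by exists 0%N.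
  exists (maxn (size (f : X).1) s) => g; rewrite inE => /orP[/eqP ->|/hs]; first exact: leq_maxl.
  by move=> h; apply: leq_trans h _; exact: leq_maxr.
pose fl := fun i : 'I_((2 ^ size F).+1) =>
  [ffun n : 'I_(size F) => ((nth 0 F n : X).2 (s + i)%N : bool)].
have : ~~ injectiveb fl.
  apply/negP => /injectiveP/leq_card; rewrite card_ffun card_bool !card_ord.
  by rewrite ltnn.
move=> /injectivePn [a [b ab fab]].
have nab : (s + a == s + b)%N = false by rewrite eqn_add2l; apply/negbTE.
exists (('X^(s + a) + 'X^(s + b), 0) : X), ((0, fun i => i == (s + a)%N) : X); split.
- rewrite /om /= /tw0 /= pairing0l addFb pairing_indic coefD !coefXn eqxx nab.
  by [].
- apply/allP => f fF; rewrite /om /= /tw0 /= pairing0l addFb pairingDr !pairingXn.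
  have iF : (index f F < size F)%N by rewrite index_mem.
  have := congr1 (fun h : {ffun 'I_(size F) -> bool} => h (Ordinal iF)) fab.
  by rewrite !ffunE /= nth_index// => ->; rewrite addbb.
- apply/allP => f fF; rewrite /om /= /tw0 /= pairing0r addbF pairing_indic nth_default//.
  by apply: leq_trans (hs f fF) _; exact: leq_addr.
Qed.

Lemma big_addb_double (F : nat -> bool) N : \big[addb/false]_(i < N.*2) F i =
  (\big[addb/false]_(i < N) F i.*2) (+) (\big[addb/false]_(i < N) F i.*2.+1).
Proof.
elim: N => [|N IH]; first by rewrite !big_ord0.
rewrite doubleS !big_ord_recr /= IH; do 2 case: (\big[_/_]_(_ < _) _).
all: by case: (F _); case: (F _).
Qed.

Definition square_twist := twprod base_twist base_twist.

(** One bit sequence feeds both copies of K by parity, so that Baire acts on a single Cantor space;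
    [mode] interleaves the two polynomial components in the same way. *)
Definition char_emb k : square_twist := ((0, fun n => k n.*2), (0, fun n => k n.*2.+1)).

Definition mode (g : square_twist) (n : nat) : bool :=
  if odd n then (g.2 : X).1`_(n./2) else (g.1 : X).1`_(n./2).

Lemma tw_char_emb_r (v : square_twist) k : tw v (char_emb k) = false.
Proof. by rewrite /= /twp /= /tw0 /= !pairing0r. Qed.

Lemma mode_fin (g : square_twist) : exists M, forall n, (M <= n)%N -> mode g n = false.
Proof.
exists (maxn (size (g.1 : X).1) (size (g.2 : X).1)).*2 => n; rewrite -geq_half_double geq_max.
by move=> /andP[h1 h2]; rewrite /mode; case: ifP => _; rewrite nth_default.
Qed.

Lemma tw_char_emb_l k (g : square_twist) M : (forall n, (M <= n)%N -> mode g n = false) ->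
  tw (char_emb k) g = \big[addb/false]_(i < M) (k i && mode g i).
Proof.
move=> hM; pose N := maxn M (maxn (size (g.1 : X).1) (size (g.2 : X).1)).
rewrite (@big_addb_widen (fun i => k i && mode g i) M N.*2); last 2 first.
- by rewrite -addnn (leq_trans (leq_maxl _ _) (leq_addr _ _)).
- by move=> n /hM ->; rewrite andbF.
rewrite (@big_addb_double (fun i => k i && mode g i)) /= /twp /= /tw0 /=.
rewrite (@pairingE _ _ N) ?(@pairingE _ (g.2 : X).1 N) /N ?leq_max ?leqnn ?orbT//.
congr (_ (+) _); apply: eq_bigr => i _; rewrite /mode /= odd_double /= ?doubleK//.
by rewrite uphalf_double.
Qed.

Lemma mode_class (f g v : square_twist) : mode f =1 mode g -> tw v (f + g) = false.
Proof.
move=> fg; rewrite /= /twp /= /tw0 /=.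
have -> : (f.1 : X).1 = (g.1 : X).1.
  by apply/polyP => n; have := fg n.*2; rewrite /mode odd_double doubleK.
have -> : (f.2 : X).1 = (g.2 : X).1.
  by apply/polyP => n; have := fg n.*2.+1; rewrite /mode /= odd_double /= uphalf_double.
by rewrite !polyb_char2 !pairing0r.
Qed.

End Pairing.

Theorem corollary5p1 (R : realType) :
  exists A : cstarAlgType R,
    [/\ simple_cstar A, nuclear A, ~ Z_stable A & ~ tensorially_prime A].
Proof.
exists (tga R square_twist); split.
- exact: tga_simple.
- exact: tga_nuclear.
- exact: (tga_not_Z_stable tw_char_emb_r mode_fin tw_char_emb_l mode_class).
- apply; exists (tga R base_twist), (tga R base_twist); split; try exact: tga_simple.
  + exact: tga_not_type_I base_twist_orthogonal.
  + exact: tga_not_type_I base_twist_orthogonal.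
  + exact: tga_min_tensor.
Qed.
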